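(* Let $n\ge0$ and let $\vec\varphi=(\varphi_0,\dots,\varphi_n)\in L^2(\mathbb R,\mathbb H^{n+1})$. Then $$\|\mathbb V_{\vec\psi}\vec\varphi\|_{L^2(\mathbb R^2,\mathbb H)}=\sqrt2\,\|\vec\varphi\|_{L^2(\mathbb R,\mathbb H^{n+1})}.$$
   Context: $\mathbb H$ is the skew field of quaternions; fix an imaginary unit $I\in\mathbb H$, $I^2=-1$. $\|f\|^2_{L^2(X,\mathbb H)}=\int_X|f|^2$ for $X=\mathbb R,\mathbb R^2$, and $\|\vec\varphi\|^2_{L^2(\mathbb R,\mathbb H^{n+1})}=\sum_{j=0}^n\|\varphi_j\|^2_{L^2(\mathbb R,\mathbb H)}$. $\vec\psi=(\psi_0,\dots,\psi_n)$ where $\psi_j=h_j/\|h_j\|_{L^2(\mathbb R)}$ with $h_j(t)=(-1)^je^{\pi t^2}\frac{d^j}{dt^j}e^{-2\pi t^2}$ (normalized weighted Hermite functions). The quaternionic Segal–Bargmann transform is $\mathcal B\varphi(q)=2^{3/4}\int_{\mathbb R}e^{-\pi(q^2+t^2)+2\pi\sqrt2\,qt}\varphi(t)\,dt$ (slice regular in $q\in\mathbb H$); the slice derivative is $\partial_sf(x+Jy)=\frac12(\partial_x-J\partial_y)f(x+Jy)$ for $J^2=-1$. The true quaternionic polyanalytic Bargmann transform is $B^{j+1}\varphi(q)=(-1)^j\sqrt{\frac{1}{(2\pi)^jj!}}\sum_{k=0}^j\binom jk(-2\pi\bar q)^k\partial_s^{j-k}\mathcal B\varphi(q)$, and the full-polyanalytic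 one is $\mathfrak B\vec\varphi=\sum_{j=0}^nB^{j+1}\varphi_j$. With $q=x+I\omega$, the full-poly QSTFT is the $\mathbb H$-valued function $\mathbb V_{\vec\psi}\vec\varphi(x,\omega)=e^{-I\pi x\omega}\mathfrak B(\vec\varphi)\left(\frac{\bar q}{\sqrt2}\right)e^{-\frac{|q|^2\pi}{2}}$, $(x,\omega)\in\mathbb R^2$. *)

(* Defs.v *)
From HB Require Import structures.
From mathcomp Require Import all_boot all_order all_algebra.
From mathcomp Require Import ring lra.
From mathcomp Require Import all_classical all_reals all_analysis.

Set Implicit Arguments.
Unset Strict Implicit.
Unset Printing Implicit Defensive.

Import Order.TTheory GRing.Theory Num.Theory.
Import numFieldNormedType.Exports.

Local Open Scope ring_scope.

(* [Quat a b c d] is a + b i + c j + d k. *)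
Record quat (R : Type) : Type :=
  Quat { q_re : R; q_i : R; q_j : R; q_k : R }.

Section QuatAlgebra.
Variable R : realType.
Implicit Types p q r : quat R.

Definition quat_tuple q := (q_re q, q_i q, q_j q, q_k q).
Definition tuple_quat (t : R * R * R * R) : quat R :=
  let: (a, b, c, d) := t in Quat a b c d.

Lemma quat_tupleK : cancel quat_tuple tuple_quat.
Proof. by case. Qed.

HB.instance Definition _ := Choice.copy (quat R) (can_type quat_tupleK).

Lemma quatP p q : q_re p = q_re q -> q_i p = q_i q -> q_j p = q_j q ->
  q_k p = q_k q -> p = q.
Proof. by case: p => ????; case: q => ???? /= -> -> -> ->. Qed.

Definition quat_add p q :=
  Quat (q_re p + q_re q) (q_i p + q_i q) (q_j p + q_j q) (q_k p + q_k q).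
Definition quat_opp p := Quat (- q_re p) (- q_i p) (- q_j p) (- q_k p).
Definition quat_mul p q := Quat
  (q_re p * q_re q - q_i p * q_i q - q_j p * q_j q - q_k p * q_k q)
  (q_re p * q_i q + q_i p * q_re q + q_j p * q_k q - q_k p * q_j q)
  (q_re p * q_j q - q_i p * q_k q + q_j p * q_re q + q_k p * q_i q)
  (q_re p * q_k q + q_i p * q_j q - q_j p * q_i q + q_k p * q_re q).
Definition quat_scale (a : R) q :=
  Quat (a * q_re q) (a * q_i q) (a * q_j q) (a * q_k q).
Definition quat_norm q : R :=
  Num.sqrt (q_re q ^+ 2 + q_i q ^+ 2 + q_j q ^+ 2 + q_k q ^+ 2).

Let addA : associative quat_add.
Proof. by move=> p q r; apply: quatP; rewrite /= addrA. Qed.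
Let addC : commutative quat_add.
Proof. by move=> p q; apply: quatP; rewrite /= addrC. Qed.
Let add0 : left_id (Quat 0 0 0 0) quat_add.
Proof. by move=> p; apply: quatP; rewrite /= add0r. Qed.
Let addN : left_inverse (Quat 0 0 0 0) quat_opp quat_add.
Proof. by move=> p; apply: quatP; rewrite /= addNr. Qed.

HB.instance Definition _ := GRing.isZmodule.Build (quat R) addA addC add0 addN.

Let mulA : associative quat_mul.
Proof. by move=> p q r; apply: quatP => /=; ring. Qed.
Let mul1 : left_id (Quat 1 0 0 0) quat_mul.
Proof. by move=> p; apply: quatP => /=; ring. Qed.
Let mulq1 : right_id (Quat 1 0 0 0) quat_mul.
Proof. by move=> p; apply: quatP => /=; ring. Qed.
Let mulDl : left_distributive quat_mul +%R.
Proof. by move=> p q r; apply: quatP => /=; ring. Qed.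
Let mulDr : right_distributive quat_mul +%R.
Proof. by move=> p q r; apply: quatP => /=; ring. Qed.
Let one_neq0 : Quat 1 0 0 0 != 0 :> quat R.
Proof. by apply/eqP => -[] /eqP; rewrite oner_eq0. Qed.

HB.instance Definition _ := GRing.Zmodule_isNzRing.Build (quat R)
  mulA mul1 mulq1 mulDl mulDr one_neq0.

Let scaleA a b q : quat_scale a (quat_scale b q) = quat_scale (a * b) q.
Proof. by apply: quatP; rewrite /= mulrA. Qed.
Let scale1 : left_id 1 quat_scale.
Proof. by move=> p; apply: quatP; rewrite /= mul1r. Qed.
Let scaleDr : right_distributive quat_scale +%R.
Proof. by move=> a p q; apply: quatP; rewrite /= mulrDr. Qed.
Let scaleDl q : {morph quat_scale^~ q : a b / a + b}.
Proof. by move=> a b; apply: quatP; rewrite /= mulrDl. Qed.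

HB.instance Definition _ := GRing.Zmodule_isLmodule.Build R (quat R)
  scaleA scale1 scaleDr scaleDl.

Let scaleAl (a : R) p q : a *: (p * q) = a *: p * q.
Proof. by apply: quatP => /=; ring. Qed.
HB.instance Definition _ :=
  GRing.Lmodule_isLalgebra.Build R (quat R) scaleAl.

Let scaleAr (a : R) p q : a *: (p * q) = p * (a *: q).
Proof. by apply: quatP => /=; ring. Qed.
HB.instance Definition _ :=
  GRing.Lalgebra_isAlgebra.Build R (quat R) scaleAr.

Let normD p q : quat_norm (p + q) <= quat_norm p + quat_norm q.
Proof.
case: p => a b c d; case: q => a' b' c' d'; rewrite /quat_norm /=.
set S := a ^+ 2 + _ + _ + _; set T := a' ^+ 2 + _ + _ + _.
have S0 : 0 <= S by rewrite !addr_ge0 ?sqr_ge0.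
have T0 : 0 <= T by rewrite !addr_ge0 ?sqr_ge0.
have CS : a * a' + b * b' + c * c' + d * d' <= Num.sqrt S * Num.sqrt T.
  rewrite -sqrtrM//; apply: le_trans (ler_norm _) _.
  rewrite -sqrtr_sqr; apply: ler_wsqrtr.
  rewrite -subr_ge0.
  rewrite (_ : _ - _ = (a * b' - b * a') ^+ 2 + (a * c' - c * a') ^+ 2 +
    (a * d' - d * a') ^+ 2 + (b * c' - c * b') ^+ 2 +
    (b * d' - d * b') ^+ 2 + (c * d' - d * c') ^+ 2); last first.
    by rewrite /S /T; ring.
  by rewrite !addr_ge0 ?sqr_ge0.
have SE : Num.sqrt S ^+ 2 = S by rewrite sqr_sqrtr.
have TE : Num.sqrt T ^+ 2 = T by rewrite sqr_sqrtr.
move: (Num.sqrt S) (Num.sqrt T) (sqrtr_ge0 S) (sqrtr_ge0 T) CS SE TE.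
move=> s t s0 t0 CS SE TE.
rewrite -[leRHS]ger0_norm ?addr_ge0// -sqrtr_sqr; apply: ler_wsqrtr.
rewrite /S /T in SE TE; lra.
Qed.
Let normZ (a : R) q : quat_norm (a *: q) = `|a| * quat_norm q.
Proof.
case: q => b c d e; rewrite /quat_norm /= !exprMn -!mulrDr.
by rewrite sqrtrM ?sqr_ge0// sqrtr_sqr.
Qed.
Let norm0 q : quat_norm q = 0 -> q = 0.
Proof.
case: q => a b c d /eqP; rewrite /quat_norm /= sqrtr_eq0 => h.
have := sqr_ge0 a; have := sqr_ge0 b; have := sqr_ge0 c; have := sqr_ge0 d.
move=> d0 c0 b0 a0.
by apply: quatP; apply/eqP; rewrite /= -sqrf_eq0; apply/eqP; lra.
Qed.

(* [`|q|] is the Euclidean modulus of q. *)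
HB.instance Definition _ := Lmodule_isNormed.Build R (quat R) normD normZ norm0.

Definition quat_conj q := Quat (q_re q) (- q_i q) (- q_j q) (- q_k q).
Definition quat_im q := Quat 0 (q_i q) (q_j q) (q_k q).

Definition quat_exp q : quat R :=
  limn (series (fun k : nat => k`!%:R^-1 *: q ^+ k)).

(* Writing q = x + J y with J ^ 2 = -1, [slice_unit q] is such a J, the one
   with y > 0 if q is not real.  At a real q every J is admissible, and a slice
   regular function has the same slice derivative for all of them. *)
Definition slice_unit q : quat R :=
  if quat_im q == 0 then Quat 0 1 0 0 else `|quat_im q|^-1 *: quat_im q.

(* At q = x + J y the partial derivatives in x and y are the derivatives of f
   in the directions 1 and J. *)
Definition slice_derive (f : quat R -> quat R) q : quat R :=
  2^-1 *: ('D_1 f q - slice_unit q * 'D_(slice_unit q) f q).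

End QuatAlgebra.

Section L2.
Context {R : realType} {d : measure_display} {T : measurableType d}.
Variable mu : {measure set T -> \bar R}.
Implicit Type f : T -> quat R.

Definition quat_measurable f : Prop :=
  [/\ measurable_fun setT (fun x => q_re (f x)),
      measurable_fun setT (fun x => q_i (f x)),
      measurable_fun setT (fun x => q_j (f x)) &
      measurable_fun setT (fun x => q_k (f x))].

Definition quat_integral f : quat R :=
  Quat (\int[mu]_x q_re (f x)) (\int[mu]_x q_i (f x))
       (\int[mu]_x q_j (f x)) (\int[mu]_x q_k (f x)).

Definition L2norm f : \bar R := sqrte (\int[mu]_x (`|f x| ^+ 2)%:E)%E.

Definition inL2 f : Prop := quat_measurable f /\ (L2norm f < +oo)%E.

Definition L2norm_vec n (phi : 'I_n -> T -> quat R) : \bar R :=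
  sqrte (\sum_(j < n) L2norm (phi j) ^+ 2)%E.

End L2.

Section Transforms.
Variable R : realType.
Implicit Types (phi : R -> quat R) (q : quat R).

Definition bargmann phi q : quat R :=
  (2 `^ (3 / 4)) *: quat_integral lebesgue_measure (fun t : R =>
    quat_exp (- pi *: (q ^+ 2 + (t ^+ 2)%:A) + (2 * pi * Num.sqrt 2 * t) *: q)
    * phi t).

(* [true_bargmann j] is the transform usually written B^{j+1}. *)
Definition true_bargmann (j : nat) phi q : quat R :=
  ((-1) ^+ j * Num.sqrt (1 / ((2 * pi) ^+ j * j`!%:R))) *:
  \sum_(k < j.+1) 'C(j, k)%:R *:
    ((- (2 * pi) *: quat_conj q) ^+ k
     * iter (j - k)%N (@slice_derive R) (bargmann phi) q).

Definition full_bargmann n (phi : 'I_n.+1 -> R -> quat R) q : quat R :=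
  \sum_(j < n.+1) true_bargmann j (phi j) q.

(* The windows are the fixed normalized weighted Hermite functions; they do not
   occur in this expression of the transform, which is the one by which it is
   defined from the Bargmann transform. *)
Definition full_poly_qstft n (I : quat R) (phi : 'I_n.+1 -> R -> quat R)
    (z : R * R) : quat R :=
  let: (x, w) := z in
  let q := x%:A + w *: I in
  quat_exp (- (pi * x * w) *: I)
  * full_bargmann phi ((Num.sqrt 2)^-1 *: quat_conj q)
  * (expR (- (`|q| ^+ 2 * pi / 2)))%:A.

End Transforms.

(* Main.v *)
(* The kernel k(q, t) = exp (- pi (q^2 + t^2) + 2 pi sqrt 2 q t) satisfies
   d_s k = ell k with ell = 2 pi (sqrt 2 t - q), so its iterated slice derivatives are
   herm m ell * k, where herm m is a Hermite polynomial.  The Appell identity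
     sum_k C(j, k) x^k herm (j - k) y = herm j (x + y)
   with x = - 2 pi conj q collapses the true polyanalytic transform to a single integral
   whose Hermite factor has a real argument, and after the Gaussian normalisation
     V (x, w) = int exp (- 2 pi I w t) sum_j window_j (t - x) phi_j t dt.
   Plancherel in w, for fixed x, followed by Tonelli and the orthogonality of the windows in x
   gives the square of the norm.  Plancherel for a real g that is both integrable and square
   integrable is obtained by regularising with exp (- e |w|): its Fourier transform is the
   Poisson kernel, an approximate identity, and translations are continuous in L2. *)

From HB Require Import structures.
Require Import Defs.
From mathcomp Require Import all_boot all_order all_algebra.
From mathcomp Require Import ring lra.
From mathcomp Require Import all_classical all_reals all_analysis measurable_realfun.

Set Implicit Arguments.
Unset Strict Implicit.
Unset Printing Implicit Defensive.

Import Order.TTheory GRing.Theory Num.Theory.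
Import numFieldNormedType.Exports.
Local Open Scope classical_set_scope.
Local Open Scope ring_scope.

(** * Quaternion coordinates and slices *)
Section Coordinates.
Variable R : realType.
Implicit Types (p q J : quat R) (k : 'I_4).

(** Noncommutativity shapes the proof. The kernel, its iterated slice derivatives, the powers of - 2
    pi conj q and the prefactor exp (- pi I x w) all lie in one slice R + R J, a copy of the complex
    numbers; exponentials and the Appell identity are used only there, and the signal stays on the
    right of every product. On the Fourier side the values of the signal need not commute with I, so
    the transform is split into a cosine and a sine part acting on real coordinates; the cross terms
    between the two are odd in w and vanish only after integration. Plancherel on the intersection
    of L1 and L2 suffices because, for fixed x, the Gaussian decay of the windows puts the integrand
    in both spaces. The exchanges of integrals in the final computation concern nonnegative
    functions, so Tonelli applies before anything is known to be finite. The factor 2 between the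
    squared norms is (2^(3/4))^2, from the Bargmann transform, times 2^(-1/2), the integral of exp
    (- 2 pi s^2). *)

(** Indexing the real coordinates by ['I_4] turns norms into sums and lets integrals, derivatives
    and limits be treated one coordinate at a time. *)
Definition qcoord k q : R := nth 0 [:: q_re q; q_i q; q_j q; q_k q] k.

Lemma qcoord_is_scalar k : scalar (qcoord k).
Proof. by move=> a p q; case: k => [[|[|[|[|//]]]] ?]. Qed.

HB.instance Definition _ k :=
  GRing.isLinear.Build R (quat R) R *%R (qcoord k) (qcoord_is_scalar k).

Lemma qcoordP p q : (forall k, qcoord k p = qcoord k q) -> p = q.
Proof.
move=> pq; apply: quatP.
- exact: (pq (@Ordinal 4 0 isT)).
- exact: (pq (@Ordinal 4 1 isT)).
- exact: (pq (@Ordinal 4 2 isT)).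
- exact: (pq (@Ordinal 4 3 isT)).
Qed.

Lemma sum_qcoord (F : R -> R) q :
  \sum_(k < 4) F (qcoord k q) = F (q_re q) + F (q_i q) + F (q_j q) + F (q_k q).
Proof. by rewrite !big_ord_recr big_ord0 /= add0r. Qed.

Lemma normq_sqr q : `|q| ^+ 2 = \sum_(k < 4) qcoord k q ^+ 2.
Proof.
rewrite (sum_qcoord (fun x => x ^+ 2)).
by rewrite [LHS]sqr_sqrtr// !addr_ge0 ?sqr_ge0.
Qed.

Lemma normq_sqrE q : `|q| ^+ 2 = q_re q ^+ 2 + q_i q ^+ 2 + q_j q ^+ 2 + q_k q ^+ 2.
Proof. by rewrite normq_sqr (sum_qcoord (fun x => x ^+ 2)). Qed.

(** This is Euler's four-square identity, compared through squares, which are injective on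
    nonnegative reals. *)
Lemma normqM p q : `|p * q| = `|p| * `|q|.
Proof.
apply: (@pexpIrn _ 2) => //; rewrite ?nnegrE ?mulr_ge0//.
by rewrite exprMn !normq_sqrE /=; ring.
Qed.

Lemma normqX p n : `|p ^+ n| = `|p| ^+ n.
Proof.
elim: n => [|n ih]; last by rewrite !exprS normqM ih.
apply: (@pexpIrn _ 2) => //; rewrite ?nnegrE//.
by rewrite normq_sqrE /= !expr0 !expr1n !expr0n /= !addr0.
Qed.

Lemma norm_qcoord k q : `|qcoord k q| <= `|q|.
Proof.
rewrite -(ler_pXn2r (n := 2)) ?nnegrE//.
by rewrite normq_sqr real_normK ?num_real// (bigD1 k)//= lerDl sumr_ge0// => i _; rewrite sqr_ge0.
Qed.

Lemma normq_le q : `|q| <= \sum_(k < 4) `|qcoord k q|.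
Proof.
rewrite -(ler_pXn2r (n := 2)) ?nnegrE// ?sumr_ge0//.
rewrite normq_sqrE (sum_qcoord Num.norm).
have h x : `|x : R| ^+ 2 = x ^+ 2 by rewrite real_normK ?num_real.
rewrite -(h (q_re q)) -(h (q_i q)) -(h (q_j q)) -(h (q_k q)).
have := normr_ge0 (q_re q); have := normr_ge0 (q_i q).
have := normr_ge0 (q_j q); have := normr_ge0 (q_k q); nra.
Qed.

Lemma scaleq_mul (a : R) q : a *: q = a%:A * q.
Proof. by rewrite -scalerAl mul1r. Qed.

Lemma norm_alg (a : R) : `|a%:A : quat R| = `|a|.
Proof. by rewrite normrZ -(expr0 (1 : quat R)) normqX expr0 mulr1. Qed.

(** When J ^ 2 = -1 this is the point a + b i of a commutative copy of the complex numbers. *)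
Definition slice (J : quat R) (a b : R) : quat R := a%:A + b *: J.

Lemma sliceD J a b c d : slice J a b + slice J c d = slice J (a + c) (b + d).
Proof. by rewrite /slice !scalerDl addrACA. Qed.

Lemma sliceZ J c a b : c *: slice J a b = slice J (c * a) (c * b).
Proof. by rewrite /slice scalerDr !scalerA. Qed.

Lemma slice_real J a : slice J a 0 = a%:A.
Proof. by rewrite /slice scale0r addr0. Qed.

Lemma slice_unitE J : slice J 0 1 = J.
Proof. by rewrite /slice scale0r add0r scale1r. Qed.

Lemma sliceM J a b c d : J ^+ 2 = -1 ->
  slice J a b * slice J c d = slice J (a * c - b * d) (a * d + b * c).
Proof.
move=> J2; rewrite /slice mulrDl !mulrDr -!scalerAl -!scalerAr !mul1r mulr1.
rewrite -expr2 J2 !scalerA !scalerBl !scalerDl !scalerN.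
by rewrite addrACA [RHS]addrAC -!addrA; congr (_ + _); rewrite addrCA; congr (_ + _); rewrite addrC.
Qed.

Lemma sliceC J a b c d : J ^+ 2 = -1 -> slice J a b * slice J c d = slice J c d * slice J a b.
Proof. by move=> J2; rewrite !sliceM//; congr slice; ring. Qed.

(** If the real part a were nonzero, the imaginary coordinates 2 a b, 2 a c, 2 a d of the square
    would force b = c = d = 0, leaving a ^ 2 = -1. *)
Lemma unit_coords J : J ^+ 2 = -1 ->
  q_re J = 0 /\ q_i J ^+ 2 + q_j J ^+ 2 + q_k J ^+ 2 = 1.
Proof.
case: J => a b c d; rewrite expr2 => -[] /= e1 e2 e3 e4.
have [a0|a0] := eqVneq a 0.
  by split=> //; move: e1; rewrite a0; lra.
have z x : a * x + x * a = 0 -> x = 0.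
  by move=> /eqP; rewrite mulrC -mulr2n mulrn_eq0 /= mulf_eq0 (negbTE a0) orbF => /eqP.
have hb : b = 0 by apply: z; lra.
have hc : c = 0 by apply: z; lra.
have hd : d = 0 by apply: z; lra.
move: e1; rewrite hb hc hd => e1; have := sqr_ge0 a; rewrite expr2; lra.
Qed.

Lemma norm_slice_sqr J a b : J ^+ 2 = -1 -> `|slice J a b| ^+ 2 = a ^+ 2 + b ^+ 2.
Proof.
move=> /unit_coords[]; case: J => x y z t /= -> e.
rewrite normq_sqrE /= !mulr0 !mulr1 !add0r !addr0 !exprMn.
by rewrite -[in RHS](mulr1 (b ^+ 2)) -e; ring.
Qed.

Lemma norm_unit J : J ^+ 2 = -1 -> `|J| = 1.
Proof.
move=> J2; apply: (@pexpIrn _ 2) => //; rewrite ?nnegrE//.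
by rewrite -(slice_unitE J) norm_slice_sqr// expr0n add0r.
Qed.

Lemma conj_slice J a b : J ^+ 2 = -1 -> quat_conj (slice J a b) = slice J a (- b).
Proof.
move=> /unit_coords[]; case: J => x y z t /= -> e.
by apply: quatP => /=; rewrite ?mulNr; ring.
Qed.

Lemma slice_unit_sqr q : slice_unit q ^+ 2 = -1.
Proof.
rewrite /slice_unit; case: ifPn => [_|h].
  by apply: quatP; rewrite expr2 /=; ring.
rewrite exprZn exprVn normq_sqrE expr2.
have n0 : q_i q ^+ 2 + q_j q ^+ 2 + q_k q ^+ 2 != 0.
  rewrite [X in X != _](_ : _ = `|quat_im q| ^+ 2) ?expf_neq0 ?normr_eq0//.
  by rewrite normq_sqrE /= expr0n add0r.
by apply: quatP => /=; field; rewrite ?expr0n/= ?add0r.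
Qed.

(** Slices cover the quaternions, so a pointwise claim need only be proved inside one slice. *)
Lemma slice_unit_decomp q : exists b, q = slice (slice_unit q) (q_re q) b.
Proof.
rewrite /slice_unit; case: ifPn => [/eqP[h1 h2 h3]|h].
  by exists 0; apply: quatP => /=; rewrite ?h1 ?h2 ?h3; ring.
exists `|quat_im q|.
rewrite /slice scalerA divff ?normr_eq0// scale1r.
by apply: quatP => /=; ring.
Qed.

End Coordinates.

(** * Calculus along real curves in the quaternions, and the exponential *)

Section QuatDerivative.
Variable R : realType.
Implicit Types (f g : R -> quat R) (p q J : quat R) (x : R).

(** Coordinatewise, so that the real product rule and mean value theorem apply directly. *)
Definition qderiv f x p :=
  forall k, is_derive x 1 (fun s => qcoord k (f s)) (qcoord k p).

Lemma qderivP f x p :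
  is_derive x 1 (fun s => q_re (f s)) (q_re p) ->
  is_derive x 1 (fun s => q_i (f s)) (q_i p) ->
  is_derive x 1 (fun s => q_j (f s)) (q_j p) ->
  is_derive x 1 (fun s => q_k (f s)) (q_k p) -> qderiv f x p.
Proof. by move=> h0 h1 h2 h3; case=> [[|[|[|[|//]]]] ?]. Qed.

Lemma qderivE f x p : qderiv f x p ->
  [/\ is_derive x 1 (fun s => q_re (f s)) (q_re p),
  is_derive x 1 (fun s => q_i (f s)) (q_i p),
  is_derive x 1 (fun s => q_j (f s)) (q_j p) &
  is_derive x 1 (fun s => q_k (f s)) (q_k p)].
Proof.
move=> h; split; [exact: (h (@Ordinal 4 0 isT))|exact: (h (@Ordinal 4 1 isT))|
  exact: (h (@Ordinal 4 2 isT))|exact: (h (@Ordinal 4 3 isT))].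
Qed.

Lemma qderiv_eq f x p q : qderiv f x p -> p = q -> qderiv f x q.
Proof. by move=> + <-. Qed.

Lemma qderiv_cst p x : qderiv (fun=> p) x 0.
Proof. by move=> k; rewrite linear0; exact: is_derive_cst. Qed.

Lemma qderivD f g x p q : qderiv f x p -> qderiv g x q ->
  qderiv (fun s => f s + g s) x (p + q).
Proof.
move=> hf hg k; rewrite linearD.
under eq_fun do rewrite linearD.
by have := hf k; have := hg k => ? ?; apply: is_deriveD.
Qed.

Lemma qderivZ f x p (a : R) : qderiv f x p -> qderiv (fun s => a *: f s) x (a *: p).
Proof.
move=> hf k; rewrite linearZ.
under eq_fun do rewrite linearZ.
by have := hf k => ?; apply: is_deriveZ.
Qed.

Lemma qderivN f x p : qderiv f x p -> qderiv (fun s => - f s) x (- p).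
Proof.
move=> hf k; rewrite linearN.
under eq_fun do rewrite linearN.
by have := hf k => ?; apply: is_deriveN.
Qed.

Lemma qderiv_sum n (f : 'I_n -> R -> quat R) x (p : 'I_n -> quat R) :
  (forall i, qderiv (f i) x (p i)) ->
  qderiv (fun s => \sum_(i < n) f i s) x (\sum_(i < n) p i).
Proof.
move=> hf; elim: n f p hf => [|n ih] f p hf.
  by under eq_fun do rewrite big_ord0; rewrite big_ord0; exact: qderiv_cst.
under eq_fun do rewrite big_ord_recr /=.
by rewrite big_ord_recr /=; apply: qderivD => //; apply: ih.
Qed.

(** Each coordinate of a quaternion product is a signed sum of four products whose first sign can be
    taken positive; a, b, c stand for the other signs. *)
Lemma is_derive_bilin (a b c : R) (u v w u' v' w' : R -> R) (du dv dw du' dv' dw' x : R)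
    (z z' : R -> R) (dz dz' : R) :
  is_derive x 1 u du -> is_derive x 1 v dv -> is_derive x 1 w dw ->
  is_derive x 1 z dz ->
  is_derive x 1 u' du' -> is_derive x 1 v' dv' -> is_derive x 1 w' dw' ->
  is_derive x 1 z' dz' ->
  is_derive x 1 (fun s => u s * u' s + a * (v s * v' s) + b * (w s * w' s) + c * (z s * z' s))
    ((u x * du' + u' x * du) + a * (v x * dv' + v' x * dv) +
     b * (w x * dw' + w' x * dw) + c * (z x * dz' + z' x * dz)).
Proof.
move=> hu hv hw hz hu' hv' hw' hz'.
have M (f g : R -> R) (df dg e : R) : is_derive x 1 f df -> is_derive x 1 g dg ->
    is_derive x 1 (fun s => e * (f s * g s)) (e * (f x * dg + g x * df)).
  move=> hf hg; exact: (@is_deriveZ _ _ _ _ e _ _ _ (is_deriveM hf hg)).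
have Mu : is_derive x 1 (fun s => u s * u' s) (u x * du' + u' x * du).
  exact: (is_deriveM hu hu').
exact: (is_deriveD (is_deriveD (is_deriveD Mu (M _ _ _ _ a hv hv')) (M _ _ _ _ b hw hw')) (M _ _ _ _ c hz hz')).
Qed.

Lemma qderivM f g x p q : qderiv f x p -> qderiv g x q ->
  qderiv (fun s => f s * g s) x (p * g x + f x * q).
Proof.
move=> /qderivE[f0 f1 f2 f3] /qderivE[g0 g1 g2 g3].
apply: qderivP => /=.
- have := is_derive_bilin (-1) (-1) (-1) f0 f1 f2 f3 g0 g1 g2 g3.
  by under eq_fun do rewrite !mulN1r; move=> h; apply: is_derive_eq; ring.
- have := is_derive_bilin 1 1 (-1) f0 f1 f2 f3 g1 g0 g3 g2.
  by under eq_fun do rewrite !mulN1r !mul1r; move=> h; apply: is_derive_eq; ring.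
- have := is_derive_bilin (-1) 1 1 f0 f1 f2 f3 g2 g3 g0 g1.
  by under eq_fun do rewrite !mulN1r !mul1r; move=> h; apply: is_derive_eq; ring.
- have := is_derive_bilin 1 (-1) 1 f0 f1 f2 f3 g3 g2 g1 g0.
  by under eq_fun do rewrite !mulN1r !mul1r; move=> h; apply: is_derive_eq; ring.
Qed.

Lemma qderiv_slice J (u v : R -> R) x du dv :
  is_derive x 1 u du -> is_derive x 1 v dv ->
  qderiv (fun s => slice J (u s) (v s)) x (slice J du dv).
Proof.
move=> hu hv k; rewrite linearD !linearZ /=.
rewrite (_ : (fun s => _) = qcoord k 1 \*: u + qcoord k J \*: v); last first.
  by apply/funext => s; rewrite linearD !linearZ /= mulrC [X in _ + X]mulrC.
by apply: is_derive_eq; rewrite /GRing.scale /=; ring.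
Qed.

(** Both g + f and g - f vanish at 0 and have nonnegative derivative on [0, t]. *)
Lemma mean_value_bound (f g df dg : R -> R) (t : R) : 0 <= t ->
  (forall x, is_derive x 1 f (df x)) -> (forall x, is_derive x 1 g (dg x)) ->
  f 0 = 0 -> g 0 = 0 -> (forall x, 0 <= x <= t -> `|df x| <= dg x) ->
  `|f t| <= g t.
Proof.
rewrite le_eqVlt => /predU1P[<-|t0] hf hg f0 g0 h; first by rewrite f0 g0 normr0.
have H (F dF : R -> R) : (forall x, is_derive x 1 F (dF x)) -> F 0 = 0 ->
    (forall x, 0 <= x <= t -> 0 <= dF x) -> 0 <= F t.
  move=> hF F0 dF0.
  have hF' x : x \in `]0, t[ -> is_derive x 1 F (dF x) by move=> _; exact: hF.
  have cF : {within `[0, t], continuous F}.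
    by apply/continuous_subspaceT => x; apply/differentiable_continuous/derivable1_diffP; have [] := hF x.
  have [c] := MVT t0 hF' cF; rewrite in_itv /= => /andP[c0 ct]; rewrite F0 !subr0 => ->.
  by rewrite mulr_ge0 ?(ltW t0)// dF0// (ltW c0) (ltW ct).
rewrite ler_norml -subr_ge0 opprK addrC -[X in _ && X]subr_ge0; apply/andP; split.
  apply: (H (g + f) (fun x => dg x + df x)).
  - by rewrite fctE f0 g0 addr0.
  - by move=> x /h; rewrite ler_norml => /andP[]; lra.
apply: (H (g - f) (fun x => dg x - df x)).
- by rewrite [LHS](_ : _ = g 0 - f 0)// g0 f0 subr0.
- by move=> x /h; rewrite ler_norml => /andP[]; lra.
Qed.

Lemma cvg_quat (T : Type) (F : set_system T) (FF : Filter F) (f : T -> quat R) p :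
  (forall k, qcoord k (f x) @[x --> F] --> qcoord k p) -> f x @[x --> F] --> p.
Proof.
move=> h; apply/cvgrPdist_le => e e0.
have e4 : 0 < e / 4 by rewrite divr_gt0.
have H k : \forall x \near F, `|qcoord k p - qcoord k (f x)| <= e / 4.
  by move/cvgrPdist_le : (h k) => /(_ _ e4).
near=> x.
have h0 : `|qcoord (@Ordinal 4 0 isT) p - qcoord (@Ordinal 4 0 isT) (f x)| <= e / 4 by near: x; exact: H.
have h1 : `|qcoord (@Ordinal 4 1 isT) p - qcoord (@Ordinal 4 1 isT) (f x)| <= e / 4 by near: x; exact: H.
have h2 : `|qcoord (@Ordinal 4 2 isT) p - qcoord (@Ordinal 4 2 isT) (f x)| <= e / 4 by near: x; exact: H.
have h3 : `|qcoord (@Ordinal 4 3 isT) p - qcoord (@Ordinal 4 3 isT) (f x)| <= e / 4 by near: x; exact: H.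
apply: (le_trans (normq_le _)).
rewrite (sum_qcoord Num.norm) /=.
by rewrite [leRHS](_ : _ = e / 4 + e / 4 + e / 4 + e / 4) ?lerD//; field.
Unshelve. all: by end_near. Qed.

Lemma quat_cvg_lim (T : Type) (F : set_system T) (FF : ProperFilter F) (f : T -> quat R) p :
  f x @[x --> F] --> p -> lim (f x @[x --> F]) = p.
Proof. by apply: cvg_lim => //; exact: norm_hausdorff. Qed.

Lemma is_derive_monomial (c : R) n x :
  is_derive x 1 (fun s => c * s ^+ n.+1) (c * (n.+1%:R * x ^+ n)).
Proof.
rewrite (_ : (fun s => _) = c \*: (@GRing.exp R ^~ n.+1))//.
have : is_derive x 1 (@GRing.exp R ^~ n.+1) (n.+1%:R * x ^+ n).
  apply: DeriveDef; last by rewrite exp_derive /GRing.scale /= mulr1.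
  exact: exprn_derivable.
by move=> h; exact: is_deriveZ.
Qed.

(** Euler's formula, by estimating a Taylor remainder. The curve [c] solves c' = z c with c 0 = 1,
    so its remainders satisfy r_(n+1)' = z r_n and r_(n+1) 0 = 0; integrating repeatedly bounds r_n
    by a term of an exponential series. *)
Lemma quat_exp_slice J a b : J ^+ 2 = -1 ->
  quat_exp (slice J a b) = expR a *: slice J (cos b) (sin b).
Proof.
move=> J2; set z := slice J a b.
pose c (t : R) := slice J (expR (t * a) * cos (t * b)) (expR (t * a) * sin (t * b)).
pose r n t := c t - \sum_(k < n) (t ^+ k / k`!%:R) *: z ^+ k.
have dc t : qderiv c t (z * c t).
  rewrite sliceM//; apply: qderiv_slice.
    rewrite (_ : (fun s => _) = (expR \o ( *%R ^~ a)) * (cos \o ( *%R ^~ b)))//.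
    apply: is_derive_eq; rewrite /GRing.scale /=; ring.
  rewrite (_ : (fun s => _) = (expR \o ( *%R ^~ a)) * (sin \o ( *%R ^~ b)))//.
  apply: is_derive_eq; rewrite /GRing.scale /=; ring.
have dmon k (t : R) : qderiv (fun s => (s ^+ k.+1 / k.+1`!%:R) *: z ^+ k.+1) t (z * ((t ^+ k / k`!%:R) *: z ^+ k)).
  rewrite -scalerAr -exprS; move: (z ^+ k.+1) => y l; rewrite !linearZ /=.
  rewrite (_ : (fun s => _) = (fun s => qcoord l y / k.+1`!%:R * s ^+ k.+1)); last first.
    by apply/funext => s /=; rewrite linearZ /=; ring.
  apply: (is_derive_eq (is_derive_monomial _ _ _)).
  rewrite /GRing.scale /= factS natrM.
  have k0 : (k`!%:R : R) != 0 by rewrite pnatr_eq0 -lt0n fact_gt0.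
  have k1 : (k.+1%:R : R) != 0 by rewrite pnatr_eq0.
  by rewrite -mulr_natr; field; rewrite k0 addrC natr1 k1.
have dr n t : qderiv (r n.+1) t (z * r n t).
  rewrite /r mulrBr; apply: qderivD; first exact: dc.
  apply: qderivN; under eq_fun do rewrite big_ord_recl.
  rewrite mulr_sumr -[\sum_(_ < _) _]add0r; apply: qderivD.
    by under eq_fun do rewrite expr0 fact0; exact: qderiv_cst.
  by apply: qderiv_sum => i; exact: dmon.
have r0 n : r n.+1 0 = 0.
  rewrite /r /c big_ord_recl /= big1 ?addr0; last first.
    by move=> i _; rewrite expr0n /= mul0r scale0r.
  by rewrite !mul0r expR0 cos0 sin0 !mul1r slice_real expr0 fact0 invr1 scale1r subrr.
pose M := expR `|a|.
(* The mean value bound is applied to each coordinate, and adding the four bounds costs a factor 4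
   per integration. [M] bounds |c| on [0, 1]. *)
have bnd n t : 0 <= t <= 1 -> `|r n t| <= M * (4 * `|z|) ^+ n / n`!%:R * t ^+ n.
  elim: n t => [|n ih] t /andP[t0 t1].
    rewrite /r big_ord0 subr0 !expr0 fact0 invr1 !mulr1 /c.
    rewrite -(ler_pXn2r (n := 2)) ?nnegrE// ?expR_ge0//.
    rewrite norm_slice_sqr// !exprMn -mulrDr cos2Dsin2 mulr1.
    rewrite ler_pXn2r ?nnegrE ?expR_ge0// ler_expR (le_trans (ler_norm _))//.
    by rewrite normrM ger0_norm// ler_piMl.
  pose C := M * (4 * `|z|) ^+ n / n`!%:R.
  have k0 : (n`!%:R : R) != 0 by rewrite pnatr_eq0 -lt0n fact_gt0.
  have k1 : (1 + n%:R : R) != 0 by rewrite addrC natr1 pnatr_eq0.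
  have C0 : 0 <= C by rewrite divr_ge0// mulr_ge0 ?expR_ge0// exprn_ge0// mulr_ge0.
  have H l : `|qcoord l (r n.+1 t)| <= C * `|z| / n.+1%:R * t ^+ n.+1.
    pose f s := qcoord l (r n.+1 s).
    pose g (s : R) := C * `|z| / n.+1%:R * s ^+ n.+1.
    rewrite -/(f t) -/(g t).
    have df x : is_derive x 1 f (qcoord l (z * r n x)) by exact: dr.
    have dg x : is_derive x 1 g (C * `|z| * x ^+ n).
      apply: (is_derive_eq (is_derive_monomial _ _ _)).
      by rewrite -natr1; field; rewrite addrC.
    apply: (mean_value_bound t0 df dg).
    - by rewrite /f r0 linear0.
    - by rewrite /g expr0n /= mulr0.
    - move=> x /andP[x0 xt]; rewrite (le_trans (norm_qcoord _ _))// normqM.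
      rewrite (_ : C * `|z| * x ^+ n = `|z| * (C * x ^+ n)); last by ring.
      by rewrite ler_wpM2l// ih// x0 (le_trans xt).
  apply: (le_trans (normq_le _)).
  apply: (@le_trans _ _ (\sum_(k < 4) (C * `|z| / n.+1%:R * t ^+ n.+1))).
    by apply: ler_sum => l _; exact: H.
  rewrite sumr_const card_ord -mulr_natr /C factS natrM !exprS -natr1.
  by rewrite le_eqVlt; apply/orP; left; apply/eqP; field; rewrite ?k0 ?[n%:R + 1]addrC ?k1.
have c1 : c 1 = expR a *: slice J (cos b) (sin b) by rewrite /c sliceZ !mul1r.
rewrite -c1 /quat_exp; apply: quat_cvg_lim.
apply/cvgrPdist_le => e e0.
have : (M *: exp_coeff (4 * `|z|)) n @[n --> \oo] --> M * 0.
  by apply: cvgMr; exact/cvg_series_cvg_0/is_cvg_series_exp_coeff.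
rewrite mulr0 => /cvgr0Pnorm_le /(_ e e0); apply: filterS => n.
move=> le_e; have := bnd n 1; rewrite ler01 lexx => /(_ isT) h.
rewrite (_ : c 1 - _ = r n 1); last first.
  rewrite /r /series /= big_mkord; congr (_ - _); apply: eq_bigr => i _.
  by rewrite expr1n mul1r.
apply: (le_trans h); apply: le_trans le_e; rewrite expr1n mulr1.
by apply: le_trans (ler_norm _); rewrite /exp_coeff /GRing.scale /= /GRing.scale /= mulrA.
Qed.

End QuatDerivative.

(** * Hermite polynomials and the Bargmann kernel *)
Section Hermite.
Variables (R : realType) (A : algType R).
Implicit Types (x y : A) (m : nat).

(* Normalised so that the m-th derivative of exp f is [herm m f' * exp f] for f quadratic
   with f'' = - 2 pi. *)
Fixpoint herm m y : A :=
  match m with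
  | 0 => 1
  | 1 => y
  | (k.+1 as m').+1 => y * herm m' y - (2 * pi * m'%:R) *: herm k y
  end.

(** One recurrence for every m: at m = 0 the term with [m.-1] has coefficient 0. *)
Lemma hermS m y : herm m.+1 y = y * herm m y - (2 * pi * m%:R) *: herm m.-1 y.
Proof. by case: m => [|m]//=; rewrite mulr0 scale0r subr0 mulr1. Qed.

Lemma herm0 y : herm 0 y = 1. Proof. by []. Qed.

Lemma herm1 y : herm 1 y = y. Proof. by []. Qed.

Arguments herm : simpl never.

Lemma comm_herm m x y : GRing.comm x y -> GRing.comm x (herm m y).
Proof.
move=> xy; suff : GRing.comm x (herm m y) /\ GRing.comm x (herm m.+1 y) by case.
elim: m => [|m [ih0 ih1]]; first by split; [exact: commr1|].
split=> //; rewrite hermS; apply: commrB; first exact: commrM.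
by rewrite /GRing.comm /= -scalerAr -(scalerAl _ (herm m y) x) ih0.
Qed.

(** The left-hand side, as a sequence [S] in j, satisfies the recurrence [hermS] with y replaced by
    y + x, and has the same initial values. *)
Lemma herm_addition j x y : GRing.comm x y ->
  \sum_(k < j.+1) 'C(j, k)%:R *: (x ^+ k * herm (j - k) y) = herm j (y + x).
Proof.
move=> xy; pose S i := \sum_(k < i.+1) 'C(i, k)%:R *: (x ^+ k * herm (i - k) y).
have ySx i : y * S i = \sum_(k < i.+1) 'C(i, k)%:R *: (x ^+ k * (y * herm (i - k) y)).
  rewrite /S mulr_sumr; apply: eq_bigr => k _.
  by rewrite -scalerAr !mulrA; congr (_ *: (_ * _)); exact: (commrX k (commr_sym xy)).
have SS i : S i.+1 = (y + x) * S i - (2 * pi * i%:R) *: S i.-1.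
  (* Pascal's rule splits C(i+1, k+1): one half yields the factor x, the other raises the Hermite
     index. *)
  have -> : S i.+1 = x * S i + \sum_(k < i.+1) 'C(i, k)%:R *: (x ^+ k * herm (i - k).+1 y).
    rewrite [S i.+1]/S big_ord_recl /= bin0 expr0 mul1r ?subn0.
    rewrite [X in _ = _ + X]big_ord_recl /= bin0 expr0 mul1r ?subn0.
    rewrite addrCA; congr (_ + _).
    rewrite /S mulr_sumr.
    under eq_bigr => k _.
      rewrite /bump /= add1n subSS binS natrD scalerDl.
      over.
    rewrite big_split /= addrC; congr (_ + _).
      by apply: eq_bigr => k _; rewrite -scalerAr mulrA -exprS.
    rewrite big_ord_recr /= bin_small// scale0r addr0.
    by apply: eq_bigr => k _; rewrite /bump /= add1n -subSn.
  rewrite mulrDl addrC -addrA [x * S i - _]addrC addrA; congr (_ + _).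
  rewrite ySx; case: i => [|i].
    by rewrite !big_ord1 /= mulr0 scale0r subr0 herm0 herm1 mulr1.
  rewrite [X in _ - X](_ : _ = \sum_(k < i.+2) 'C(i.+1, k)%:R *: (x ^+ k * ((2 * pi * (i.+1 - k)%:R) *: herm (i.+1 - k).-1 y))).
    rewrite -sumrB; apply: eq_bigr => k _.
    by rewrite hermS mulrBr scalerBr.
  rewrite big_ord_recr /= subnn mulr0 scale0r mulr0 scaler0 addr0 /S scaler_sumr.
  (* The coefficients match by (i + 1 - k) C(i + 1, k) = (i + 1) C(i, k). *)
  apply: eq_bigr => k _; rewrite -!scalerAr !scalerA; congr (_ *: (_ * herm _ _)).
    have := mul_bin_down i.+1 k => /(congr1 (fun n => n%:R : R)) /=; rewrite !natrM => h.
    by rewrite -!mulrA h; ring.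
  by rewrite subSn// -ltnS.
rewrite -/(S j); suff : S j = herm j (y + x) /\ S j.+1 = herm j.+1 (y + x) by case.
elim: j => [|j [ih0 ih1]].
  by rewrite SS /S !big_ord1 /= mulr0 scale0r subr0 bin0 scale1r expr0 !herm0 !mulr1.
by split=> //; rewrite SS ih1 ih0 [in RHS]hermS.
Qed.

End Hermite.

Arguments herm : simpl never.

Section Kernel.
Variable R : realType.
Implicit Types (f g : R -> quat R) (p q J : quat R) (x : R).

(** At a real argument the Hermite factor is a real scalar, hence central; this is how it leaves the
    quaternionic kernel after the Appell identity. *)
Lemma herm_alg m (y : R) : herm m (y%:A : quat R) = (herm m (y : R^o))%:A.
Proof.
suff : herm m (y%:A : quat R) = (herm m (y : R^o))%:A /\
  herm m.+1 (y%:A : quat R) = (herm m.+1 (y : R^o))%:A by case.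
elim: m => [|m [ih0 ih1]]; first by rewrite !herm0 !herm1 scale1r.
split=> //; rewrite hermS [in RHS]hermS /= ih0 ih1 scalerBl scalerA.
by rewrite -(scalerAl y 1 (_ : quat R)) mul1r scalerA.
Qed.

(** The Appell property herm_m' = m herm_(m-1) combined with the chain rule; commutation of p with f
    x lets p be collected on the left at each use of the product rule. *)
Lemma qderiv_herm m f x p : GRing.comm p (f x) -> qderiv f x p ->
  qderiv (fun s => herm m (f s)) x (m%:R *: (p * herm m.-1 (f x))).
Proof.
move=> cp hf.
suff : qderiv (fun s => herm m (f s)) x (m%:R *: (p * herm m.-1 (f x))) /\
  qderiv (fun s => herm m.+1 (f s)) x (m.+1%:R *: (p * herm m (f x))) by case.
elim: m => [|m [ih0 ih1]].
  split; first by rewrite scale0r; exact: qderiv_cst.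
  by rewrite scale1r herm0 mulr1.
split=> //; under eq_fun do rewrite hermS.
apply: (qderiv_eq (qderivD (qderivM hf ih1) (qderivN (qderivZ _ ih0)))).
have -> : f x * (m.+1%:R *: (p * herm m (f x))) = m.+1%:R *: (p * (f x * herm m (f x))).
  by rewrite -scalerAr !mulrA cp.
rewrite -[m.+2%:R]natr1 scalerDl scale1r addrAC -addrA addrC; congr (_ + _).
rewrite [in RHS]hermS mulrBr scalerBr -!scalerAr !scalerA.
by rewrite addrC; congr (_ - _ *: _); ring.
Qed.

(** Read off from the real coordinate of the quaternionic statement along s |-> s. *)
Lemma is_derive_herm m x : is_derive x 1 (fun s : R => herm m (s : R^o) : R)
  (m%:R * herm m.-1 (x : R^o)).
Proof.
have h : qderiv (fun s : R => (s%:A : quat R)) x 1.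
  move=> k; rewrite (_ : (fun s => _) = (fun s => qcoord k 1 * s ^+ 1)); last first.
    by apply/funext => s; rewrite linearZ /= expr1 mulrC.
  apply: (is_derive_eq (is_derive_monomial _ _ _)); by rewrite expr0 !mulr1.
have := qderiv_herm m (commr_sym (commr1 _)) h (@Ordinal 4 0 isT).
under eq_fun do rewrite herm_alg.
by rewrite herm_alg mul1r scalerA /qcoord /= mulr1; under eq_fun do rewrite mulr1.
Qed.

(* [ell q t] is the logarithmic derivative in q of [quat_exp (bexp q t)], the Bargmann kernel,
   and [bker m] the m-th slice derivative of that kernel. *)
Definition ell q (t : R) : quat R := - (2 * pi) *: q + (2 * pi * Num.sqrt 2 * t)%:A.
Definition bexp q (t : R) : quat R :=
  - pi *: (q ^+ 2 + (t ^+ 2)%:A) + (2 * pi * Num.sqrt 2 * t) *: q.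
Definition bker m q t : quat R := herm m (ell q t) * quat_exp (bexp q t).

(** The real and imaginary parts of [bexp] at a + b J, which do not depend on J; see
    [bexp_slice]. *)
Definition breal (a b t : R) := - pi * (a ^+ 2 - b ^+ 2 + t ^+ 2) + 2 * pi * Num.sqrt 2 * t * a.
Definition bimag (a b t : R) := - pi * (2 * a * b) + 2 * pi * Num.sqrt 2 * t * b.

Lemma ell_slice J a b t : 
  ell (slice J a b) t = slice J (- (2 * pi) * a + 2 * pi * Num.sqrt 2 * t) (- (2 * pi) * b).
Proof.
by rewrite /ell sliceZ -(slice_real J) sliceD addr0.
Qed.

Lemma bexp_slice J a b t : J ^+ 2 = -1 ->
  bexp (slice J a b) t = slice J (breal a b t) (bimag a b t).
Proof.
move=> J2; rewrite /bexp expr2 sliceM// -(slice_real J) sliceD !sliceZ sliceD.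
by congr slice; rewrite /breal /bimag; ring.
Qed.

Lemma quat_exp_bexp J a b t : J ^+ 2 = -1 ->
  quat_exp (bexp (slice J a b) t) =
    slice J (expR (breal a b t) * cos (bimag a b t)) (expR (breal a b t) * sin (bimag a b t)).
Proof. by move=> J2; rewrite bexp_slice// quat_exp_slice// sliceZ. Qed.

(** Holomorphy inside the slice: moving in direction v multiplies the derivative by v. Since [bexp]
    varies by v ell and [ell] by - 2 pi v, the result is v (ell herm_m - 2 pi m herm_(m-1)) times
    the exponential, and the bracket is herm_(m+1). *)
Lemma qderiv_bker m J a b c d t x : J ^+ 2 = -1 ->
  qderiv (fun s => bker m (slice J (a + s * c) (b + s * d)) t) x
    (slice J c d * bker m.+1 (slice J (a + x * c) (b + x * d)) t).
Proof.
move=> J2.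
pose al s := breal (a + s * c) (b + s * d) t.
pose be s := bimag (a + s * c) (b + s * d) t.
have lin u v : is_derive x 1 (fun s : R => u + s * v) v.
  rewrite (_ : (fun s => _) = cst u + (fun s => v * s ^+ 1)); last first.
    by apply/funext => s /=; rewrite mulrC.
  apply: (is_derive_eq (is_deriveD (is_derive_cst _ _ _) (is_derive_monomial _ _ _))).
  by rewrite expr0; ring.
have mul2 (u v : R -> R) du dv : is_derive x 1 u du -> is_derive x 1 v dv ->
    is_derive x 1 (fun s => u s * v s) (u x * dv + v x * du).
  by move=> hu hv; exact: (is_deriveM hu hv).
have cst2 (u : R -> R) du (e : R) : is_derive x 1 u du ->
    is_derive x 1 (fun s => e * u s) (e * du).
  by move=> hu; exact: (is_deriveZ _ hu).
have add2 (u v : R -> R) du dv : is_derive x 1 u du -> is_derive x 1 v dv ->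
    is_derive x 1 (fun s => u s + v s) (du + dv).
  by move=> hu hv; exact: (is_deriveD hu hv).
have dal : is_derive x 1 al (- pi * (2 * (a + x * c) * c - 2 * (b + x * d) * d) + 2 * pi * Num.sqrt 2 * t * c).
  have := add2 _ _ _ _ (cst2 _ _ (- pi) (add2 _ _ _ _ (add2 _ _ _ _ (mul2 _ _ _ _ (lin a c) (lin a c)) (cst2 _ _ (-1) (mul2 _ _ _ _ (lin b d) (lin b d)))) (is_derive_cst (t ^+ 2) x 1))) (cst2 _ _ (2 * pi * Num.sqrt 2 * t) (lin a c)).
  rewrite (_ : (fun s => _) = al); last by apply/funext => s; rewrite /al /breal /=; ring.
  by move=> h; apply: (is_derive_eq h); ring.
have dbe : is_derive x 1 be (- pi * (2 * ((a + x * c) * d + c * (b + x * d))) + 2 * pi * Num.sqrt 2 * t * d).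
  have := add2 _ _ _ _ (cst2 _ _ (- pi * 2) (mul2 _ _ _ _ (lin a c) (lin b d))) (cst2 _ _ (2 * pi * Num.sqrt 2 * t) (lin b d)).
  rewrite (_ : (fun s => _) = be); last by apply/funext => s; rewrite /be /bimag /=; ring.
  by move=> h; apply: (is_derive_eq h); ring.
pose L := ell (slice J (a + x * c) (b + x * d)) t.
have hE : qderiv (fun s => quat_exp (bexp (slice J (a + s * c) (b + s * d)) t)) x
    (slice J c d * (L * quat_exp (bexp (slice J (a + x * c) (b + x * d)) t))).
  under eq_fun do rewrite quat_exp_bexp//.
  have ccos : is_derive x 1 (fun s => cos (be s)) _ := is_derive1_comp (is_derive_cos _) dbe.
  have csin : is_derive x 1 (fun s => sin (be s)) _ := is_derive1_comp (is_derive_sin _) dbe.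
  have cexp : is_derive x 1 (fun s => expR (al s)) _ := is_derive1_comp (is_derive_expR _) dal.
  apply: (qderiv_eq (qderiv_slice J (mul2 _ _ _ _ cexp ccos) (mul2 _ _ _ _ cexp csin))).
  rewrite quat_exp_bexp// /L ell_slice !sliceM// -/(al x) -/(be x).
  by congr slice; ring.
have hL : qderiv (fun s => ell (slice J (a + s * c) (b + s * d)) t) x (- (2 * pi) *: slice J c d).
  under eq_fun do rewrite ell_slice.
  have h1 := add2 _ _ _ _ (cst2 _ _ (- (2 * pi)) (lin a c)) (is_derive_cst (2 * pi * Num.sqrt 2 * t) x 1).
  have h2 := cst2 _ _ (- (2 * pi)) (lin b d).
  by apply: (qderiv_eq (qderiv_slice J h1 h2)); rewrite sliceZ addr0.
have cL u v : GRing.comm (slice J u v) L by rewrite /L ell_slice /GRing.comm sliceC.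
apply: (qderiv_eq (qderivM (qderiv_herm m _ hL) hE)); rewrite -/L.
  by rewrite /GRing.comm sliceZ cL.
rewrite /bker; set E := quat_exp _; set v := slice J c d.
have -> : herm m L * (v * (L * E)) = v * (L * herm m L) * E.
  rewrite !mulrA; congr (_ * _); rewrite -(comm_herm m (cL _ _)) -!mulrA.
  by rewrite (comm_herm m (commr_refl L)).
rewrite hermS -/L [RHS]mulrA mulrBr mulrBl addrC; congr (_ + _).
rewrite -(scalerAl _ v) scalerA -(scalerAl _ _ E) -(scalerAr _ v) -(scalerAl _ _ E) -[RHS]scaleNr.
by congr (_ *: _); ring.
Qed.

End Kernel.

Section KernelBounds.
Variable R : realType.
Implicit Types (p q J : quat R) (x : R).

(** Exponential growth is enough, because the Gaussian of the kernel absorbs it; the induction pays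
    for the factor y with |y| <= exp |y|. *)
Lemma herm_bound m : exists2 D : R, 0 <= D &
  forall y : quat R, `|herm m y| <= D * expR (m%:R * `|y|).
Proof.
have norm1 : `|1 : quat R| = 1.
  by rewrite -(scale1r (1 : quat R)) norm_alg normr1.
suff : (exists2 D : R, 0 <= D &
    forall y : quat R, `|herm m y| <= D * expR (m%:R * `|y|)) /\
  (exists2 D : R, 0 <= D &
    forall y : quat R, `|herm m.+1 y| <= D * expR (m.+1%:R * `|y|)) by case.
have le_exp (z : R) : z <= expR z.
  by rewrite (le_trans _ (expR_ge1Dx z))// lerDr.
elim: m => [|m [[D0 D00 ih0] [D1 D10 ih1]]].
  split; exists 1 => // y; first by rewrite herm0 norm1 mul0r expR0 mulr1.
  by rewrite herm1 !mul1r.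
split; first by exists D1.
exists (D1 + 2 * pi * m.+1%:R * D0) => [|y].
  by rewrite addr_ge0// !mulr_ge0// pi_ge0.
rewrite hermS /= (le_trans (ler_normB _ _))// [leRHS]mulrDl; apply: lerD.
  rewrite normqM -natr1 mulrDl mul1r expRD [leRHS](_ : _ = expR `|y| * (D1 * expR (m.+1%:R * `|y|))); last by ring.
  exact: ler_pM.
rewrite normrZ ger0_norm ?mulr_ge0 ?pi_ge0// -[leRHS]mulrA.
rewrite ler_wpM2l ?mulr_ge0 ?pi_ge0// (le_trans (ih0 y))// ler_wpM2l// ler_expR.
by rewrite ler_wpM2r// ler_nat -addn2 leq_addr.
Qed.

(** Uniformity for q in a bounded part of the slice is what domination under the integral sign
    requires. Half of the Gaussian rate pi is spent on absorbing a term linear in |t|. *)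
Lemma bker_bound m J (rho : R) : J ^+ 2 = -1 -> 0 <= rho ->
  exists2 C : R, 0 <= C & forall a b t : R, `|a| <= rho -> `|b| <= rho ->
    `|bker m (slice J a b) t| <= C * expR (- (pi / 2 * t ^+ 2)).
Proof.
move=> J2 rho0; have [D D0 hD] := herm_bound m.
have pi0 : 0 < pi :> R := pi_gt0 R.
pose s : R := 2 * pi * Num.sqrt 2.
have s0 : 0 <= s by rewrite !mulr_ge0 ?pi_ge0 ?sqrtr_ge0.
have sE : 2 * pi * Num.sqrt 2 = s by [].
clearbody s.
(* [c0] is the constant part and [c1] the coefficient of |t| in the upper bound of the exponent. *)
have [c0 c0E] : exists c, c = m%:R * (4 * pi * rho) + pi * rho ^+ 2 by exists (m%:R * (4 * pi * rho) + pi * rho ^+ 2).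
have [c1 c1E] : exists c, c = s * (m%:R + rho) by exists (s * (m%:R + rho)).
exists (D * expR (c0 + c1 ^+ 2 / (2 * pi))) => [|a b t ha hb].
  by rewrite mulr_ge0 ?expR_ge0.
rewrite normqM quat_exp_bexp// -sliceZ normrZ (ger0_norm (expR_ge0 _)).
have -> : `|slice J (cos (bimag a b t)) (sin (bimag a b t))| = 1.
  by apply: (@pexpIrn _ 2); rewrite ?nnegrE// norm_slice_sqr// cos2Dsin2 expr1n.
rewrite mulr1; apply: (@le_trans _ _ (D * expR (m%:R * `|ell (slice J a b) t|) * expR (breal a b t))).
  by rewrite ler_wpM2r ?expR_ge0// hD.
have -> : D * expR (c0 + c1 ^+ 2 / (2 * pi)) * expR (- (pi / 2 * t ^+ 2)) =
    D * expR (c0 + c1 ^+ 2 / (2 * pi) - pi / 2 * t ^+ 2) by rewrite -mulrA -expRD.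
rewrite -[leLHS]mulrA -expRD ler_wpM2l// ler_expR.
have he : `|ell (slice J a b) t| <= 4 * pi * rho + s * `|t|.
  rewrite ell_slice /slice (le_trans (ler_normD _ _))// norm_alg normrZ norm_unit// mulr1.
  rewrite (le_trans (lerD (ler_normD _ _) (lexx _)))//.
  rewrite sE !normrM normrN !normrM (ger0_norm s0) (ger0_norm (ltW pi0)) normr_nat.
  have h1 := ler_wpM2l (ltW pi0) ha; have h2 := ler_wpM2l (ltW pi0) hb; lra.
have hr : breal a b t <= pi * rho ^+ 2 - pi * t ^+ 2 + s * (`|t| * rho).
  have h1 : b ^+ 2 <= rho ^+ 2.
    by rewrite -(real_normK (num_real b)) lerXn2r ?nnegrE.
  have h2 : t * a <= `|t| * rho.
    by rewrite (le_trans (ler_norm _))// normrM ler_wpM2l.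
  have h3 := ler_wpM2l s0 h2.
  rewrite /breal sE; have := sqr_ge0 a; nra.
have hm := ler_wpM2l (ler0n R m) he.
apply: (le_trans (lerD hm hr)).
have ht : t ^+ 2 = `|t| ^+ 2 by rewrite real_normK ?num_real.
rewrite ht.
(* Completing the square in |t|. *)
have h4 : c1 * `|t| <= pi / 2 * `|t| ^+ 2 + c1 ^+ 2 / (2 * pi).
  rewrite -subr_ge0 (_ : _ - _ = (pi / 2) * (`|t| - c1 / pi) ^+ 2).
    by rewrite mulr_ge0 ?sqr_ge0// divr_ge0 ?pi_ge0.
  by move: (pi : R) pi0 => P P0; field; exact: lt0r_neq0.
rewrite c0E; move: h4; set X := _ / (2 * pi).
rewrite c1E; lra.
Qed.

End KernelBounds.

(** * Measurability and integration of quaternion-valued functions *)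

Section QuatIntegral.
Context {R : realType} {d : measure_display} {T : measurableType d}.
Implicit Types (f g : T -> quat R) (p : quat R).

Lemma quat_measurableP f :
  quat_measurable f <-> (forall k, measurable_fun setT (fun x => qcoord k (f x))).
Proof.
split=> [[h0 h1 h2 h3] k|h]; first by case: k => [[|[|[|[|//]]]] ?].
split; [exact: (h (@Ordinal 4 0 isT))|exact: (h (@Ordinal 4 1 isT))|
  exact: (h (@Ordinal 4 2 isT))|exact: (h (@Ordinal 4 3 isT))].
Qed.

Lemma quat_measurable_cst p : quat_measurable (fun _ : T => p).
Proof. by split; exact: measurable_cst. Qed.

Lemma quat_measurableD f g : quat_measurable f -> quat_measurable g ->
  quat_measurable (fun x => f x + g x).
Proof. by move=> [? ? ? ?] [? ? ? ?]; split => /=; exact: measurable_funD. Qed.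

Lemma quat_measurableZ (u : T -> R) f : measurable_fun setT u -> quat_measurable f ->
  quat_measurable (fun x => u x *: f x).
Proof. by move=> ? [? ? ? ?]; split => /=; exact: measurable_funM. Qed.

Lemma quat_measurableM f g : quat_measurable f -> quat_measurable g ->
  quat_measurable (fun x => f x * g x).
Proof.
move=> [f0 f1 f2 f3] [g0 g1 g2 g3].
split => /=; repeat (apply: measurable_funB || apply: measurable_funD || exact: measurable_funM).
Qed.

Lemma quat_measurable_slice J (u v : T -> R) :
  measurable_fun setT u -> measurable_fun setT v ->
  quat_measurable (fun x => slice J (u x) (v x)).
Proof.
by move=> hu hv; apply: quat_measurableD; apply: quat_measurableZ => //;
  exact: quat_measurable_cst.
Qed.

Lemma quat_measurable_sum n (F : 'I_n -> T -> quat R) :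
  (forall i, quat_measurable (F i)) -> quat_measurable (fun x => \sum_(i < n) F i x).
Proof.
elim: n F => [|n ih] F h.
  by under eq_fun do rewrite big_ord0; exact: quat_measurable_cst.
by under eq_fun do rewrite big_ord_recr /=; apply: quat_measurableD => //; exact: ih.
Qed.

Lemma quat_measurable_herm m f : quat_measurable f ->
  quat_measurable (fun x => herm m (f x)).
Proof.
move=> hf; suff : quat_measurable (fun x => herm m (f x)) /\
  quat_measurable (fun x => herm m.+1 (f x)) by case.
elim: m => [|m [ih0 ih1]].
  by split=> //; under eq_fun do rewrite herm0; exact: quat_measurable_cst.
split=> //; under eq_fun do rewrite hermS -scaleNr.
apply: quat_measurableD; first exact: quat_measurableM.
by apply: quat_measurableZ.
Qed.

Lemma measurable_normq f : quat_measurable f -> measurable_fun setT (fun x => `|f x|).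
Proof.
move=> [f0 f1 f2 f3].
apply: (@measurableT_comp _ _ _ _ _ _ (@Num.sqrt R)) => //.
  exact: (continuous_measurable_fun (@sqrt_continuous R)).
by repeat apply: measurable_funD => //; exact: measurable_funX.
Qed.

Variable mu : {measure set T -> \bar R}.

Definition qintegrable f :=
  forall k, mu.-integrable setT (fun x => (qcoord k (f x))%:E).

Lemma qcoord_integral k f :
  qcoord k (quat_integral mu f) = \int[mu]_x qcoord k (f x).
Proof. by case: k => [[|[|[|[|//]]]] ?]. Qed.

Lemma le_qintegrable f (g : T -> R) : quat_measurable f ->
  mu.-integrable setT (EFin \o g) -> (forall x, `|f x| <= g x) -> qintegrable f.
Proof.
move=> /quat_measurableP hf hg fg k; apply: le_integrable hg => //.
  exact/measurable_EFinP.
move=> x _ /=; rewrite lee_fin (le_trans (norm_qcoord _ _))// (le_trans (fg x))//.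
exact: ler_norm.
Qed.

(** Integrability and value are proved together because the inductive step for the value uses the
    integrability of the partial sum. *)
Lemma Rintegral_sum n (F : 'I_n -> T -> R) :
  (forall i, mu.-integrable setT (EFin \o F i)) ->
  mu.-integrable setT (fun x => (\sum_(i < n) F i x)%:E) /\
  \int[mu]_x (\sum_(i < n) F i x) = \sum_(i < n) \int[mu]_x F i x.
Proof.
elim: n F => [|n ih] F h.
  under eq_fun do rewrite big_ord0.
  under eq_Rintegral do rewrite big_ord0.
  rewrite big_ord0 /Rintegral integral0; split=> //; exact: integrable0.
have [i1 i2] := ih (fun i => F (widen_ord (leqnSn n) i)) (fun i => h _).
under eq_fun do rewrite big_ord_recr /=.
under eq_Rintegral do rewrite big_ord_recr /=.
split; last by rewrite big_ord_recr /= RintegralD// i2.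
by under eq_fun do rewrite EFinD; apply: integrableD => //; exact: h.
Qed.

Definition qbasis (l : nat) : quat R :=
  Quat (l == 0)%:R (l == 1)%:R (l == 2)%:R (l == 3)%:R.

(** Left multiplication by p is real-linear; this displays its matrix, which is how constants on the
    left pass through integrals. *)
Lemma qcoordM k p q :
  qcoord k (p * q) = \sum_(l < 4) qcoord k (p * qbasis l) * qcoord l q.
Proof.
rewrite !big_ord_recr big_ord0 /= /qcoord.
by case: k => [[|[|[|[|//]]]] ?] /=; ring.
Qed.

Lemma quat_integralMl p f : qintegrable f ->
  qintegrable (fun x => p * f x) /\
  quat_integral mu (fun x => p * f x) = p * quat_integral mu f.
Proof.
move=> hf.
have H k (l : 'I_4) : mu.-integrable setT (fun x => (qcoord k (p * qbasis l) * qcoord l (f x))%:E).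
  by under eq_fun do rewrite EFinM; apply: integrableZl => //; exact: hf.
split=> [k|].
  under eq_fun do rewrite qcoordM.
  exact: (Rintegral_sum (H k)).1.
apply: qcoordP => k; rewrite qcoord_integral qcoordM.
under eq_Rintegral do rewrite qcoordM.
rewrite (Rintegral_sum (H k)).2; apply: eq_bigr => l _.
by rewrite qcoord_integral RintegralZl//; exact: hf.
Qed.

Lemma quat_integralD f g : qintegrable f -> qintegrable g ->
  qintegrable (fun x => f x + g x) /\
  quat_integral mu (fun x => f x + g x) = quat_integral mu f + quat_integral mu g.
Proof.
move=> hf hg; split=> [k|].
  by under eq_fun do rewrite linearD EFinD; apply: integrableD => //; [exact: hf|exact: hg].
apply: qcoordP => k; rewrite linearD /= !qcoord_integral.
under eq_Rintegral do rewrite linearD /=.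
by rewrite RintegralD//; [exact: hf|exact: hg].
Qed.

Lemma quat_integralZ (a : R) f : qintegrable f ->
  qintegrable (fun x => a *: f x) /\
  quat_integral mu (fun x => a *: f x) = a *: quat_integral mu f.
Proof.
have -> : (fun x => a *: f x) = (fun x => a%:A * f x).
  by apply/funext => x; rewrite scaleq_mul.
by rewrite (scaleq_mul a (quat_integral mu f)); exact: quat_integralMl.
Qed.

Lemma quat_integral_sum n (F : 'I_n -> T -> quat R) : (forall i, qintegrable (F i)) ->
  qintegrable (fun x => \sum_(i < n) F i x) /\
  quat_integral mu (fun x => \sum_(i < n) F i x) = \sum_(i < n) quat_integral mu (F i).
Proof.
move=> hF.
have H k i : mu.-integrable setT (fun x => (qcoord k (F i x))%:E) by exact: hF.
split=> [k|].
  by under eq_fun do rewrite linear_sum; exact: (Rintegral_sum (H k)).1.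
apply: qcoordP => k; rewrite linear_sum /= qcoord_integral.
under eq_Rintegral do rewrite linear_sum /=.
rewrite (Rintegral_sum (H k)).2; apply: eq_bigr => l _.
by rewrite qcoord_integral.
Qed.

End QuatIntegral.

(** * Slice derivatives of the Bargmann transform *)
Section Bargmann.
Variable R : realType.
Local Notation mu := (@lebesgue_measure R).
Implicit Types (p q J : quat R) (x : R).

Lemma gaussian_integral (c : R) : 0 < c ->
  mu.-integrable setT (fun x => (expR (- (c * x ^+ 2)))%:E) /\
  (\int[mu]_x (expR (- (c * x ^+ 2)))%:E = (Num.sqrt (pi / c))%:E)%E.
Proof.
(* With variance 1 / (2 c) the centred normal density is proportional to exp (- c x^2). *)
move=> c0; pose s : R := Num.sqrt (2 * c)^-1.
have s2 : s ^+ 2 = (2 * c)^-1 by rewrite sqr_sqrtr// invr_ge0 mulr_ge0// ltW.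
have s0 : s != 0 by rewrite gt_eqF// sqrtr_gt0 invr_gt0 mulr_gt0.
have pk0 := normal_peak_gt0 s0.
have pk : (normal_peak s)^-1 = Num.sqrt (pi / c).
  rewrite /normal_peak invrK s2; congr Num.sqrt.
  by move: (pi : R) => P; field; rewrite gt_eqF.
have E x : expR (- (c * x ^+ 2)) = (normal_peak s)^-1 * normal_pdf 0 s x.
  rewrite normal_pdfE// mulrA mulVf ?gt_eqF// mul1r /normal_fun subr0 s2.
  by congr expR; field; rewrite gt_eqF.
under eq_fun do rewrite E EFinM.
have h := integrable_normal_pdf (0 : R) s.
split; first exact: integrableZl.
by rewrite integralZl// integral_normal_pdf mule1 pk.
Qed.

Lemma inL2_integrable (phi : R -> quat R) : inL2 mu phi ->
  mu.-integrable setT (fun t => (`|phi t| ^+ 2)%:E).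
Proof.
move=> [mphi]; rewrite /L2norm => h; apply/integrableP; split.
  by apply/measurable_EFinP/measurable_funX/measurable_normq.
under eq_integral do rewrite gee0_abs ?lee_fin ?sqr_ge0//.
by move: h; case: (integral _ _ _) => [r _|/=|_]; rewrite ?ltry ?ltNyr ?ltNy0 ?ltxx ?ltNye.
Qed.

(** From u v <= u^2 + v^2, where both squares are integrable. This is the dominating function for
    all Bargmann integrals. *)
Lemma gaussian_L2_integrable (C : R) (phi : R -> quat R) : 0 <= C -> inL2 mu phi ->
  mu.-integrable setT (EFin \o (fun t => C * expR (- (pi / 2 * t ^+ 2)) * `|phi t|)).
Proof.
move=> C0 hphi.
have hg := (gaussian_integral (pi_gt0 R)).1.
have h : mu.-integrable setT (fun t => (C ^+ 2 * expR (- (pi * t ^+ 2)) + `|phi t| ^+ 2)%:E).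
  under eq_fun do rewrite EFinD EFinM.
  by apply: integrableD => //; [exact: integrableZl|exact: inL2_integrable].
apply: le_integrable h => //.
  apply/measurable_EFinP/measurable_funM; last exact: (measurable_normq hphi.1).
  apply: measurable_funM => //; apply: measurableT_comp => //.
  by apply: measurable_funN; apply: measurable_funM => //; exact: measurable_funX.
move=> t _ /=; rewrite lee_fin.
have -> : expR (- (pi * t ^+ 2)) = expR (- (pi / 2 * t ^+ 2)) ^+ 2.
  by rewrite [RHS]expr2 -expRD; congr expR; field.
rewrite ger0_norm ?mulr_ge0 ?expR_ge0// ger0_norm ?addr_ge0 ?mulr_ge0 ?sqr_ge0//.
rewrite -exprMn; set u := C * _; set v := `|_|.
have := sqr_ge0 (u - v); have := sqr_ge0 u; have := sqr_ge0 v; nra.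
Qed.

Lemma quat_measurable_bker m J a b : J ^+ 2 = -1 ->
  quat_measurable (fun t : R => bker m (slice J a b) t).
Proof.
move=> J2; apply: quat_measurableM.
  apply: quat_measurable_herm.
  rewrite (funext (ell_slice J a b)).
  apply: quat_measurable_slice => //.
  by apply: measurable_funD => //; exact: measurable_funM.
rewrite (funext (fun t => quat_exp_bexp a b t J2)).
have mr : measurable_fun setT (breal a b).
  by repeat (apply: measurable_funD || apply: measurable_funM || apply: measurable_funX || exact: measurable_cst || exact: measurable_id).
have mi : measurable_fun setT (bimag a b).
  by repeat (apply: measurable_funD || apply: measurable_funM || apply: measurable_funX || exact: measurable_cst || exact: measurable_id).
apply: quat_measurable_slice; apply: measurable_funM; apply: measurableT_comp => //.
  exact: (continuous_measurable_fun (@continuous_cos R)).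
exact: (continuous_measurable_fun (@continuous_sin R)).
Qed.

(** The candidate for the m-th slice derivative, obtained by differentiating formally under the
    integral. *)
Definition bargmannD (m : nat) (phi : R -> quat R) q : quat R :=
  (2 `^ (3 / 4)) *: quat_integral mu (fun t => bker m q t * phi t).

Lemma qintegrable_bker m (phi : R -> quat R) J a b : inL2 mu phi -> J ^+ 2 = -1 ->
  qintegrable mu (fun t => bker m (slice J a b) t * phi t).
Proof.
move=> hphi J2; pose rho : R := `|a| + `|b|.
have [C C0 hC] := bker_bound m J2 (addr_ge0 (normr_ge0 a) (normr_ge0 b)).
apply: (le_qintegrable _ (gaussian_L2_integrable C0 hphi)) => [|t].
  by apply: quat_measurableM; [exact: quat_measurable_bker|exact: hphi.1].
by rewrite normqM ler_wpM2r// hC// ?lerDl ?lerDr.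
Qed.

(** Differentiation under the integral along a segment in the slice, one coordinate at a time. The
    slice derivative uses the directions 1 and J, that is (c, d) = (1, 0) and (0, 1). *)
Lemma derive_bargmannD m (phi : R -> quat R) J a b c d : inL2 mu phi -> J ^+ 2 = -1 ->
  `|c| <= 1 -> `|d| <= 1 ->
  'D_(slice J c d) (bargmannD m phi) (slice J a b) =
    slice J c d * bargmannD m.+1 phi (slice J a b).
Proof.
move=> hphi J2 c1 d1.
pose z s := slice J (a + s * c) (b + s * d).
pose f k (s t : R) := qcoord k (bker m (z s) t * phi t).
have df k (s t : R) : is_derive s 1 (f k ^~ t) (qcoord k (slice J c d * bker m.+1 (z s) t * phi t)).
  apply: (qderiv_eq (qderivM (qderiv_bker m a b c d t s J2) (qderiv_cst (phi t) s))).
  by rewrite mulr0 addr0.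
(* For |s| < 1 the moving point [z s] keeps both slice coordinates below [rho], so one Gaussian
   dominates all the partial derivatives. *)
pose rho : R := `|a| + `|b| + 1.
have rho0 : 0 <= rho by rewrite !addr_ge0.
have [C C0 hC] := bker_bound m.+1 J2 rho0.
have zb s : s \in `](-1), 1[ -> `|a + s * c| <= rho /\ `|b + s * d| <= rho.
  rewrite in_itv /= -ltr_norml => /ltW s1.
  have h (u v : R) : `|v| <= 1 -> `|u + s * v| <= `|u| + 1.
    move=> v1; rewrite (le_trans (ler_normD _ _))// lerD2l normrM.
    by rewrite -[leRHS]mulr1 ler_pM.
  split; rewrite (le_trans (h _ _ _))// /rho lerD2r ?lerDl ?lerDr//.
have nv : `|slice J c d| <= 2.
  rewrite /slice (le_trans (ler_normD _ _))// norm_alg normrZ norm_unit// mulr1.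
  by rewrite -[2]/(1 + 1) lerD.
have C20 : 0 <= 2 * C by rewrite mulr_ge0.
have zero_in : (0 : R) \in `](-1), 1[ by rewrite in_itv /= oppr_lt0 ltr01.
have key k : (h^-1 *: ((\int[mu]_t f k (h + 0) t) - (\int[mu]_t f k 0 t)) : R) @[h --> 0^'] -->
    \int[mu]_t qcoord k (slice J c d * bker m.+1 (z 0) t * phi t).
  have := @cvg_differentiation_under_integral R _ _ mu (f k) setT measurableT 0 (-1) 1.
  move=> /(_ zero_in _ _ (fun t => 2 * C * expR (- (pi / 2 * t ^+ 2)) * `|phi t|)).
  have -> : (\int[mu]_t qcoord k (slice J c d * bker m.+1 (z 0) t * phi t)) =
      \int[mu]_t partial1of2 (f k) 0 t.
    by apply: eq_Rintegral => t _; rewrite partial1of2E; have := df k 0 t => ?; rewrite derive_val.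
  apply.
  - by move=> s _; exact: qintegrable_bker.
  - by move=> s t _ _; have [] := df k s t.
  - by move=> t; rewrite !mulr_ge0 ?expR_ge0.
  - exact: gaussian_L2_integrable.
  - move=> s t /zb[h1 h2] _; rewrite partial1of2E; have := df k s t => ?; rewrite derive_val.
    rewrite (le_trans (norm_qcoord _ _))// normqM (normqM (slice J c d)) ler_wpM2r//.
    by rewrite -(mulrA 2 C) ler_pM// hC.
have z0 : z 0 = slice J a b by rewrite /z !mul0r !addr0.
have [_ Ev] := quat_integralMl (slice J c d) (qintegrable_bker m.+1 a b hphi J2).
rewrite /derive; apply: quat_cvg_lim.
have -> : slice J c d * bargmannD m.+1 phi (slice J a b) = (2 `^ (3 / 4)) *:
    quat_integral mu (fun t => slice J c d * bker m.+1 (z 0) t * phi t).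
  rewrite /bargmannD -scalerAr -Ev z0; congr (_ *: quat_integral _ _).
  by apply/funext => t; rewrite mulrA.
apply: cvg_quat => k.
rewrite [X in _ --> X]linearZ /= qcoord_integral.
have := cvgMl_tmp (a := 2 `^ (3 / 4)) (key k).
move=> /(_ ltac:(typeclasses eauto)); apply: cvg_trans; apply: near_eq_cvg; near=> h.
have qZ (e : R) p : qcoord k (e *: p) = e * qcoord k p by rewrite linearZ.
have qB p q : qcoord k (p - q) = qcoord k p - qcoord k q by rewrite linearB.
have G (e A B : R) : h^-1 * (e * A - e * B) = e * (h^-1 *: (A - B)).
  by rewrite /GRing.scale /=; ring.
have qD p : qcoord k (bargmannD m phi p) =
    2 `^ (3 / 4) * \int[mu]_t qcoord k (bker m p t * phi t).
  by rewrite /bargmannD qZ qcoord_integral.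
have qDB p p' : qcoord k (h^-1 *: (bargmannD m phi p - bargmannD m phi p')) =
    2 `^ (3 / 4) * (h^-1 *: (\int[mu]_t qcoord k (bker m p t * phi t) -
                             \int[mu]_t qcoord k (bker m p' t * phi t))).
  apply: (etrans _ (G _ _ _)); apply: (etrans (qZ _ _)); congr (_ * _).
  apply: (etrans (qB _ _)); exact: (congr2 (fun A B => A - B) (qD p) (qD p')).
have zh : h *: slice J c d + slice J a b = z h.
  by rewrite sliceZ sliceD /z; congr slice; rewrite addrC.
by rewrite qDB zh -z0 addr0.
Unshelve. all: by end_near. Qed.

(** Write f' for the next [bargmannD]: the derivatives along 1 and J are f' and J f', so (f' - J J
    f') / 2 = f'. The value is the same for every admissible J, so the choice made by [slice_unit]
    at real points is harmless. *)
Lemma iter_slice_derive_bargmann m (phi : R -> quat R) : inL2 mu phi ->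
  iter m (@slice_derive R) (bargmann phi) = bargmannD m phi.
Proof.
move=> hphi; elim: m => [|m ih].
  apply/funext => q; rewrite /= /bargmann /bargmannD /bker.
  by under [in RHS]eq_fun do rewrite herm0 mul1r.
rewrite iterS ih; apply/funext => q; rewrite /slice_derive.
have J2 := slice_unit_sqr q; have [b qE] := slice_unit_decomp q.
move: (slice_unit q) J2 qE => J J2 qE.
have n0 : `|0 : R| <= 1 by rewrite normr0.
have n1 : `|1 : R| <= 1 by rewrite normr1.
have := derive_bargmannD m (q_re q) b hphi J2 n1 n0.
have := derive_bargmannD m (q_re q) b hphi J2 n0 n1.
rewrite -qE slice_unitE slice_real scale1r => -> ->.
rewrite mul1r mulrA -expr2 J2 mulN1r opprK -[X in X + _]scale1r -[X in _ + X]scale1r.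
by rewrite -scalerDl scalerA mulVf ?scale1r// -[1 + 1]/(2%:R) pnatr_eq0.
Qed.

End Bargmann.

(** * From the polyanalytic transform to a windowed Fourier integral *)

Section Window.
Variable R : realType.
Local Notation mu := (@lebesgue_measure R).
Implicit Types (p q J : quat R) (x : R).

(** This is 2^(-j/2) h_j, with h_j the weighted Hermite function (-1)^j exp (pi s^2) (d/ds)^j exp (-
    2 pi s^2). *)
Definition hgauss (j : nat) (s : R) : R :=
  (herm j (2 * pi * Num.sqrt 2 * s : R^o) : R) * expR (- (pi * s ^+ 2)).

(* [window j] is (-1)^j sqrt 2 psi_j for the normalised weighted Hermite function psi_j;
   its norm sqrt 2 is the constant of the theorem. *)
Definition window (j : nat) (s : R) : R :=
  (-1) ^+ j * Num.sqrt (1 / ((2 * pi) ^+ j * j`!%:R)) * 2 `^ (3 / 4) * hgauss j s.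

Lemma quat_integral_bker_sum j (phi : R -> quat R) J a b p : inL2 mu phi -> J ^+ 2 = -1 ->
  qintegrable mu (fun t => \sum_(k < j.+1) 'C(j, k)%:R *: (p ^+ k * (bker (j - k) (slice J a b) t * phi t))) /\
  quat_integral mu (fun t => \sum_(k < j.+1) 'C(j, k)%:R *: (p ^+ k * (bker (j - k) (slice J a b) t * phi t))) =
  \sum_(k < j.+1) 'C(j, k)%:R *: (p ^+ k * quat_integral mu (fun t => bker (j - k) (slice J a b) t * phi t)).
Proof.
move=> hphi J2.
have h k : qintegrable mu (fun t => 'C(j, k)%:R *: (p ^+ k * (bker (j - k) (slice J a b) t * phi t))) /\
    quat_integral mu (fun t => 'C(j, k)%:R *: (p ^+ k * (bker (j - k) (slice J a b) t * phi t))) =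
    'C(j, k)%:R *: (p ^+ k * quat_integral mu (fun t => bker (j - k) (slice J a b) t * phi t)).
  have [h1 h2] := quat_integralMl (p ^+ k) (qintegrable_bker (j - k) a b hphi J2).
  have [h3 h4] := quat_integralZ 'C(j, k)%:R h1.
  by split=> //; rewrite h4 h2.
have [h1 h2] := quat_integral_sum (fun k : 'I_j.+1 => (h k).1).
by split=> //; rewrite h2; apply: eq_bigr => k _; rewrite (h k).2.
Qed.

(** In ell - 2 pi conj q the imaginary parts cancel, leaving 2 pi sqrt 2 t - 4 pi a. The Appell
    identity applies because [ell] and conj q lie in the same slice. *)
Lemma bker_sum j J a b t : J ^+ 2 = -1 ->
  \sum_(k < j.+1) 'C(j, k)%:R *: ((- (2 * pi) *: quat_conj (slice J a b)) ^+ k * bker (j - k) (slice J a b) t) =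
  (herm j (2 * pi * Num.sqrt 2 * (t - Num.sqrt 2 * a) : R^o) * expR (breal a b t)) *:
    slice J (cos (bimag a b t)) (sin (bimag a b t)).
Proof.
move=> J2; rewrite /bker.
under eq_bigr do rewrite mulrA scalerAl.
rewrite -mulr_suml herm_addition; last first.
  by rewrite conj_slice// sliceZ ell_slice /GRing.comm sliceC.
have -> : ell (slice J a b) t + - (2 * pi) *: quat_conj (slice J a b) =
    (2 * pi * Num.sqrt 2 * (t - Num.sqrt 2 * a))%:A.
  rewrite conj_slice// sliceZ ell_slice sliceD -(slice_real J); congr slice; last by ring.
  have : Num.sqrt 2 * Num.sqrt 2 = 2 :> R by rewrite -expr2 sqr_sqrtr.
  move: (Num.sqrt (2 : R)) (pi : R) => r P hr.
  by rewrite mulrBr !mulrA -[2 * P * r * r]mulrA hr; ring.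
by rewrite herm_alg -scalerAl mul1r quat_exp_bexp// -sliceZ scalerA.
Qed.

(** The point conj q / sqrt 2 has slice coordinates a = x / sqrt 2 and b = - w / sqrt 2, so sqrt 2 a
    = x is the centre of the window. Two cancellations remain: the prefactor removes pi x w from the
    phase, and the Gaussian weight removes w from the modulus. *)
Lemma true_bargmann_window j (phi : R -> quat R) (I : quat R) x w : inL2 mu phi -> I ^+ 2 = -1 ->
  let q := x%:A + w *: I in
  let f := fun t => window j (t - x) *:
      (slice I (cos (2 * pi * w * t)) (- sin (2 * pi * w * t)) * phi t) in
  qintegrable mu f /\
  quat_exp (- (pi * x * w) *: I) * true_bargmann j phi ((Num.sqrt 2)^-1 *: quat_conj q)
    * (expR (- (`|q| ^+ 2 * pi / 2)))%:A = quat_integral mu f.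
Proof.
move=> hphi I2 q f.
pose a := (Num.sqrt 2)^-1 * x; pose b := - ((Num.sqrt 2)^-1 * w).
have qE : q = slice I x w by [].
have pE : (Num.sqrt 2)^-1 *: quat_conj q = slice I a b.
  by rewrite qE conj_slice// sliceZ /b -mulrN.
have r2 : Num.sqrt 2 * Num.sqrt 2 = 2 :> R by rewrite -expr2 sqr_sqrtr.
have r0 : Num.sqrt 2 != 0 :> R by rewrite gt_eqF// sqrtr_gt0.
have ax : Num.sqrt 2 * a = x by rewrite /a mulrA divff// mul1r.
have bw : Num.sqrt 2 * b = - w by rewrite /b mulrN mulrA divff// mul1r.
have wE : w = - (Num.sqrt 2 * b) by rewrite bw opprK.
have nq : `|q| ^+ 2 = x ^+ 2 + w ^+ 2 by rewrite qE norm_slice_sqr.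
rewrite pE nq /true_bargmann; set c := (-1) ^+ j * _.
set y := - (2 * pi) *: quat_conj _.
set r := expR _; set e := quat_exp _.
have [h1 h2] := quat_integral_bker_sum j a b y hphi I2.
have [h3 h4] := quat_integralMl e h1.
have [h5 h6] := quat_integralZ (c * 2 `^ (3 / 4) * r) h3.
have fE : f = (fun t => (c * 2 `^ (3 / 4) * r) *: (e * \sum_(k < j.+1) 'C(j, k)%:R *: (y ^+ k * (bker (j - k) (slice I a b) t * phi t)))).
  apply/funext => t.
  under eq_bigr do rewrite mulrA scalerAl.
  rewrite -mulr_suml bker_sum// ax /e.
  have -> : - (pi * x * w) *: I = slice I 0 (- (pi * x * w)) by rewrite /slice scale0r add0r.
  rewrite quat_exp_slice// expR0 scale1r.
  set A := herm j _ * _; set S := slice I (cos (bimag a b t)) _.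
  rewrite -(scalerAl A S) -(scalerAr A _ (S * phi t)) scalerA (mulrA _ S (phi t)) /S sliceM// -cosD.
  have -> : cos (- (pi * x * w)) * sin (bimag a b t) + sin (- (pi * x * w)) * cos (bimag a b t) =
    sin (- (pi * x * w) + bimag a b t) by rewrite [RHS]sinD addrC.
  (* An identity modulo z^2 = 2 for z = sqrt 2: the difference of the two sides is displayed as a
     multiple of z z - 2. *)
  have -> : - (pi * x * w) + bimag a b t = - (2 * pi * w * t).
    rewrite /bimag -ax wE; move: (Num.sqrt (2 : R)) (pi : R) r2 => z P hz.
    rewrite [LHS](_ : _ = - (2 * P * - (z * b) * t) + P * a * b * (z * z - 2)); last by ring.
    by rewrite hz subrr mulr0 addr0.
  rewrite cosN sinN /f; congr (_ *: _).
  rewrite /window -/c /hgauss -[RHS]mulrA; congr (_ * _).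
  (* The exponents add up to - pi (t - x)^2, again modulo z^2 = 2. *)
  rewrite /A [RHS]mulrCA; congr (_ * _); rewrite /r -expRD; congr expR.
  rewrite /breal -ax wE; move: (Num.sqrt (2 : R)) (pi : R) r2 => z P hz.
  rewrite [RHS](_ : _ = - (P * (t - z * a) ^+ 2) + P * (a ^+ 2 - b ^+ 2) / 2 * (z * z - 2)); last by field.
  by rewrite hz subrr mulr0 addr0.
split; first by rewrite fE.
rewrite fE h6 h4 h2.
have -> : \sum_(k < j.+1) 'C(j, k)%:R *: (y ^+ k * iter (j - k) (@slice_derive R) (bargmann phi) (slice I a b)) =
    (2 `^ (3 / 4)) *: \sum_(k < j.+1) 'C(j, k)%:R *: (y ^+ k * quat_integral mu (fun t => bker (j - k) (slice I a b) t * phi t)).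
  rewrite scaler_sumr; apply: eq_bigr => k _.
  by rewrite iter_slice_derive_bargmann// /bargmannD -scalerAr !scalerA mulrC.
move: (\sum_(k < _) _) => Q; rewrite scalerA -(scalerAr r _ 1) mulr1.
rewrite -(scalerAr _ e Q) scalerA; congr (_ *: _); rewrite mulrC; ring.
Qed.

End Window.

(** * The Poisson kernel and Plancherel's identity *)
Section LebesgueInvariance.
Variable R : realType.
Local Notation mu := (@lebesgue_measure R).

(** Lebesgue measure is determined by half-open intervals, so these suffice; translations and
    reflections are then handled by the same lemmas. *)
Lemma lebesgue_preserving (phi : R -> R) (mphi : measurable_fun setT phi) :
  (forall b c : R, b < c -> mu (phi @^-1` `]b, c]) = (c - b)%:E) ->
  forall A, measurable A -> pushforward mu phi A = mu A.
Proof.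
move=> h A mA.
have mphi' : @measurable_fun _ _ (measurableTypeR R) (measurableTypeR R) setT phi := mphi.
pose nu0 : {measure set (measurableTypeR R) -> \bar R} := pushforward mu (phi : measurableTypeR R -> measurableTypeR R).
pose nu := nu0 mphi'.
have H X : ocitv X -> mu X = nu X.
  move=> /ocitvP[->|[[b c] /= bc ->]]; first by rewrite !measure0.
  by rewrite /nu /= /pushforward h// lebesgue_measure_itv /= lte_fin bc EFinB.
exact: (esym (lebesgue_measure_unique H mA)).
Qed.

Lemma ge0_integral_preserving (phi : R -> R) (f : R -> \bar R) : measurable_fun setT phi ->
  (forall b c : R, b < c -> mu (phi @^-1` `]b, c]) = (c - b)%:E) ->
  measurable_fun setT f -> (forall x, 0 <= f x)%E ->
  (\int[mu]_x f (phi x) = \int[mu]_x f x)%E.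
Proof.
move=> mphi h mf f0.
rewrite -(@ge0_integral_pushforward _ _ (measurableTypeR R) (measurableTypeR R) R phi mphi mu setT f)//.
by apply: eq_measure_integral => A mA _; exact: (lebesgue_preserving mphi h mA).
Qed.

Lemma integral_preserving (phi : R -> R) (f : R -> \bar R) : measurable_fun setT phi ->
  (forall b c : R, b < c -> mu (phi @^-1` `]b, c]) = (c - b)%:E) ->
  mu.-integrable setT f ->
  mu.-integrable setT (f \o phi) /\ (\int[mu]_x f (phi x) = \int[mu]_x f x)%E.
Proof.
move=> mphi h intf; have mf := measurable_int mu intf.
have i1 : mu.-integrable setT (f \o phi).
  apply/integrableP; split; first exact: measurableT_comp.
  rewrite (ge0_integral_preserving (f := fun x => `|f x|%E) mphi h)//.
    by case/integrableP : intf.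
  exact: measurableT_comp.
split=> //.
rewrite -(@integral_pushforward _ _ (measurableTypeR R) (measurableTypeR R) R phi mphi mu setT f)//.
by apply: eq_measure_integral => A mA _; exact: (lebesgue_preserving mphi h mA).
Qed.

Lemma translation_preserving (a b c : R) : b < c ->
  mu ((fun x => x + a) @^-1` `]b, c]) = (c - b)%:E.
Proof.
move=> bc; rewrite [X in mu X](_ : _ = `]b - a, c - a]%classic).
  by rewrite lebesgue_measure_itv /= lte_fin ltrD2r bc -EFinB; congr EFin; ring.
by apply/seteqP; split => x /=; rewrite !in_itv /= ltrBlDr lerBrDr.
Qed.

Lemma reflection_preserving (a b c : R) : b < c ->
  mu ((fun x => a - x) @^-1` `]b, c]) = (c - b)%:E.
Proof.
move=> bc; rewrite [X in mu X](_ : _ = `[a - c, a - b[%classic).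
  by rewrite lebesgue_measure_itv /= lte_fin ltrD2l ltrN2 bc -EFinB; congr EFin; ring.
apply/seteqP; split => x /=; rewrite !in_itv /= => /andP[h1 h2]; apply/andP; split; lra.
Qed.

Lemma measurable_translation (a : R) : measurable_fun setT (fun x : R => x + a).
Proof. by apply: measurable_funD. Qed.

Lemma measurable_reflection (a : R) : measurable_fun setT (fun x : R => a - x).
Proof. by apply: measurable_funB. Qed.

End LebesgueInvariance.

Section PoissonKernel.
Variable R : realType.
Local Notation mu := (@lebesgue_measure R).
Implicit Types e a b w x : R.

Lemma is_derive_lin a x : is_derive x 1 (fun s : R => a * s) a.
Proof.
have := is_derive_monomial a 0 x; rewrite expr0 !mulr1.
by rewrite (_ : (fun s => _) = (fun s => a * s)).
Qed.

(* The Fourier transform of exp (- e |w|), see [fourier_exp_abs]. *)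
Definition poisson (e a : R) : R := 2 * e / (e ^+ 2 + (2 * pi * a) ^+ 2).

Lemma poisson_den e a : 0 < e -> 0 < e ^+ 2 + (2 * pi * a) ^+ 2.
Proof. by move=> e0; rewrite ltr_pwDl ?exprn_gt0 ?sqr_ge0. Qed.

Lemma poisson_ge0 e a : 0 < e -> 0 <= poisson e a.
Proof. by move=> e0; rewrite divr_ge0 ?mulr_ge0 ?(ltW e0)// ltW// poisson_den. Qed.

Lemma poisson_le e a : 0 < e -> poisson e a <= 2 / e.
Proof.
move=> e0; rewrite /poisson ler_pdivrMr ?poisson_den// mulrDr.
rewrite (_ : 2 / e * e ^+ 2 = 2 * e); last by field; rewrite gt_eqF.
by rewrite lerDl mulr_ge0 ?sqr_ge0// divr_ge0// ltW.
Qed.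

Lemma poissonN e a : poisson e (- a) = poisson e a.
Proof. by rewrite /poisson mulrN sqrrN. Qed.

Lemma continuous_poisson e : 0 < e -> continuous (poisson e).
Proof.
move=> e0 x; apply: cvgM; first exact: cvg_cst.
apply: cvgV; first by rewrite gt_eqF// poisson_den.
apply: cvgD; first exact: cvg_cst.
apply: (@continuous_comp _ _ _ (fun a => 2 * pi * a) (fun a => a ^+ 2)).
  by apply: cvgM; [exact: cvg_cst|exact: cvg_id].
exact: exprn_continuous.
Qed.

Lemma measurable_poisson e : 0 < e -> measurable_fun setT (poisson e).
Proof. by move=> e0; apply: continuous_measurable_fun; exact: continuous_poisson. Qed.

(** By evenness it is twice the half-line integral, with primitive atan (2 pi x / e) / pi, which
    tends to 1 / 2. *)
Lemma integral_poisson e : 0 < e -> (\int[mu]_a (poisson e a)%:E = 1)%E.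
Proof.
move=> e0; have pi0 : 0 < pi :> R := pi_gt0 R.
rewrite ge0_symfun_integralT; first last.
- by move=> x; rewrite /= poissonN.
- exact: continuous_poisson.
- by move=> x; exact: poisson_ge0.
rewrite -set_itvcy.
pose c : R := 2 * pi / e.
have c0 : 0 < c by rewrite divr_gt0 ?mulr_gt0.
pose F (x : R) : R := pi^-1 * atan (c * x).
have dF (x : R) : is_derive x 1 F (poisson e x).
  have h2 := is_derive1_comp (is_derive1_atan (c * x)) (is_derive_lin c x).
  apply: (is_derive_eq (is_deriveZ pi^-1 h2)).
  have := poisson_den x e0.
  rewrite /GRing.scale /= /poisson /c; move: (pi : R) pi0 => P P0 h.
  by field; rewrite !gt_eqF//= addrC.
have cF : continuous F.
  by move=> x; apply/differentiable_continuous/derivable1_diffP; have [] := dF x.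
rewrite (@ge0_continuous_FTC2y _ (poisson e) F 0 (1 / 2)).
- by rewrite /F mulr0 atan0 mulr0 -EFinB -EFinM; congr EFin; field.
- by move=> x _; exact: poisson_ge0.
- exact/continuous_subspaceT/continuous_poisson.
- rewrite (_ : 1 / 2 = pi^-1 * (pi / 2)); last by move: (pi : R) pi0 => P P0; field; rewrite gt_eqF.
  apply: cvgMl_tmp; apply: cvg_comp (@cvgy_atan R).
  apply: gt0_cvgMry => //; exact: cvg_id.
- by move=> x _; have [] := dF x.
- exact/cvg_at_right_filter/cF.
- by move=> x _; rewrite derive1E; have := dF x => ?; rewrite derive_val.
Qed.

(** With 1 + cos in place of cos the integrand is nonnegative, so the fundamental theorem on the
    half-line applies; the case b = 0 is later subtracted to isolate the cosine. *)
Lemma integral_exp_cos e b : 0 < e ->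
  (\int[mu]_w (expR (- (e * `|w|)) * (1 + cos (b * w)))%:E =
   (2 / e + 2 * e / (e ^+ 2 + b ^+ 2))%:E)%E.
Proof.
move=> e0.
pose f (w : R) := expR (- (e * `|w|)) * (1 + cos (b * w)).
have cN : continuous (fun w : R => expR (- (e * `|w|))).
  move=> w; apply: (@continuous_comp _ _ _ (fun w : R => - (e * `|w|)) expR); last exact: continuous_expR.
  by apply: cvgN; apply: cvgM; [exact: cvg_cst|exact: norm_continuous].
have clin : continuous (fun w : R => b * w) by move=> w; apply: cvgM; [exact: cvg_cst|exact: cvg_id].
have cf : continuous f.
  move=> w; apply: cvgM; first exact: cN.
  apply: cvgD; first exact: cvg_cst.
  by apply: (@continuous_comp _ _ _ (fun w : R => b * w) cos); [exact: clin|exact: continuous_cos].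
have cosge (t : R) : 0 <= 1 + cos t by have := cos_geN1 t; lra.
rewrite (ge0_symfun_integralT _ cf); first last.
- by move=> w; rewrite /f /= normrN mulrN cosN.
- by move=> w; rewrite /f mulr_ge0 ?expR_ge0.
rewrite -set_itvcy.
have d0 : 0 < e ^+ 2 + b ^+ 2 by rewrite ltr_pwDl ?exprn_gt0 ?sqr_ge0.
pose h (w : R) := - e^-1 + (b * sin (b * w) - e * cos (b * w)) / (e ^+ 2 + b ^+ 2).
pose F (w : R) := expR (- (e * w)) * h w.
have dF (w : R) : is_derive w 1 F (expR (- (e * w)) * (1 + cos (b * w))).
  have h0 := is_derive1_comp (is_derive_expR (- e * w)) (is_derive_lin (- e) w).
  have h1 := is_derive1_comp (is_derive_sin (b * w)) (is_derive_lin b w).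
  have h2 := is_derive1_comp (is_derive_cos (b * w)) (is_derive_lin b w).
  have h3 := is_deriveB (is_deriveZ b h1) (is_deriveZ e h2).
  have h4 := is_deriveD (is_derive_cst (- e^-1) w 1) (is_deriveZ (e ^+ 2 + b ^+ 2)^-1 h3).
  have h5 := is_deriveM h0 h4.
  rewrite (_ : F = (expR \o (fun s => - e * s)) * (cst (- e^-1) +
      (e ^+ 2 + b ^+ 2)^-1 \*: (b \*: (sin \o (fun s => b * s)) - e \*: (cos \o (fun s => b * s))))); last first.
    by apply/funext => x; rewrite /F /h -mulNr [_ / (e ^+ 2 + b ^+ 2)]mulrC.
  apply: (is_derive_eq h5).
  rewrite [X in _ + X *: _](_ : _ = - e^-1 + (e ^+ 2 + b ^+ 2)^-1 * (b * sin (b * w) - e * cos (b * w)))//.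
  rewrite /GRing.scale /= mulNr.
  move: (expR _) (sin _) (cos _) => E s c.
  by field; rewrite !gt_eqF.
have cF : continuous F.
  by move=> x; apply/differentiable_continuous/derivable1_diffP; have [] := dF x.
have -> : (\int[mu]_(w in `[0%R, +oo[) (f w)%:E = \int[mu]_(w in `[0%R, +oo[) (expR (- (e * w)) * (1 + cos (b * w)))%:E)%E.
  by apply: eq_integral => w; rewrite inE /= in_itv /= andbT => w0; rewrite /f ger0_norm.
rewrite (@ge0_continuous_FTC2y _ _ F 0 0).
- rewrite /F /h !mulr0 oppr0 expR0 sin0 cos0 -EFinB -EFinM; congr EFin; field.
  by rewrite !gt_eqF.
- by move=> x _; rewrite mulr_ge0 ?expR_ge0.
- apply: continuous_subspaceT => w; apply: cvgM.
    apply: (@continuous_comp _ _ _ (fun w : R => - (e * w)) expR); last exact: continuous_expR.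
    by apply: cvgN; apply: cvgM; [exact: cvg_cst|exact: cvg_id].
  apply: cvgD; first exact: cvg_cst.
  by apply: (@continuous_comp _ _ _ (fun w : R => b * w) cos); [exact: clin|exact: continuous_cos].
(* [M] bounds the oscillating factor [h], so the primitive tends to 0 at infinity. *)
- pose M : R := e^-1 + (`|b| + e) / (e ^+ 2 + b ^+ 2).
  have hM (w : R) : `|h w| <= M.
    rewrite (le_trans (ler_normD _ _))// normrN ger0_norm ?invr_ge0 ?(ltW e0)// lerD2l.
    rewrite normrM [X in _ * X]ger0_norm ?invr_ge0 ?(ltW d0)// ler_wpM2r ?invr_ge0 ?(ltW d0)//.
    rewrite (le_trans (ler_normB _ _))// !normrM (gtr0_norm e0) lerD//.
      by rewrite ler_piMr// sin_max.
    by rewrite ler_piMr ?(ltW e0)// cos_max.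
  have E0 : expR (- (e * w)) @[w --> +oo] --> (0 : R).
    by apply: (cvg_comp (fun w => e * w) (fun w => expR (- w))); [apply: gt0_cvgMry => //; exact: cvg_id|exact: cvgr_expR].
  have EM : expR (- (e * w)) * M @[w --> +oo] --> (0 : R).
    by rewrite -(mul0r M); exact: cvgMr_tmp.
  have EM' : - (expR (- (e * w)) * M) @[w --> +oo] --> (0 : R).
    by rewrite -oppr0; exact: cvgN.
  apply: (squeeze_cvgr _ EM' EM); apply: nearW => w.
  rewrite -ler_norml /F normrM ger0_norm ?expR_ge0//.
  by rewrite ler_wpM2l ?expR_ge0.
- by move=> x _; have [] := dF x.
- exact/cvg_at_right_filter/cF.
- by move=> x _; rewrite derive1E; have := dF x => ?; rewrite derive_val.
Qed.

Lemma integral_exp_abs e : 0 < e ->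
  mu.-integrable setT (fun w => (expR (- (e * `|w|)))%:E) /\
  \int[mu]_w expR (- (e * `|w|)) = 2 / e.
Proof.
move=> e0; have := integral_exp_cos 0 e0.
under eq_integral do rewrite mul0r cos0 EFinM muleC.
have mE : measurable_fun setT (fun w : R => expR (- (e * `|w|))).
  apply: measurableT_comp => //; apply: measurable_funN; apply: measurable_funM => //.
rewrite ge0_integralZl//; last exact/measurable_EFinP.
have -> : 2 / e + 2 * e / (e ^+ 2 + 0 ^+ 2) = (1 + 1) * (2 / e).
  by field; rewrite gt_eqF.
rewrite EFinM => h.
have {}h : (\int[mu]_w (expR (- (e * `|w|)))%:E = (2 / e)%:E)%E.
  (* Cancelling the factor 2 in the extended reals: twice an infinite value is not finite. *)
  move: h; case: (integral _ _ _) => [r||].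
  - by rewrite -!EFinM => -[] h; congr EFin; apply: mulfI h; rewrite -[1 + 1]/(2%:R) pnatr_eq0.
  - by rewrite gt0_muley.
  - by rewrite gt0_muleNy.
split; last by rewrite /Rintegral h.
apply/integrableP; split; first exact/measurable_EFinP.
under eq_integral do rewrite /= ger0_norm ?expR_ge0//.
by rewrite h ltry.
Qed.

Lemma fourier_exp_abs e a : 0 < e ->
  \int[mu]_w (expR (- (e * `|w|)) * cos (2 * pi * w * a)) = poisson e a.
Proof.
move=> e0; have [i1 h1] := integral_exp_abs e0.
have mE : measurable_fun setT (fun w : R => expR (- (e * `|w|))).
  by apply/measurable_EFinP; exact: (measurable_int mu i1).
have mc : measurable_fun setT (fun w : R => cos (2 * pi * w * a)).
  apply: measurableT_comp; first exact: (continuous_measurable_fun (@continuous_cos R)).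
  by apply: measurable_funM => //; exact: measurable_funM.
have ic : mu.-integrable setT (EFin \o (fun w => expR (- (e * `|w|)) * cos (2 * pi * w * a))).
  apply: le_integrable i1 => //; first exact/measurable_EFinP/measurable_funM.
  by move=> w _ /=; rewrite lee_fin normrM ler_piMr// cos_max.
have := integral_exp_cos (2 * pi * a) e0.
move=> /(congr1 fine) /=; rewrite -/(Rintegral _ _ _).
under eq_Rintegral do rewrite mulrDr mulr1.
rewrite RintegralD//; last first.
  by apply: eq_integrable ic => // w _ /=; congr (_ * cos _)%:E; ring.
rewrite h1 => /addrI; rewrite -/(poisson e a) => <-.
by apply: eq_Rintegral => w _; congr (_ * cos _); ring.
Qed.

End PoissonKernel.

(** * Parametric integrals and a dominated Fubini theorem *)

Lemma integrable_scale {R : realType} {d : measure_display} {T : measurableType d}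
    (mu : {measure set T -> \bar R}) (c : R) (f : T -> R) :
  mu.-integrable setT (EFin \o f) -> mu.-integrable setT (EFin \o (fun t => c * f t)).
Proof.
by move=> h; rewrite /comp; under eq_fun do rewrite EFinM; exact: integrableZl.
Qed.

Lemma integrable_add {R : realType} {d : measure_display} {T : measurableType d}
    (mu : {measure set T -> \bar R}) (f g : T -> R) :
  mu.-integrable setT (EFin \o f) -> mu.-integrable setT (EFin \o g) ->
  mu.-integrable setT (EFin \o (fun t => f t + g t)).
Proof.
by move=> hf hg; rewrite /comp; under eq_fun do rewrite EFinD; exact: integrableD.
Qed.

Section ParametricIntegral.
Context {R : realType} {d1 d2 : measure_display}.
Context {T1 : measurableType d1} {T2 : measurableType d2}.
Variables (m1 : {sigma_finite_measure set T1 -> \bar R}).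
Variables (m2 : {sigma_finite_measure set T2 -> \bar R}).

(** The integral is the difference of those of the positive and negative parts, each measurable in x
    by Tonelli. *)
Lemma measurable_Rintegral (f : T1 * T2 -> R) : measurable_fun setT f ->
  measurable_fun setT (fun x => \int[m2]_y f (x, y)).
Proof.
move=> mf; apply: measurableT_comp; first exact: (fine_measurable measurableT).
have mf' : measurable_fun setT (EFin \o f) by exact/measurable_EFinP.
rewrite (_ : (fun x => _) = (fun x => (\int[m2]_y ((EFin \o f)^\+%E (x, y)) - \int[m2]_y ((EFin \o f)^\-%E (x, y)))%E)).
  apply: emeasurable_funB.
    apply: (measurable_fun_fubini_tonelli_F (m2 := m2) ((EFin \o f)^\+%E)) => //.
    exact: measurable_funepos.
  apply: (measurable_fun_fubini_tonelli_F (m2 := m2) ((EFin \o f)^\-%E)) => //.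
  exact: measurable_funeneg.
by apply/funext => x; rewrite [LHS]integralE; congr (_ - _)%E; apply: eq_integral => y _; rewrite !(funeposE, funenegE).
Qed.

(** The product bound makes k integrable for the product measure. As it holds at every point, the
    sections are integrable for every x and y, so later rewriting under integrals involves no null
    sets. *)
Lemma dominated_Fubini (u : T1 -> R) (v : T2 -> R) (k : T1 * T2 -> R) :
  m1.-integrable setT (EFin \o u) -> m2.-integrable setT (EFin \o v) ->
  measurable_fun setT k -> (forall x y, `|k (x, y)| <= u x * v y) ->
  [/\ forall x, m2.-integrable setT (fun y => (k (x, y))%:E),
      forall y, m1.-integrable setT (fun x => (k (x, y))%:E),
      m1.-integrable setT (fun x => (\int[m2]_y k (x, y))%:E),
      m2.-integrable setT (fun y => (\int[m1]_x k (x, y))%:E) &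
      \int[m1]_x \int[m2]_y k (x, y) = \int[m2]_y \int[m1]_x k (x, y)].
Proof.
move=> iu iv mk kuv.
have h1 x : m2.-integrable setT (fun y => (k (x, y))%:E).
  have : m2.-integrable setT (fun y => (u x * v y)%:E).
    by under eq_fun do rewrite EFinM; exact: integrableZl.
  apply: le_integrable => //.
    by apply/measurable_EFinP; exact: measurable_fun_pair2.
  by move=> y _ /=; rewrite lee_fin (le_trans (kuv x y))// ler_norm.
have h2 y : m1.-integrable setT (fun x => (k (x, y))%:E).
  have : m1.-integrable setT (fun x => (u x * v y)%:E).
    by under eq_fun do rewrite mulrC EFinM; exact: integrableZl.
  apply: le_integrable => //.
    by apply/measurable_EFinP; exact: measurable_fun_pair1.
  by move=> x _ /=; rewrite lee_fin (le_trans (kuv x y))// ler_norm.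
have ik : (m1 \x m2)%E.-integrable setT (EFin \o k).
  apply/integrable12ltyP; first exact/measurable_EFinP.
  apply: (@le_lt_trans _ _ (\int[m1]_x (`|(u x)%:E| * \int[m2]_y `|(v y)%:E|))%E).
    apply: ge0_le_integral => //.
    - by move=> x _; exact: integral_ge0.
    - apply: (measurable_fun_fubini_tonelli_F (m2 := m2) (fun z => `|(k z)%:E|%E)) => //.
      by apply/measurable_EFinP; exact: measurableT_comp.
    - apply: emeasurable_funM => //.
      by apply: measurableT_comp => //; exact: measurable_int iu.
    move=> x _; rewrite -ge0_integralZl//; last first.
      by apply: measurableT_comp => //; exact: measurable_int iv.
    apply: ge0_le_integral => //.
    - by apply: measurableT_comp => //; exact: measurable_int (h1 x).
    - by apply: emeasurable_funM => //; apply: measurableT_comp => //; exact: measurable_int iv.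
    move=> y _; rewrite -abseM -EFinM /= lee_fin.
    by rewrite (le_trans (kuv x y))// ler_norm.
  have [_ iv'] := integrableP _ _ _ iv; have [mu' iu'] := integrableP _ _ _ iu.
  rewrite ge0_integralZr//; last 2 first.
  - exact: measurableT_comp.
  - exact: integral_ge0.
  by apply: lte_mul_pinfty => //; [exact: integral_ge0|rewrite ge0_fin_numE// integral_ge0].
have E1 x : (\int[m2]_y (k (x, y))%:E)%E = (\int[m2]_y k (x, y))%:E.
  by rewrite /Rintegral fineK//; exact: (integrable_fin_num _ (h1 x)).
have E2 y : (\int[m1]_x (k (x, y))%:E)%E = (\int[m1]_x k (x, y))%:E.
  by rewrite /Rintegral fineK//; exact: (integrable_fin_num _ (h2 y)).
split=> //.
- by under eq_fun do rewrite -E1; exact: (integrable_fubini_F ik).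
- under eq_fun do rewrite -E2.
  apply/integrableP; split; first exact: (measurable_fubini_G ik).
  apply: le_lt_trans ((integrable21ltyP _ _ (measurable_int _ ik)).1 ik).
  apply: ge0_le_integral => //.
  - by apply: measurableT_comp => //; exact: (measurable_fubini_G ik).
  - apply: (measurable_fun_fubini_tonelli_G (m1 := m1) (fun z => `|(k z)%:E|%E)) => //.
    by apply/measurable_EFinP; exact: measurableT_comp.
  - move=> y _; apply: le_abse_integral => //.
    exact: (measurable_int m1 (h2 y)).
have := Fubini ik; rewrite /=.
under eq_integral do rewrite E1; under [in X in _ = X]eq_integral do rewrite E2.
by rewrite /Rintegral => ->.
Qed.

End ParametricIntegral.

(** * The regularised Fourier energy as a pairing with the Poisson kernel *)

Section FourierPoisson.
Variable R : realType.
Local Notation mu := (@lebesgue_measure R).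
Implicit Types (g : R -> R) (e w s t : R).

(** The Fourier transform of g is fcos g - i fsin g; two real functions are kept because the unit I
    will act on quaternion coordinates. *)
Definition fcos g w : R := \int[mu]_t (cos (2 * pi * w * t) * g t).
Definition fsin g w : R := \int[mu]_t (sin (2 * pi * w * t) * g t).

Lemma measurable_cos : measurable_fun setT (@cos R).
Proof. exact: (continuous_measurable_fun (@continuous_cos R)). Qed.

Lemma measurable_sin : measurable_fun setT (@sin R).
Proof. exact: (continuous_measurable_fun (@continuous_sin R)). Qed.

Lemma bounded_integrable g (k : R -> R) : mu.-integrable setT (EFin \o g) ->
  measurable_fun setT k -> (forall t, `|k t| <= 1) ->
  mu.-integrable setT (fun t => (k t * g t)%:E).
Proof.
move=> ig mk k1; apply: le_integrable (ig) => //.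
  apply/measurable_EFinP/measurable_funM => //.
  by apply/measurable_EFinP; exact: (measurable_int mu ig).
by move=> t _ /=; rewrite lee_fin normrM ler_piMl.
Qed.

Lemma measurable_phase (a : R) : measurable_fun setT (fun t : R => a * t).
Proof. exact: measurable_funM. Qed.

Lemma integrable_fcos g w : mu.-integrable setT (EFin \o g) ->
  mu.-integrable setT (fun t => (cos (2 * pi * w * t) * g t)%:E).
Proof.
move=> ig; apply: bounded_integrable => //; last by move=> t; exact: cos_max.
exact: (measurableT_comp measurable_cos (measurable_phase _)).
Qed.

Lemma integrable_fsin g w : mu.-integrable setT (EFin \o g) ->
  mu.-integrable setT (fun t => (sin (2 * pi * w * t) * g t)%:E).
Proof.
move=> ig; apply: bounded_integrable => //; last by move=> t; exact: sin_max.
exact: (measurableT_comp measurable_sin (measurable_phase _)).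
Qed.

Lemma le_Rintegral_norm g (k : R -> R) : mu.-integrable setT (EFin \o g) ->
  measurable_fun setT k -> (forall t, `|k t| <= 1) ->
  `|\int[mu]_t (k t * g t)| <= \int[mu]_t `|g t|.
Proof.
move=> ig mk k1; have ikg := bounded_integrable ig mk k1.
apply: (le_trans (le_normr_Rintegral _ ikg)) => //.
apply: le_Rintegral => //.
- exact: (integrable_norm ikg).
- exact: (integrable_norm ig).
- by move=> t _; rewrite normrM ler_piMl.
Qed.

Lemma measurable_fcos g : measurable_fun setT g -> measurable_fun setT (fcos g).
Proof.
move=> mg; apply: (@measurable_Rintegral R _ _ (measurableTypeR R) (measurableTypeR R) mu
  (fun z => cos (2 * pi * z.1 * z.2) * g z.2)).
apply: measurable_funM; last exact: measurableT_comp.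
apply: (measurableT_comp measurable_cos).
by apply: measurable_funM => //; exact: measurable_funM.
Qed.

Lemma measurable_fsin g : measurable_fun setT g -> measurable_fun setT (fsin g).
Proof.
move=> mg; apply: (@measurable_Rintegral R _ _ (measurableTypeR R) (measurableTypeR R) mu
  (fun z => sin (2 * pi * z.1 * z.2) * g z.2)).
apply: measurable_funM; last exact: measurableT_comp.
apply: (measurableT_comp measurable_sin).
by apply: measurable_funM => //; exact: measurable_funM.
Qed.

Lemma fcosD g w s : mu.-integrable setT (EFin \o g) ->
  fcos g w * cos (2 * pi * w * s) + fsin g w * sin (2 * pi * w * s) =
  \int[mu]_t (cos (2 * pi * w * (s - t)) * g t).
Proof.
move=> ig; rewrite /fcos /fsin mulrC [X in _ + X]mulrC.
rewrite -!RintegralZl//; [|exact: integrable_fsin|exact: integrable_fcos].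
rewrite -RintegralD//; first last.
- by apply: integrable_scale; exact: integrable_fsin.
- by apply: integrable_scale; exact: integrable_fcos.
by apply: eq_Rintegral => t _; rewrite mulrBr cosB; ring.
Qed.

(** With rho w = exp (- e |w|), the inverse transform [U] of rho times the transform of g is the
    Poisson convolution of g; pairing [U] with g gives the energy. Each half is one use of Fubini,
    legitimate because the transform of g is bounded by its L1 norm [N]. *)
Lemma poisson_fourier g e : 0 < e -> mu.-integrable setT (EFin \o g) ->
  [/\ mu.-integrable setT (fun w => (expR (- (e * `|w|)) * (fcos g w ^+ 2 + fsin g w ^+ 2))%:E),
   mu.-integrable setT (fun s => (g s * \int[mu]_t (poisson e (s - t) * g t))%:E) &
  \int[mu]_w (expR (- (e * `|w|)) * (fcos g w ^+ 2 + fsin g w ^+ 2)) =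
  \int[mu]_s (g s * \int[mu]_t (poisson e (s - t) * g t))].
Proof.
move=> e0 ig; have mg : measurable_fun setT g by apply/measurable_EFinP; exact: (measurable_int mu ig).
have [irho _] := integral_exp_abs e0.
pose rho w := expR (- (e * `|w|)); have rho0 w : 0 <= rho w by exact: expR_ge0.
have mrho : measurable_fun setT rho by apply/measurable_EFinP; exact: (measurable_int mu irho).
pose N := \int[mu]_t `|g t|.
have N0 : 0 <= N by apply: Rintegral_ge0.
have cN w : `|fcos g w| <= N.
  apply: le_Rintegral_norm => //; last by move=> t; exact: cos_max.
  exact: (measurableT_comp measurable_cos (measurable_phase _)).
have sN w : `|fsin g w| <= N.
  apply: le_Rintegral_norm => //; last by move=> t; exact: sin_max.
  exact: (measurableT_comp measurable_sin (measurable_phase _)).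
have ing : mu.-integrable setT (EFin \o (fun t => `|g t|)) by exact: (integrable_norm ig).
pose U s := \int[mu]_w (rho w * (fcos g w * cos (2 * pi * w * s) + fsin g w * sin (2 * pi * w * s))).
have UE s : U s = \int[mu]_t (poisson e (s - t) * g t).
  rewrite /U; under eq_Rintegral do rewrite fcosD//.
  pose k (z : R * R) := rho z.1 * (cos (2 * pi * z.1 * (s - z.2)) * g z.2).
  have mk : measurable_fun setT k.
    apply: measurable_funM; first exact: measurableT_comp.
    apply: measurable_funM; last exact: measurableT_comp.
    apply: (measurableT_comp measurable_cos).
    by apply: measurable_funM; [exact: measurable_funM|exact: measurable_funB].
  have bk x y : `|k (x, y)| <= rho x * `|g y|.
    rewrite /k /= normrM (ger0_norm (rho0 x)) ler_wpM2l// normrM ler_piMl// cos_max//.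
  have [h1 h2 h3 h4 h5] := dominated_Fubini irho ing mk bk.
  transitivity (\int[mu]_w \int[mu]_t k (w, t)).
    apply: eq_Rintegral => w _; rewrite /k /= RintegralZl//.
    apply: bounded_integrable => //; last by move=> t; exact: cos_max.
    apply: (measurableT_comp measurable_cos).
    by apply: measurable_funM => //; exact: measurable_funB.
  rewrite h5; apply: eq_Rintegral => t _.
  rewrite -fourier_exp_abs// -RintegralZr//; last first.
    apply: le_integrable (irho) => //.
      apply/measurable_EFinP/measurable_funM => //.
      apply: (measurableT_comp measurable_cos).
      by apply: measurable_funM => //; exact: measurable_funM.
    by move=> w _ /=; rewrite lee_fin normrM ler_piMr// cos_max.
  by apply: eq_Rintegral => w _; rewrite /k /= mulrA.
(* Second exchange: integrating [k] in s first gives the energy density, in w first the pairing with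
   g. *)
pose k0 (z : R * R) := rho z.1 * (fcos g z.1 * cos (2 * pi * z.1 * z.2) + fsin g z.1 * sin (2 * pi * z.1 * z.2)).
pose k (z : R * R) := k0 z * g z.2.
have mk0 : measurable_fun setT k0.
  apply: measurable_funM; first exact: measurableT_comp.
  have mph : measurable_fun setT (fun z : R * R => 2 * pi * z.1 * z.2).
    by apply: measurable_funM => //; exact: measurable_funM.
  apply: measurable_funD; apply: measurable_funM.
  - by apply: measurableT_comp => //; exact: measurable_fcos.
  - exact: (measurableT_comp measurable_cos mph).
  - by apply: measurableT_comp => //; exact: measurable_fsin.
  - exact: (measurableT_comp measurable_sin mph).
have mk : measurable_fun setT k.
  by apply: measurable_funM => //; exact: measurableT_comp.
have bk0 x y : `|k0 (x, y)| <= rho x * (N + N).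
  rewrite /k0 /= normrM (ger0_norm (rho0 x)) ler_wpM2l//.
  rewrite (le_trans (ler_normD _ _))// lerD// normrM.
    by rewrite (le_trans _ (cN x))// ler_piMr// cos_max.
  by rewrite (le_trans _ (sN x))// ler_piMr// sin_max.
have iv : mu.-integrable setT (EFin \o (fun t => (N + N) * `|g t|)).
  exact: integrable_scale.
have bk x y : `|k (x, y)| <= rho x * ((N + N) * `|g y|).
  by rewrite /k normrM mulrA ler_wpM2r.
have [h1 h2 h3 h4 h5] := dominated_Fubini irho iv mk bk.
have E1 w : \int[mu]_s k (w, s) = rho w * (fcos g w ^+ 2 + fsin g w ^+ 2).
  have ic : mu.-integrable setT (fun s => (fcos g w * (cos (2 * pi * w * s) * g s))%:E).
    by apply: integrable_scale; exact: integrable_fcos.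
  have is' : mu.-integrable setT (fun s => (fsin g w * (sin (2 * pi * w * s) * g s))%:E).
    by apply: integrable_scale; exact: integrable_fsin.
  rewrite !expr2 {2}/fcos {2}/fsin -!RintegralZl//; [|exact: integrable_fsin|exact: integrable_fcos].
  rewrite -RintegralD// -RintegralZl//; last exact: integrable_add.
  by apply: eq_Rintegral => s _; rewrite /k /k0 /=; ring.
have E2 s : \int[mu]_w k (w, s) = g s * \int[mu]_t (poisson e (s - t) * g t).
  rewrite -UE mulrC /U -RintegralZr//.
  have irN : mu.-integrable setT (EFin \o (fun w => (N + N) * rho w)).
    exact: integrable_scale.
  apply: le_integrable irN => //.
    by apply/measurable_EFinP; exact: (measurable_fun_pair1 _ mk0).
  by move=> w _ /=; rewrite lee_fin (le_trans (bk0 w s))// mulrC ler_norm.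
split.
- by move: h3; under eq_fun do rewrite E1.
- by move: h4; under eq_fun do rewrite E2.
- under eq_Rintegral do rewrite -E1; rewrite h5.
  by under eq_Rintegral do rewrite E2.
Qed.

End FourierPoisson.

Section PoissonEnergy.
Variable R : realType.
Local Notation mu := (@lebesgue_measure R).
Implicit Types (g : R -> R) (e w s t : R).

Lemma integral_poissonB e s : 0 < e -> (\int[mu]_t (poisson e (s - t))%:E = 1)%E.
Proof.
move=> e0; rewrite -(integral_poisson e0).
apply: (ge0_integral_preserving (f := fun t => (poisson e t)%:E) (measurable_reflection s) (reflection_preserving s)).
- by apply/measurable_EFinP; exact: measurable_poisson.
- by move=> x; rewrite lee_fin poisson_ge0.
Qed.

Lemma integrable_poissonB e s : 0 < e -> mu.-integrable setT (EFin \o (fun t => poisson e (s - t))).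
Proof.
move=> e0; apply/integrableP; split.
  apply/measurable_EFinP; apply: measurableT_comp; first exact: measurable_poisson.
  exact: measurable_reflection.
under eq_integral do rewrite /= ger0_norm ?poisson_ge0//.
by rewrite integral_poissonB// ltry.
Qed.

Lemma integrable_poissonM g e s : 0 < e -> mu.-integrable setT (EFin \o g) ->
  mu.-integrable setT (EFin \o (fun t => poisson e (s - t) * g t)).
Proof.
move=> e0 ig; have h := integrable_scale (2 / e) (integrable_norm ig).
apply: le_integrable (h) => //.
  apply/measurable_EFinP; apply: measurable_funM.
    apply: measurableT_comp; first exact: measurable_poisson.
    exact: measurable_reflection.
  by apply/measurable_EFinP; exact: (measurable_int mu ig).
move=> t _ /=; rewrite lee_fin normrM ger0_norm ?poisson_ge0//.
apply: le_trans (ler_norm _); apply: ler_wpM2r => //; exact: poisson_le.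
Qed.

(** Tonelli and the unit mass of the kernel. It is applied to g^2 when the square in the Poisson
    energy is expanded. *)
Lemma integral_poisson_conv g e : 0 < e -> mu.-integrable setT (EFin \o g) ->
  (forall t, 0 <= g t) ->
  mu.-integrable setT (EFin \o (fun s => \int[mu]_t (poisson e (s - t) * g t))) /\
  \int[mu]_s \int[mu]_t (poisson e (s - t) * g t) = \int[mu]_t g t.
Proof.
move=> e0 ig g0; have mg : measurable_fun setT g by apply/measurable_EFinP; exact: (measurable_int mu ig).
have E s : (\int[mu]_t (poisson e (s - t) * g t))%:E = (\int[mu]_t (poisson e (s - t) * g t)%:E)%E.
  by rewrite /Rintegral fineK//; exact: (integrable_fin_num _ (integrable_poissonM s e0 ig)).
have mP : measurable_fun setT (fun z : R * R => poisson e (z.1 - z.2)).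
  by apply: measurableT_comp; [exact: measurable_poisson|exact: measurable_funB].
have F : (\int[mu]_s (\int[mu]_t (poisson e (s - t) * g t))%:E = \int[mu]_t (g t)%:E)%E.
  under eq_integral do rewrite E.
  rewrite (fubini_tonelli (m1 := mu) (m2 := mu) (fun z : R * R => (poisson e (z.1 - z.2) * g z.2)%:E))//; last 2 first.
  - apply/measurable_EFinP; apply: measurable_funM => //.
    exact: measurableT_comp.
  - by move=> z; rewrite lee_fin mulr_ge0// poisson_ge0.
  apply: eq_integral => t _ /=.
  under eq_integral do rewrite -opprB poissonN mulrC EFinM.
  rewrite ge0_integralZl//.
  - by rewrite integral_poissonB// mule1.
  - apply/measurable_EFinP; apply: measurableT_comp; first exact: measurable_poisson.
    exact: measurable_reflection.
  - by move=> x _; rewrite lee_fin poisson_ge0.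
  - by rewrite lee_fin.
split; last by rewrite /Rintegral F.
apply/integrableP; split.
  apply/measurable_EFinP.
  apply: (@measurable_Rintegral R _ _ (measurableTypeR R) (measurableTypeR R) mu
    (fun z => poisson e (z.1 - z.2) * g z.2)).
  by apply: measurable_funM => //; exact: measurableT_comp.
under eq_integral => s _.
  rewrite /= ger0_norm; last by apply: Rintegral_ge0 => t _; rewrite mulr_ge0// poisson_ge0.
  over.
rewrite F; apply: (integrable_lty _ ig) => //.
Qed.

(* The left-hand side is 2 |g|^2 - 2 <g, poisson e * g> since [poisson e] has mass 1. *)
Lemma poisson_energy g e : 0 < e -> mu.-integrable setT (EFin \o g) ->
  mu.-integrable setT (EFin \o (fun t => g t ^+ 2)) ->
  (\int[mu]_y ((poisson e y)%:E * \int[mu]_s ((g s - g (s + y)) ^+ 2)%:E) =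
  (2 * (\int[mu]_t g t ^+ 2) -
   2 * \int[mu]_w (expR (- (e * `|w|)) * (fcos g w ^+ 2 + fsin g w ^+ 2)))%:E)%E.
Proof.
move=> e0 ig ig2.
have mg : measurable_fun setT g by apply/measurable_EFinP; exact: (measurable_int mu ig).
have [_ igU EU] := poisson_fourier e0 ig.
have [iV EV] := integral_poisson_conv e0 ig2 (fun t => sqr_ge0 (g t)).
pose d (z : R * R) := poisson e (z.1 - z.2) * (g z.1 - g z.2) ^+ 2.
have md : measurable_fun setT d.
  apply: measurable_funM.
    by apply: measurableT_comp; [exact: measurable_poisson|exact: measurable_funB].
  apply: measurable_funX; apply: measurable_funB; exact: measurableT_comp.
have d0 z : 0 <= d z by rewrite mulr_ge0 ?sqr_ge0// poisson_ge0.
have dE s : (\int[mu]_t (d (s, t))%:E)%E = (g s ^+ 2 + (- 2 * (g s * \int[mu]_t (poisson e (s - t) * g t)) +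
    \int[mu]_t (poisson e (s - t) * g t ^+ 2)))%:E.
  have i1 := integrable_scale (g s ^+ 2) (integrable_poissonB s e0).
  have i2 := integrable_scale (- 2 * g s) (integrable_poissonM s e0 ig).
  have i3 := integrable_poissonM s e0 ig2.
  have -> : (\int[mu]_t (d (s, t))%:E)%E = (\int[mu]_t ((g s ^+ 2 * poisson e (s - t))%:E + ((- 2 * g s * (poisson e (s - t) * g t))%:E + (poisson e (s - t) * g t ^+ 2)%:E)))%E.
    by apply: eq_integral => t _; rewrite -!EFinD; congr EFin; rewrite /d /=; ring.
  rewrite integralD//; last by apply: integrableD.
  rewrite integralD//.
  rewrite !EFinD mulrA; congr (_ + (_ + _))%E.
  - under eq_integral do rewrite EFinM.
    rewrite integralZl//; last exact: integrable_poissonB.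
    by rewrite integral_poissonB// mule1.
  - rewrite -RintegralZl//; last exact: integrable_poissonM.
    by rewrite /Rintegral fineK//; exact: (integrable_fin_num _ i2).
  - by rewrite /Rintegral fineK//; exact: (integrable_fin_num _ i3).
have T1 : (\int[mu]_s \int[mu]_t (d (s, t))%:E = (2 * (\int[mu]_t g t ^+ 2) -
   2 * \int[mu]_w (expR (- (e * `|w|)) * (fcos g w ^+ 2 + fsin g w ^+ 2)))%:E)%E.
  under eq_integral do rewrite dE.
  have j2 := integrable_scale (- 2) igU.
  have j3 := integrable_add j2 iV.
  rewrite (_ : (\int[mu]_s _)%E = (\int[mu]_s (g s ^+ 2 + (- 2 * (g s * \int[mu]_t (poisson e (s - t) * g t)) +
    \int[mu]_t (poisson e (s - t) * g t ^+ 2))))%:E); last first.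
    by rewrite /Rintegral fineK//; exact: (integrable_fin_num _ (integrable_add ig2 j3)).
  congr EFin; rewrite RintegralD// RintegralD// RintegralZl//.
  rewrite EV EU; move: (Rintegral _ _ _) (Rintegral _ _ _) => A B; ring.
rewrite -T1.
transitivity (\int[mu]_y \int[mu]_s (poisson e y * (g s - g (s + y)) ^+ 2)%:E)%E.
  apply: eq_integral => y _; rewrite -ge0_integralZl//.
  - apply/measurable_EFinP; apply: measurable_funX; apply: measurable_funB => //.
    by apply: measurableT_comp => //; exact: measurable_translation.
  - by move=> s _; rewrite lee_fin sqr_ge0.
  - by rewrite lee_fin poisson_ge0.
rewrite (fubini_tonelli (m1 := mu) (m2 := mu) (fun z : R * R => (poisson e z.1 * (g z.2 - g (z.2 + z.1)) ^+ 2)%:E))//; last 2 first.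
- apply/measurable_EFinP; apply: measurable_funM.
    by apply: measurableT_comp => //; exact: measurable_poisson.
  apply: measurable_funX; apply: measurable_funB; first exact: measurableT_comp.
  by apply: measurableT_comp => //; exact: measurable_funD.
- by move=> z; rewrite lee_fin mulr_ge0 ?sqr_ge0// poisson_ge0.
apply: eq_integral => s _ /=.
(* The substitution t = s + y, together with the evenness of the kernel, identifies the shifted form
   with the double integral of [d]. *)
rewrite -(ge0_integral_preserving (f := fun t => (d (s, t))%:E) (measurable_translation s) (translation_preserving s)).
- apply: eq_integral => y _; congr EFin.
  by rewrite /d /= opprD addrCA subrr addr0 poissonN [y + s]addrC.
- by apply/measurable_EFinP; exact: (measurable_fun_pair2 _ md).
- by move=> t; rewrite lee_fin.
Qed.

End PoissonEnergy.

(** * Continuity of translations in L2 *)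

Section L2Translation.
Variable R : realType.
Local Notation mu := (@lebesgue_measure R).
Implicit Types (f g h : R -> R) (s t y : R).

Definition shift_energy f y : \bar R := (\int[mu]_s ((f s - f (s + y)) ^+ 2)%:E)%E.

Lemma measurable_shift_sqr f y : measurable_fun setT f ->
  measurable_fun setT (fun s => (f s - f (s + y)) ^+ 2).
Proof.
move=> mf; apply: measurable_funX; apply: measurable_funB => //.
by apply: measurableT_comp => //; exact: measurable_translation.
Qed.

Lemma integral_sqr_shift f y : measurable_fun setT f ->
  (\int[mu]_s (f (s + y) ^+ 2)%:E = \int[mu]_s (f s ^+ 2)%:E)%E.
Proof.
move=> mf; apply: (ge0_integral_preserving (f := fun s => (f s ^+ 2)%:E) (measurable_translation y) (translation_preserving y)).
- by apply/measurable_EFinP; exact: measurable_funX.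
- by move=> s; rewrite lee_fin sqr_ge0.
Qed.

(** A weak triangle inequality from (b + c)^2 <= 2 b^2 + 2 c^2, the source of the constants 4 and 8
    below; the loss is harmless for errors that are arbitrarily small. *)
Lemma integral_sqr_le (u v w : R -> R) : measurable_fun setT u -> measurable_fun setT v ->
  measurable_fun setT w -> (forall s, `|u s| <= `|v s| + `|w s|) ->
  (\int[mu]_s (u s ^+ 2)%:E <= 2%:E * \int[mu]_s (v s ^+ 2)%:E + 2%:E * \int[mu]_s (w s ^+ 2)%:E)%E.
Proof.
move=> hmu mv mw huvw.
have m2 (k : R -> R) : measurable_fun setT k -> measurable_fun setT (fun s : R => (k s ^+ 2)%:E).
  by move=> mk; apply/measurable_EFinP; exact: measurable_funX.
have k0 (k : R -> R) s : (0 <= (k s ^+ 2)%:E)%E by rewrite lee_fin sqr_ge0.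
rewrite -!ge0_integralZl//; [|exact: m2|exact: m2].
rewrite -ge0_integralD//; last 4 first.
- by move=> s _; rewrite mule_ge0.
- by apply: emeasurable_funM => //; exact: m2.
- by move=> s _; rewrite mule_ge0.
- by apply: emeasurable_funM => //; exact: m2.
apply: ge0_le_integral => //.
- exact: m2.
- by apply: emeasurable_funD; apply: emeasurable_funM => //; exact: m2.
move=> s _; rewrite -!EFinM -EFinD lee_fin.
have nk (x : R) : x ^+ 2 = `|x| ^+ 2 by rewrite real_normK ?num_real.
rewrite (nk (u s)) (nk (v s)) (nk (w s)).
have := huvw s; have := normr_ge0 (u s); have := sqr_ge0 (`|v s| - `|w s|).
move: `|u s| `|v s| `|w s| => a b c h1 h2 h3.
have : a ^+ 2 <= (b + c) ^+ 2 by rewrite lerXn2r ?nnegrE//; lra.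
lra.
Qed.

Lemma shift_energy_le f y : measurable_fun setT f ->
  (shift_energy f y <= 4%:E * \int[mu]_s (f s ^+ 2)%:E)%E.
Proof.
move=> mf; apply: le_trans.
  apply: (@integral_sqr_le _ f (fun s => f (s + y))) => //.
  - apply: measurable_funB => //.
    by apply: measurableT_comp => //; exact: measurable_translation.
  - by apply: measurableT_comp => //; exact: measurable_translation.
  - by move=> s; exact: ler_normB.
rewrite integral_sqr_shift// -ge0_muleDl//.
by rewrite -EFinD (_ : 2 + 2 = 4 :> R)//; lra.
Qed.

Lemma shift_energy_triangle f h y : measurable_fun setT f -> measurable_fun setT h ->
  (shift_energy f y <= 8%:E * \int[mu]_s ((f s - h s) ^+ 2)%:E + 2%:E * shift_energy h y)%E.
Proof.
move=> mf mh.
have mfh : measurable_fun setT (fun s => f s - h s) by exact: measurable_funB.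
have mD (k : R -> R) : measurable_fun setT k -> measurable_fun setT (fun s : R => k s - k (s + y)).
  move=> mk; apply: measurable_funB => //.
  by apply: measurableT_comp => //; exact: measurable_translation.
apply: le_trans.
  apply: (@integral_sqr_le _ (fun s => (f s - h s) - (f (s + y) - h (s + y))) (fun s => h s - h (s + y))).
  - exact: mD.
  - exact: (mD _ mfh).
  - exact: mD.
  - move=> s; rewrite (_ : f s - f (s + y) = ((f s - h s) - (f (s + y) - h (s + y))) + (h s - h (s + y))); last by ring.
    exact: ler_normD.
apply: leeD => //.
have := shift_energy_le y mfh; rewrite /shift_energy => h1.
apply: (le_trans (lee_wpmul2l _ h1)) => //.
by rewrite muleA -EFinM (_ : 2 * 4 = 8 :> R)//; lra.
Qed.

(** Put f to 0 where |s| or |f s| exceeds n: at each point the error vanishes from some n on, and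
    its square is dominated by f^2. *)
Lemma truncation_approx f (delta : R) : measurable_fun setT f ->
  mu.-integrable setT (EFin \o (fun s => f s ^+ 2)) -> 0 < delta ->
  exists N : R, exists g, [/\ 0 <= N, measurable_fun setT g,
    forall s, `|g s| <= N, forall s, N < `|s| -> g s = 0 &
    (\int[mu]_s ((f s - g s) ^+ 2)%:E <= delta%:E)%E].
Proof.
move=> mf if2 d0.
pose b (n : nat) s := (`|s| <= n%:R) && (`|f s| <= n%:R).
pose g n s := if b n s then f s else 0.
have mg n : measurable_fun setT (g n).
  apply: measurable_fun_ifT => //.
  apply: measurable_and; apply: measurable_fun_ler => //; exact: measurableT_comp.
have mfg n : measurable_fun setT (fun s => ((f s - g n s) ^+ 2)%:E).
  by apply/measurable_EFinP; apply: measurable_funX; exact: measurable_funB.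
have bnd n s : (f s - g n s) ^+ 2 <= f s ^+ 2.
  by rewrite /g; case: ifP => _; rewrite ?subrr ?subr0// expr0n sqr_ge0.
have ifg n : mu.-integrable setT (fun s => ((f s - g n s) ^+ 2)%:E).
  apply: le_integrable (if2) => //; first exact: mfg.
  move=> s _ /=.
  by rewrite lee_fin !ger0_norm ?sqr_ge0.
have [||_ _] := @dominated_convergence _ _ _ mu setT measurableT
  (fun n s => ((f s - g n s) ^+ 2)%:E) (cst 0%E) (fun s => (f s ^+ 2)%:E) mfg (@measurable_cst _ _ _ _ _ _) _ if2 _.
- apply: aeW => s _; apply: cvg_near_cst.
  near=> n.
  rewrite /g /b.
  have h1 : `|s| <= n%:R by near: n; exact: nbhs_infty_ger.
  have h2 : `|f s| <= n%:R by near: n; exact: nbhs_infty_ger.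
  by rewrite h1 h2 /= subrr expr0n.
- by apply: aeW => s n _ /=; rewrite lee_fin ger0_norm ?sqr_ge0.
rewrite /= integral0 => /fine_cvgP[_].
move=> /cvgr0Pnorm_le /(_ delta d0) [n _ /(_ n (leqnn n))] /= hn.
exists n%:R, (g n); split => //.
- by move=> s; rewrite /g /b; case: ifP => [/andP[]//|_]; rewrite normr0.
- by move=> s; rewrite /g /b ltNge => /negbTE ->.
rewrite -(fineK (integrable_fin_num _ (ifg n)))// lee_fin.
by apply: le_trans hn; exact: ler_norm.
Unshelve. all: by end_near. Qed.

(** An L1 approximation g of the truncation f1 is upgraded to L2: clamping g to [- N, N] brings it
    no further from f1, and a difference bounded by 2 N has its square at most 2 N times its
    absolute value. *)
Lemma continuous_approx f (delta : R) : measurable_fun setT f ->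
  mu.-integrable setT (EFin \o (fun s => f s ^+ 2)) -> 0 < delta ->
  exists N : R, exists h, [/\ 0 <= N, continuous h,
    forall s, `|h s| <= N, forall s, N < `|s| -> h s = 0 &
    (\int[mu]_s ((f s - h s) ^+ 2)%:E <= delta%:E)%E].
Proof.
move=> mf if2 d0.
have d4 : 0 < delta / 4 by rewrite divr_gt0.
have [N [f1 [N0 mf1 f1N f10 hf1]]] := truncation_approx mf if2 d4.
pose E := `[- (N + 1), N + 1]%classic : set R.
have mE : measurable E by exact: measurable_itv.
have Efin : (mu E < +oo)%E.
  by rewrite /E lebesgue_measure_itv /=; case: ifP => _; rewrite ?ltry// -EFinB ltry.
have iE : mu.-integrable E (EFin \o f1).
  apply: measurable_bounded_integrable => //; first exact: measurable_funTS.
  exists N; split; first exact: num_real.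
  by move=> M NM s _; apply: (le_trans (f1N s)); exact: ltW.
have [g_ [cg ig g_cvg]] := approximation_continuous_integrable mE Efin iE.
(* The accuracy absorbs the factor 2 N; the denominator has 2 N + 1 so that N = 0 is allowed. *)
have [n hn] : exists n, (\int[mu]_(z in E) `|(f1 z - g_ n z)%:E| <= (delta / (4 * (2 * N + 1)))%:E)%E.
  move/fine_cvgP : g_cvg => [gf /cvgr0Pnorm_le].
  have e0 : 0 < delta / (4 * (2 * N + 1)) by rewrite divr_gt0// mulr_gt0//; lra.
  move=> /(_ _ e0) ge; near \oo => n; exists n.
  rewrite -[leLHS]fineK; last by near: n.
  by rewrite lee_fin (le_trans (ler_norm _))//; near: n.
pose g := g_ n.
pose c s := Num.max (- N) (Num.min N (g s)).
(* A continuous cutoff equal to 1 on [- N, N], outside of which f1 is 0, and vanishing outside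
   [- (N + 1), N + 1]. *)
pose tent s := Num.max 0 (Num.min 1 (N + 1 - `|s|)).
have ccont : continuous c.
  move=> s; apply: (@continuous_max R R (cst (- N)) (fun s => Num.min N (g s)) s); first exact: cvg_cst.
  by apply: (@continuous_min R R (cst N) g s); [exact: cvg_cst|exact: cg].
have tcont : continuous tent.
  move=> s; apply: (@continuous_max R R (cst 0) (fun s => Num.min 1 (N + 1 - `|s|)) s); first exact: cvg_cst.
  apply: (@continuous_min R R (cst 1) (fun s => N + 1 - `|s|) s); first exact: cvg_cst.
  by apply: cvgB; [exact: cvg_cst|exact: norm_continuous].
have cN s : `|c s| <= N.
  by rewrite ler_norml /c /Num.max /Num.min; case: ifP; case: ifP; lra.
have t01 s : 0 <= tent s <= 1.
  by rewrite /tent /Num.max /Num.min; case: ifP; case: ifP; lra.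
exists (N + 1), (fun s => c s * tent s); split.
- lra.
- by move=> s; apply: cvgM; [exact: ccont|exact: tcont].
- move=> s; have /andP[t0 t1] := t01 s; rewrite normrM (ger0_norm t0).
  have := cN s; have := normr_ge0 (c s); move: `|c s| (tent s) t0 t1 => a b; nra.
- move=> s hs; rewrite [tent s](_ : _ = 0) ?mulr0//.
  by rewrite /tent /Num.max /Num.min; case: ifP; case: ifP; lra.
have mh : measurable_fun setT (fun s => c s * tent s).
  by apply: continuous_measurable_fun => s; apply: cvgM; [exact: ccont|exact: tcont].
have key s : (f1 s - c s * tent s) ^+ 2 <= ((fun s => 2 * N * `|f1 s - g s|) \_ E) s.
  rewrite patchE mem_setE /E in_itv /= -ler_norml.
  have f1s := f1N s; have cs := cN s; have /andP[t0 t1] := t01 s.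
  case: (lerP `|s| (N + 1)) => sN1; last first.
    rewrite f10; last by lra.
    rewrite [tent s](_ : _ = 0) ?mulr0 ?subrr ?expr0n//.
    by rewrite /tent /Num.max /Num.min; case: ifP; case: ifP; lra.
  have cle : `|f1 s - c s| <= `|f1 s - g s|.
    move: f1s; rewrite ler_norml /c /Num.max /Num.min => /andP[f1a f1b].
    have := ler_norm (f1 s - g s); have := ler_norm (- (f1 s - g s)); rewrite normrN.
    rewrite ler_norml; case: ifP; case: ifP; lra.
  have cle0 : `|f1 s - c s * tent s| <= `|f1 s - g s|.
    case: (lerP `|s| N) => sN.
      rewrite [tent s](_ : _ = 1) ?mulr1//.
      by rewrite /tent /Num.max /Num.min; case: ifP; case: ifP; lra.
    move: cle; rewrite f10// !sub0r !normrN; apply: le_trans.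
    by rewrite normrM (ger0_norm t0) ler_piMr.
  have cle1 : `|f1 s - c s * tent s| <= 2 * N.
    rewrite (le_trans (ler_normB _ _))// normrM (ger0_norm t0).
    have := normr_ge0 (c s); nra.
  rewrite -(real_normK (num_real (f1 s - c s * tent s))) expr2.
  by apply: ler_pM.
have mk : measurable_fun E (fun s => `|f1 s - g s|).
  apply: measurableT_comp => //; apply: measurable_funB; first exact: measurable_funTS.
  by apply: measurable_funTS; apply: continuous_measurable_fun; exact: cg.
have h1 : (\int[mu]_s ((f1 s - c s * tent s) ^+ 2)%:E <= (delta / 4)%:E)%E.
  apply: (@le_trans _ _ (\int[mu]_s (((fun s => 2 * N * `|f1 s - g s|) \_ E) s)%:E)%E).
    apply: ge0_le_integral => //.
    - by move=> s _; rewrite lee_fin sqr_ge0.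
    - by apply/measurable_EFinP; apply: measurable_funX; exact: measurable_funB.
    - apply/measurable_EFinP; apply: (iffLR (measurable_restrictT _ mE)).
      exact: measurable_funM.
    - by move=> s _; rewrite lee_fin.
  have -> : (\int[mu]_s (((fun s => 2 * N * `|f1 s - g s|) \_ E) s)%:E =
      \int[mu]_(s in E) ((2 * N)%:E * (`|f1 s - g s|)%:E))%E.
    by rewrite [RHS]integral_mkcond; apply: eq_integral => s _; rewrite !patchE; case: ifP.
  rewrite ge0_integralZl//; last 2 first.
  - exact/measurable_EFinP.
  - by rewrite lee_fin mulr_ge0.
  apply: (le_trans (lee_wpmul2l _ hn)); first by rewrite lee_fin mulr_ge0.
  have N1 : 0 < 2 * N + 1 by lra.
  rewrite -EFinM lee_fin [leLHS](_ : _ = delta / 4 * (2 * N / (2 * N + 1))).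
    by apply: ler_piMr; [exact: ltW|rewrite ler_pdivrMr//; lra].
  by field; rewrite gt_eqF.
apply: le_trans.
  apply: (@integral_sqr_le _ (fun s => f s - f1 s) (fun s => f1 s - c s * tent s)).
  - exact: measurable_funB.
  - exact: measurable_funB.
  - exact: measurable_funB.
  - by move=> s; rewrite -[f s - _](subrKA (f1 s)); exact: ler_normD.
apply: (@le_trans _ _ (2%:E * (delta / 4)%:E + 2%:E * (delta / 4)%:E)%E).
  by apply: leeD; apply: lee_wpmul2l.
rewrite -!EFinM -EFinD lee_fin; lra.
Unshelve. all: by end_near. Qed.

(** Continuity under the integral: shifts by |y| < 1 keep the difference supported in
    [- (N + 1), N + 1], where its square is at most (2 N)^2. *)
Lemma shift_energy_cvg0_cont h (N delta : R) : 0 <= N -> continuous h ->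
  (forall s, `|h s| <= N) -> (forall s, N < `|s| -> h s = 0) -> 0 < delta ->
  \forall y \near 0, (shift_energy h y <= delta%:E)%E.
Proof.
move=> N0 ch hN h0 d0.
have mh : measurable_fun setT h by exact: continuous_measurable_fun.
pose F (y s : R) : R := (h s - h (s + y)) ^+ 2.
pose G (s : R) : R := (2 * N) ^+ 2 * \1_(`[- (N + 1), N + 1]%classic) s.
have iG : mu.-integrable setT (EFin \o G).
  by apply: integrable_scale; exact: integrable_indic_itv.
have FG y s : (`](-1), 1[%classic : set R) y -> `|F y s| <= G s.
  rewrite /= in_itv /= -ltr_norml => y1; rewrite ger0_norm ?sqr_ge0// /F /G indicE.
  rewrite mem_setE in_itv /= -ler_norml; case: (lerP `|s| (N + 1)) => sN.
    rewrite mulr1 -(real_normK (num_real (h s - _))) lerXn2r ?nnegrE ?mulr_ge0//.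
    by rewrite (le_trans (ler_normB _ _))// mulr2n mulrDl !mul1r lerD.
  have := ler_normB (s + y) y; rewrite addrK => hs.
  by rewrite h0 ?h0 ?subrr ?expr0n ?mulr0//; lra.
have iF y : (`](-1), 1[%classic : set R) y -> mu.-integrable setT (EFin \o F y).
  move=> y1; apply: le_integrable (iG) => //.
    by apply/measurable_EFinP; exact: measurable_shift_sqr.
  by move=> s _ /=; rewrite lee_fin (le_trans (FG _ _ y1))// ler_norm.
have I0 : (`](-1), 1[%classic : set R) 0 by rewrite /= in_itv /= oppr_lt0 ltr01.
have := @continuity_under_integral R _ _ mu F setT measurableT (-1) 1 iF _ G iG _ 0 (mem_set I0).
have cF : {ae mu, forall s : R, setT s -> {in (`](-1), 1[%classic : set R), continuous (F ^~ s)}}.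
  apply: aeW => s _ y _; rewrite /F.
  apply: (@continuous_comp _ _ _ (fun y => h s - h (s + y)) (fun x => x ^+ 2)); last exact: exprn_continuous.
  apply: cvgB; first exact: cvg_cst.
  apply: (@continuous_comp _ _ _ (fun y => s + y) h); last exact: ch.
  by apply: cvgD; [exact: cvg_cst|exact: cvg_id].
have bF y : (`](-1), 1[%classic : set R) y -> {ae mu, forall s : R, setT s -> `|F y s| <= G s}.
  by move=> y1; apply: aeW => s _; exact: FG.
move=> /(_ cF bF).
have F00 : \int[mu]_s F 0 s = 0.
  rewrite /Rintegral (eq_integral (cst 0%E)) ?integral0// => s _.
  by rewrite /F addr0 subrr expr0n.
rewrite /prop_for /continuous_at F00 => /cvgr0Pnorm_le /(_ _ d0) H.
near=> y.
have y1 : y \in `](-1), 1[.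
  by near: y; apply: near_in_itvoo; rewrite in_itv /= oppr_lt0 ltr01.
rewrite /shift_energy -(fineK (integrable_fin_num _ (iF y y1)))// lee_fin.
by apply: (le_trans (ler_norm _)); near: y.
Unshelve. all: by end_near. Qed.

Lemma shift_energy_cvg0 f (delta : R) : measurable_fun setT f ->
  mu.-integrable setT (EFin \o (fun s => f s ^+ 2)) -> 0 < delta ->
  \forall y \near 0, (shift_energy f y <= delta%:E)%E.
Proof.
move=> mf if2 d0.
(* Chosen so that 8 (delta / 16) + 2 (delta / 4) = delta. *)
have d1 : 0 < delta / 16 by rewrite divr_gt0.
have d2 : 0 < delta / 4 by rewrite divr_gt0.
have [N [h [N0 ch hN h0 hf]]] := continuous_approx mf if2 d1.
have mh : measurable_fun setT h by exact: continuous_measurable_fun.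
near=> y.
have hy : (shift_energy h y <= (delta / 4)%:E)%E.
  by near: y; exact: (shift_energy_cvg0_cont N0 ch hN h0 d2).
apply: (le_trans (shift_energy_triangle y mf mh)).
apply: (@le_trans _ _ (8%:E * (delta / 16)%:E + 2%:E * (delta / 4)%:E)%E).
  by apply: leeD; apply: lee_wpmul2l.
rewrite -!EFinM -EFinD lee_fin; lra.
Unshelve. all: by end_near. Qed.

End L2Translation.

(** * Removing the regularisation *)

Section Plancherel.
Variable R : realType.
Local Notation mu := (@lebesgue_measure R).
Implicit Types (g : R -> R) (e w s t y : R).

(** Away from 0 the kernel is O(e) times the fixed integrable function [poisson 1]. With a and b the
    squares of 2 pi eta and 2 pi y, it rests on (1 + b) / b <= 1 + 1 / a for b >= a. *)
Lemma poisson_tail (eta y e : R) : 0 < eta -> eta <= `|y| -> 0 < e ->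
  poisson e y <= (1 + ((2 * pi * eta) ^+ 2)^-1) * e * poisson 1 y.
Proof.
move=> eta0 ey e0; have pi0 : 0 < pi :> R := pi_gt0 R.
have h : (2 * pi * eta) ^+ 2 <= (2 * pi * y) ^+ 2.
  rewrite [leLHS]exprMn [leRHS]exprMn; apply: ler_wpM2l; first exact: sqr_ge0.
  by rewrite -(real_normK (num_real y)) lerXn2r ?nnegrE// ltW.
have h0 : 0 < (2 * pi * eta) ^+ 2 by rewrite exprn_gt0// !mulr_gt0.
rewrite /poisson expr1n mulr1.
move: ((2 * pi * eta) ^+ 2) ((2 * pi * y) ^+ 2) h h0 => a b ab a0.
have b0 : 0 < b by exact: lt_le_trans ab.
rewrite ler_pdivrMr; last by rewrite ltr_pwDl ?exprn_gt0// ltW.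
rewrite -mulrA [X in _ <= X](_ : _ = (2 * e) * (((1 + a^-1) * (e ^+ 2 + b)) / (1 + b))); last first.
  by field; rewrite !gt_eqF//; lra.
rewrite -[leLHS]mulr1 ler_wpM2l ?mulr_ge0 ?(ltW e0)// ler_pdivlMr; last by lra.
have : 1 <= a^-1 * b by rewrite mulrC ler_pdivlMr// mul1r.
have := sqr_ge0 e; have : 0 <= a^-1 by rewrite invr_ge0 ltW.
move: (a^-1) (e ^+ 2) => c d; nra.
Qed.

Lemma poisson_energy_cvg0 g : measurable_fun setT g ->
  mu.-integrable setT (EFin \o (fun t => g t ^+ 2)) ->
  forall delta : R, 0 < delta -> \forall n \near \oo,
  (\int[mu]_y ((poisson n.+1%:R^-1 y)%:E * shift_energy g y) <= delta%:E)%E.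
Proof.
move=> mg ig2 delta d0; pose A := \int[mu]_t g t ^+ 2.
have AE : (\int[mu]_t (g t ^+ 2)%:E = A%:E)%E.
  by rewrite /A /Rintegral fineK//; exact: (integrable_fin_num _ ig2).
have A0 : 0 <= A by apply: Rintegral_ge0 => t _; rewrite sqr_ge0.
have d2 : 0 < delta / 2 by rewrite divr_gt0.
have [eta /= eta0 H] := (nbhs_ballP _ _).1 (shift_energy_cvg0 mg ig2 d2).
pose K : R := 1 + ((2 * pi * eta) ^+ 2)^-1.
have K0 : 0 <= K by rewrite addr_ge0// invr_ge0 sqr_ge0.
have E4 y : (shift_energy g y <= (4 * A)%:E)%E.
  by rewrite EFinM -AE; exact: shift_energy_le.
have E0 y : (0 <= shift_energy g y)%E.
  by apply: integral_ge0 => s _; rewrite lee_fin sqr_ge0.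
have EF y : shift_energy g y = (fine (shift_energy g y))%:E.
  by rewrite fineK// ge0_fin_numE// (le_lt_trans (E4 y))// ltry.
have mE : measurable_fun setT (fun y => shift_energy g y).
  apply: (measurable_fun_fubini_tonelli_F (m2 := mu) (fun z : R * R => ((g z.2 - g (z.2 + z.1)) ^+ 2)%:E)).
    apply/measurable_EFinP; apply: measurable_funX; apply: measurable_funB; first exact: measurableT_comp.
    by apply: measurableT_comp => //; exact: measurable_funD.
  by move=> z; rewrite lee_fin sqr_ge0.
(* For |y| < eta the shift energy is at most delta / 2 and the kernel has mass 1; elsewhere the
   shift energy is at most 4 A and the tail bound applies. *)
have bnd e : 0 < e -> (\int[mu]_y ((poisson e y)%:E * shift_energy g y) <= (delta / 2 + K * (4 * A) * e)%:E)%E.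
  move=> e0.
  have KA0 : 0 <= K * (4 * A) * e.
    by apply: mulr_ge0; [apply: mulr_ge0 => //; exact: mulr_ge0|exact: ltW].
  have mP := measurable_poisson e0; have mP1 := measurable_poisson (ltr01 : 0 < 1 :> R).
  have le1 y : (((poisson e y)%:E * shift_energy g y) <= ((delta / 2)%:E * (poisson e y)%:E + (K * (4 * A) * e)%:E * (poisson 1 y)%:E))%E.
    rewrite EF -!EFinM -EFinD lee_fin.
    have P0 := poisson_ge0 y e0; have P10 := poisson_ge0 y (ltr01 : 0 < 1 :> R).
    have r4 : fine (shift_energy g y) <= 4 * A by rewrite -lee_fin -EF.
    have r0 : 0 <= fine (shift_energy g y) by rewrite -lee_fin -EF.
    case: (ltP `|y| eta) => hy.
      have rd : fine (shift_energy g y) <= delta / 2.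
        by rewrite -lee_fin -EF; apply: H; rewrite /ball /= sub0r normrN.
      apply: (@le_trans _ _ (delta / 2 * poisson e y)); first by rewrite mulrC ler_wpM2r.
      by rewrite lerDl; exact: mulr_ge0.
    apply: (@le_trans _ _ (K * (4 * A) * e * poisson 1 y)).
      apply: (@le_trans _ _ (K * e * poisson 1 y * (4 * A))).
        by rewrite ler_pM//; exact: poisson_tail.
      by rewrite le_eqVlt; apply/orP; left; apply/eqP; ring.
    by rewrite lerDr; apply: mulr_ge0 => //; exact: ltW.
  apply: (@le_trans _ _ (\int[mu]_y ((delta / 2)%:E * (poisson e y)%:E + (K * (4 * A) * e)%:E * (poisson 1 y)%:E))%E).
    apply: ge0_le_integral => //.
    - by move=> y _; rewrite mule_ge0// lee_fin poisson_ge0.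
    - by apply: emeasurable_funM => //; exact/measurable_EFinP.
    - by apply: emeasurable_funD; apply: emeasurable_funM => //; exact/measurable_EFinP.
  have p1 y : (0 <= (poisson e y)%:E)%E by rewrite lee_fin poisson_ge0.
  have p2 y : (0 <= (poisson 1 y)%:E)%E by rewrite lee_fin poisson_ge0.
  have c1 : (0 <= (delta / 2)%:E)%E by rewrite lee_fin ltW.
  have c2 : (0 <= (K * (4 * A) * e)%:E)%E by rewrite lee_fin.
  rewrite ge0_integralD//; last 4 first.
  - by move=> y _; rewrite mule_ge0.
  - by apply: emeasurable_funM => //; exact/measurable_EFinP.
  - by move=> y _; rewrite mule_ge0.
  - by apply: emeasurable_funM => //; exact/measurable_EFinP.
  rewrite !ge0_integralZl//; [|exact/measurable_EFinP|exact/measurable_EFinP].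
  by rewrite !integral_poisson// !mule1 -EFinD.
have cv : (K * (4 * A) * n.+1%:R^-1) @[n --> \oo] --> (0 : R).
  rewrite -(mulr0 (K * (4 * A))); apply: cvgMl_tmp.
  exact: cvg_harmonic.
move/cvgr0Pnorm_le : cv => /(_ _ d2); apply: filterS => n hn.
apply: (le_trans (bnd _ _)); first by rewrite invr_gt0.
rewrite lee_fin; have := le_trans (ler_norm _) hn.
by move: (K * (4 * A) * _) => x; lra.
Qed.

(** The regularised energies converge in two ways as e = 1 / (n + 1) decreases: by monotone
    convergence to the full Fourier energy, which could a priori be infinite, and by
    [poisson_energy] to the squared norm of g. *)
Lemma plancherel g : mu.-integrable setT (EFin \o g) ->
  mu.-integrable setT (EFin \o (fun t => g t ^+ 2)) ->
  (\int[mu]_w (fcos g w ^+ 2 + fsin g w ^+ 2)%:E = \int[mu]_t (g t ^+ 2)%:E)%E.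
Proof.
move=> ig ig2; pose A := \int[mu]_t g t ^+ 2.
have mg : measurable_fun setT g by apply/measurable_EFinP; exact: (measurable_int mu ig).
have -> : (\int[mu]_t (g t ^+ 2)%:E = A%:E)%E.
  by rewrite /A /Rintegral fineK//; exact: (integrable_fin_num _ ig2).
pose Q w := fcos g w ^+ 2 + fsin g w ^+ 2.
have Q0 w : 0 <= Q w by rewrite addr_ge0 ?sqr_ge0.
have mQ : measurable_fun setT Q.
  by apply: measurable_funD; apply: measurable_funX; [exact: measurable_fcos|exact: measurable_fsin].
pose e (n : nat) : R := n.+1%:R^-1.
have e0 n : 0 < e n by rewrite invr_gt0.
pose f n w := (expR (- (e n * `|w|)) * Q w)%:E.
have iE n : (\int[mu]_w f n w = (\int[mu]_w (expR (- (e n * `|w|)) * Q w))%:E)%E.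
  have [h _ _] := poisson_fourier (e0 n) ig.
  by rewrite /Rintegral fineK//; exact: (integrable_fin_num _ h).
have mf n : measurable_fun setT (f n).
  apply/measurable_EFinP; apply: measurable_funM => //.
  by have [h _] := integral_exp_abs (e0 n); apply/measurable_EFinP; exact: (measurable_int mu h).
have cvg1 : (\int[mu]_w f n w)%E @[n --> \oo] --> (\int[mu]_w (Q w)%:E)%E.
  have := @cvg_monotone_convergence _ _ _ mu setT measurableT f mf.
  have -> : (\int[mu]_w (Q w)%:E)%E = (\int[mu]_w limn (f ^~ w))%E.
    apply: eq_integral => w _; apply/esym/cvg_lim => //.
    apply: cvg_EFin; first exact: nearW.
    rewrite /f /= -[X in _ --> X]mul1r -expR0.
    apply: cvgMr_tmp; apply: (@cvg_comp _ _ _ (fun n => - (e n * `|w|)) expR); last exact: continuous_expR.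
    rewrite -oppr0 -(mul0r `|w|); apply: cvgN; apply: cvgMr_tmp.
    exact: cvg_harmonic.
  apply.
  - by move=> n w _; rewrite lee_fin mulr_ge0 ?expR_ge0.
  - move=> w _ m n mn; rewrite lee_fin ler_wpM2r// ler_expR lerN2 ler_wpM2r//.
    by rewrite /e lef_pV2 ?posrE// ler_nat.
have cvg2 : (\int[mu]_w f n w)%E @[n --> \oo] --> A%:E.
  under eq_fun do rewrite iE.
  apply: cvg_EFin; first exact: nearW.
  apply/cvgrPdist_le => delta d0.
  have := poisson_energy_cvg0 mg ig2 d0; apply: filterS => n.
  rewrite /shift_energy poisson_energy//.
  rewrite lee_fin -/A -/(e n) => hn.
  (* Nonnegativity of the Poisson energy gives the other side of the estimate, hence a bound on the
     absolute difference. *)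
  have : (0%:E <= (2 * A - 2 * \int[mu]_w (expR (- (e n * `|w|)) * (fcos g w ^+ 2 + fsin g w ^+ 2)))%:E)%E.
    rewrite -poisson_energy//; apply: integral_ge0 => y _.
    by rewrite mule_ge0 ?lee_fin ?poisson_ge0//; apply: integral_ge0 => s _; rewrite lee_fin sqr_ge0.
  rewrite lee_fin /= /comp /= -/(Q _); move: hn; set I := \int[mu]_w _ => h1 h2.
  rewrite ger0_norm; lra.
exact: (cvg_unique _ cvg1 cvg2).
Qed.

End Plancherel.

(** * Orthogonality of the windows *)
Section HermiteOrthogonality.
Variable R : realType.
Local Notation mu := (@lebesgue_measure R).
Implicit Types (s t x : R) (j k : nat).

(** At q = 0 the kernel derivatives are the Hermite functions, which thus inherit measurability and
    Gaussian bounds from [bker]. *)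
Lemma bker0 j s (J : quat R) : J ^+ 2 = -1 -> bker j (slice J 0 0) s = (hgauss j s)%:A.
Proof.
move=> J2; rewrite /bker ell_slice quat_exp_bexp// !mulr0 add0r slice_real herm_alg.
have -> : breal 0 0 s = - (pi * s ^+ 2) by rewrite /breal; ring.
have -> : bimag 0 0 s = 0 by rewrite /bimag; ring.
by rewrite cos0 sin0 mulr1 mulr0 slice_real /hgauss -scalerA mulr_algl.
Qed.

Lemma unit_i : (Quat 0 1 0 0 : quat R) ^+ 2 = -1.
Proof. by apply: quatP; rewrite expr2 /=; ring. Qed.

Lemma hgauss_bound j : exists2 C : R, 0 <= C & forall s, `|hgauss j s| <= C * expR (- (pi / 2 * s ^+ 2)).
Proof.
have [C C0 hC] := bker_bound j unit_i (lexx 0).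
by exists C => // s; rewrite -(norm_alg (hgauss j s)) -(bker0 j s unit_i) hC ?normr0.
Qed.

Lemma measurable_hgauss j : measurable_fun setT (@hgauss R j).
Proof.
have [h _ _ _] := quat_measurable_bker j 0 0 unit_i.
apply: eq_measurable_fun h => s _; rewrite bker0 ?unit_i//=.
by rewrite mulr1.
Qed.

Lemma hgaussS j s : hgauss j.+1 s = 2 * pi * Num.sqrt 2 * s * hgauss j s - 2 * pi * j%:R * hgauss j.-1 s.
Proof. by rewrite /hgauss hermS mulrBl -!mulrA. Qed.

Lemma is_derive_hgauss j s : is_derive s 1 (@hgauss R j)
  (2 * pi * Num.sqrt 2 * (j%:R * hgauss j.-1 s) - 2 * pi * s * hgauss j s).
Proof.
pose sg : R := 2 * pi * Num.sqrt 2.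
have h1 := is_derive1_comp (is_derive_herm j (sg * s)) (is_derive_lin sg s).
have h0 : is_derive s 1 (fun x : R => - (pi * x ^+ 2)) (- pi * (2 * s)).
  rewrite (_ : (fun x : R => - (pi * x ^+ 2)) = (fun x : R => - pi * x ^+ 2)); last by apply/funext => x; rewrite mulNr.
  by apply: (is_derive_eq (is_derive_monomial _ _ _)).
have h2 := @is_derive1_comp R expR (fun x : R => - (pi * x ^+ 2)) s _ _ (is_derive_expR _) h0.
apply: (is_derive_eq (is_deriveM h1 h2)).
rewrite /GRing.scale /hgauss /= -/sg.
move: (expR _) (herm _ _) (herm _ _) => E a b; ring.
Qed.

Lemma hgauss2_bound j k : exists2 C : R, 0 <= C & forall s u : R, `|u| <= 1 ->
  `|hgauss j (s + u) * hgauss k (s + u)| <= C * expR (- (pi / 2 * s ^+ 2)).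
Proof.
have [C C0 hC] := hgauss_bound j; have [D D0 hD] := hgauss_bound k.
have pi0 : 0 < pi :> R := pi_gt0 R.
(* From (s + u)^2 = s^2 / 2 + (s + 2 u)^2 / 2 - u^2 and u^2 <= 1: half of the decay survives the
   shift, at the cost of a factor exp pi. *)
exists (C * D * expR pi) => [|s u u1]; first by rewrite !mulr_ge0 ?expR_ge0.
apply: (@le_trans _ _ ((C * expR (- (pi / 2 * (s + u) ^+ 2))) * (D * expR (- (pi / 2 * (s + u) ^+ 2))))).
  by rewrite normrM ler_pM.
rewrite [leLHS]mulrACA -expRD -[leRHS]mulrA -expRD ler_wpM2l ?mulr_ge0// ler_expR.
have u2 : u ^+ 2 <= 1 by rewrite -(real_normK (num_real u)) expr_le1.
have : 0 <= (s + 2 * u) ^+ 2 by exact: sqr_ge0.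
have : 0 <= pi * ((s + 2 * u) ^+ 2 / 2 + (1 - u ^+ 2)).
  by rewrite mulr_ge0 ?(ltW pi0)// addr_ge0 ?divr_ge0 ?sqr_ge0// subr_ge0.
move: (pi : R) => P; lra.
Qed.

Lemma integrable_gauss1 (C : R) : mu.-integrable setT (EFin \o (fun s => C * expR (- (pi / 2 * s ^+ 2)))).
Proof.
apply: integrable_scale; apply: (gaussian_integral _).1.
by rewrite divr_gt0 ?pi_gt0.
Qed.

Lemma integrable_hgauss2 j k : mu.-integrable setT (EFin \o (fun s => hgauss j s * hgauss k s)).
Proof.
have [C C0 hC] := hgauss2_bound j k.
apply: le_integrable (integrable_gauss1 C) => //.
  by apply/measurable_EFinP; apply: measurable_funM; exact: measurable_hgauss.
move=> s _ /=; rewrite lee_fin; have := hC s 0; rewrite normr0 addr0 => /(_ ler01) h.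
by apply: (le_trans h); exact: ler_norm.
Qed.

Definition hprod j k : R := \int[mu]_s (hgauss j s * hgauss k s).

Lemma hprodC j k : hprod j k = hprod k j.
Proof. by apply: eq_Rintegral => s _; rewrite mulrC. Qed.

(** Integration by parts for F = hgauss j * hgauss k. By [hgaussS] and (2 pi sqrt 2)^2 = 8 pi^2, its
    derivative [f] involves only the products in the statement, so it remains to show that [f] has
    integral 0. *)
Lemma hprodS j k : hprod j.+1 k = 2 * pi * k%:R * hprod j k.-1.
Proof.
have pi0 : 0 < pi :> R := pi_gt0 R.
pose sg : R := 2 * pi * Num.sqrt 2.
have sg2 : sg * sg = 8 * pi ^+ 2.
  have : Num.sqrt 2 * Num.sqrt 2 = 2 :> R by rewrite -expr2 sqr_sqrtr.
  rewrite /sg; move: (Num.sqrt (2 : R)) (pi : R) => z P hz.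
  by rewrite mulrACA hz; ring.
have sg0 : sg != 0 by rewrite gt_eqF// !mulr_gt0// sqrtr_gt0.
pose F s := hgauss j s * hgauss k s.
pose f s := sg * (k%:R * (hgauss j s * hgauss k.-1 s)) - sg / (2 * pi) * (hgauss j.+1 s * hgauss k s).
have dF s : is_derive s 1 F (f s).
  apply: (is_derive_eq (is_deriveM (is_derive_hgauss j s) (is_derive_hgauss k s))).
  rewrite /GRing.scale /= /f hgaussS -/sg.
  rewrite [RHS](_ : _ = sg * (k%:R * (hgauss j s * hgauss k.-1 s)) -
    (sg * sg) / (2 * pi) * s * (hgauss j s * hgauss k s) + sg * (j%:R * hgauss j.-1 s) * hgauss k s); last first.
    move: (hgauss _ _) (hgauss _ _) (hgauss _ _) (hgauss _ _) (sg) => a b c d g.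
    by move: (pi : R) pi0 => P P0; field; rewrite gt_eqF.
  rewrite sg2.
  move: (hgauss _ _) (hgauss _ _) (hgauss _ _) (hgauss _ _) (sg) => a b c d g.
  by move: (pi : R) pi0 => P P0; field; rewrite gt_eqF.
have i1 := integrable_hgauss2 j k.-1.
have i2 := integrable_hgauss2 j.+1 k.
have [C1 C10 hC1] := hgauss2_bound j k.-1; have [C2 C20 hC2] := hgauss2_bound j.+1 k.
have f0 : \int[mu]_s f s = 0.
  (* Boundary terms are avoided by translation invariance: the integral of [Phi u] does not depend
     on u, and its derivative at u = 0 is the integral of [f]. *)
  pose Phi (u s : R) := F (s + u).
  pose D : R := sg * (k%:R * C1) + sg / (2 * pi) * C2.
  have sgp : 0 <= sg by rewrite !mulr_ge0 ?sqrtr_ge0 ?(ltW pi0).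
  have sgpp : 0 <= sg / (2 * pi) by rewrite divr_ge0 ?mulr_ge0 ?(ltW pi0).
  have dPhi (u s : R) : is_derive u 1 (Phi ^~ s) (f (s + u)).
    have h : is_derive u 1 (fun u : R => s + u) 1.
      apply: (is_derive_eq (is_deriveD (is_derive_cst s u 1) (is_derive_id u 1))).
      by rewrite add0r.
    by have := is_derive1_comp (dF (s + u)) h; rewrite mulr1.
  have intPhi u : mu.-integrable setT (EFin \o Phi u) /\ \int[mu]_s Phi u s = \int[mu]_s F s.
    have [h1 h2] := integral_preserving (measurable_translation u) (translation_preserving u) (integrable_hgauss2 j k).
    by split=> //; rewrite /Rintegral; congr fine; exact: h2.
  have := @cvg_differentiation_under_integral R _ _ mu Phi setT measurableT 0 (-1) 1.
  have z0 : (0 : R) \in `](-1), 1[ by rewrite in_itv /= oppr_lt0 ltr01.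
  move=> /(_ z0 _ _ (fun s => D * expR (- (pi / 2 * s ^+ 2)))).
  have -> : (\int[mu]_s partial1of2 Phi 0 s) = \int[mu]_s f s.
    apply: eq_Rintegral => s _; rewrite partial1of2E; have := dPhi 0 s => ?; rewrite derive_val.
    by rewrite addr0.
  have -> : (fun h : R => h^-1 *: (\int[mu]_s Phi (h + 0) s - \int[mu]_s Phi 0 s) : R) = cst 0.
    by apply/funext => h; rewrite (intPhi (h + 0)).2 (intPhi 0).2 subrr scaler0.
  move=> H; suff H2 : (cst 0 : R -> R) x @[x --> (0 : R)^'] --> \int[mu]_s f s.
    exact: (cvg_unique _ H2 (cvg_cst _)).
  apply: H.
  - by move=> u _; exact: (intPhi u).1.
  - by move=> u s _ _; have [] := dPhi u s.
  - by move=> s; apply: mulr_ge0; [apply: addr_ge0; apply: mulr_ge0 => //; exact: mulr_ge0|exact: expR_ge0].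
  - exact: integrable_gauss1.
  - move=> u s u1 _; rewrite partial1of2E; have := dPhi u s => ?; rewrite derive_val.
    have {}u1 : `|u| <= 1 by move: u1; rewrite /= in_itv /= -ltr_norml => /ltW.
    apply: (le_trans (ler_normB _ _)); rewrite /D [leRHS]mulrDl; apply: lerD.
      rewrite normrM (ger0_norm sgp) normrM normr_nat -[leRHS]mulrA; apply: ler_wpM2l => //.
      by rewrite -[leRHS]mulrA; apply: ler_wpM2l => //; exact: hC1.
    rewrite normrM (ger0_norm sgpp) -[leRHS]mulrA.
    by apply: ler_wpM2l => //; exact: hC2.
have j1 : mu.-integrable setT (EFin \o (fun s => sg * (k%:R * (hgauss j s * hgauss k.-1 s)))).
  by apply: integrable_scale; exact: integrable_scale.
have j2 := integrable_scale (sg / (2 * pi)) i2.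
move: f0; rewrite /f RintegralB// RintegralZl//; last exact: integrable_scale.
rewrite RintegralZl// RintegralZl// -/(hprod _ _) -/(hprod _ _) => h.
have : sg * (k%:R * hprod j k.-1 - hprod j.+1 k / (2 * pi)) = 0.
  rewrite -[RHS]h; move: (hprod _ _) (hprod _ _) (sg) => a b g.
  by move: (pi : R) pi0 => P P0; field; rewrite gt_eqF.
move/eqP; rewrite mulf_eq0 (negbTE sg0) /= subr_eq0 => /eqP.
move: (hprod j k.-1) (hprod j.+1 k) => a b.
move: (pi : R) pi0 => P P0 hab.
have : 2 * P * (k%:R * a) = b by rewrite hab; field; rewrite gt_eqF.
by move=> <-; ring.
Qed.

(** [hprodS] lowers both indices at once; unequal indices end with 0 against a positive index, where
    its factor is 0, and equal ones end with the Gaussian integral. *)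
Lemma hprodE j k : hprod j k = (j == k)%:R * ((2 * pi) ^+ j * j`!%:R) * Num.sqrt (2^-1).
Proof.
elim: j k => [|j ih] [|k].
- rewrite eqxx expr0 fact0 !mul1r.
  have c0 : 0 < 2 * pi :> R by rewrite mulr_gt0 ?pi_gt0.
  have [_ h] := gaussian_integral c0.
  have -> : Num.sqrt 2^-1 = Num.sqrt (pi / (2 * pi)) :> R.
    congr Num.sqrt; move: (pi : R) (pi_gt0 R) => P P0; field; rewrite gt_eqF//.
  rewrite /hprod /Rintegral -[RHS]/(fine (Num.sqrt (pi / (2 * pi)))%:E) -h; congr fine.
  apply: eq_integral => s _; congr EFin; rewrite /hgauss !herm0 !mul1r -expRD.
  by congr expR; ring.
- by rewrite hprodC hprodS /= mulr0 !mul0r.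
- by rewrite hprodS /= mulr0 !mul0r.
- rewrite hprodS /= ih eqSS; case: eqP => [->|_]; last by rewrite !mul0r mulr0.
  by rewrite factS natrM exprS; ring.
Qed.

Lemma window_orthogonal j k t :
  mu.-integrable setT (EFin \o (fun x => window j (t - x) * window k (t - x))) /\
  \int[mu]_x (window j (t - x) * window k (t - x)) = 2 * (j == k)%:R.
Proof.
pose c i : R := (-1) ^+ i * Num.sqrt (1 / ((2 * pi) ^+ i * i`!%:R)) * 2 `^ (3 / 4).
have wE s : window j s * window k s = (c j * c k) * (hgauss j s * hgauss k s).
  by rewrite /window -/(c j) -/(c k) mulrACA.
have iw : mu.-integrable setT (EFin \o (fun s => window j s * window k s)).
  by rewrite (_ : (fun s => _) = (fun s => (c j * c k) * (hgauss j s * hgauss k s)));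
    [exact/integrable_scale/integrable_hgauss2|exact/funext].
have [h1 h2] := integral_preserving (measurable_reflection t) (reflection_preserving t) iw.
split=> //; rewrite /Rintegral [X in fine X]h2 -/(Rintegral _ _ _).
under eq_Rintegral do rewrite wE.
rewrite RintegralZl//; last exact: integrable_hgauss2.
rewrite -/(hprod j k) hprodE; case: eqP => [->|_]; last by rewrite !mul0r !mulr0.
rewrite mulr1 mul1r /c.
set A := (2 * pi) ^+ k * _.
have A0 : 0 < A by rewrite mulr_gt0 ?exprn_gt0 ?mulr_gt0 ?pi_gt0// ltr0n fact_gt0.
have e1 : Num.sqrt (1 / A) * Num.sqrt (1 / A) = 1 / A.
  by rewrite -expr2 sqr_sqrtr// divr_ge0// ltW.
(* The constant 2 arises here, as 2^(3/2) times the 2^(-1/2) of [hprodE]. *)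
have e2 : (2 : R) `^ (3 / 4) * 2 `^ (3 / 4) = 2 * Num.sqrt 2.
  rewrite -powRD; last by rewrite pnatr_eq0 implybT.
  rewrite (_ : 3 / 4 + 3 / 4 = 1 + 2^-1); last by field.
  by rewrite powRD ?pnatr_eq0 ?implybT// powRr1// powR12_sqrt.
have e3 : Num.sqrt 2 * Num.sqrt 2^-1 = 1 :> R.
  by rewrite -sqrtrM// divff ?pnatr_eq0// sqrtr1.
have e4 : (-1) ^+ k * (-1) ^+ k = 1 :> R by rewrite -expr2 sqrr_sign.
rewrite [LHS](_ : _ = ((-1) ^+ k * (-1) ^+ k) * (Num.sqrt (1 / A) * Num.sqrt (1 / A)) *
  (2 `^ (3 / 4) * 2 `^ (3 / 4)) * A * Num.sqrt 2^-1); last first.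
  by move: ((-1) ^+ k) (Num.sqrt (1 / A)) (2 `^ (3 / 4)) (Num.sqrt 2^-1) => *; ring.
rewrite e1 e2 e4 mul1r.
have -> : 1 / A * (2 * Num.sqrt 2) * A * Num.sqrt 2^-1 = 2 * (Num.sqrt 2 * Num.sqrt 2^-1).
  by move: (Num.sqrt (2 : R)) (Num.sqrt (2^-1 : R)) => z z'; field; rewrite gt_eqF.
by rewrite e3 mulr1.
Qed.

End HermiteOrthogonality.

(** * The norm of the short-time Fourier transform *)
Section Assembly.
Variable R : realType.
Local Notation mu := (@lebesgue_measure R).
Implicit Types (s t x w : R).

(** For fixed x, the function of t whose Fourier transform in w is the short-time transform. *)
Definition windowed n (phi : 'I_n.+1 -> R -> quat R) x t : quat R :=
  \sum_(j < n.+1) window j (t - x) *: phi j t.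

Lemma window_bound (j : nat) : exists2 C : R, 0 <= C & forall s, `|window j s| <= C * expR (- (pi / 2 * s ^+ 2)).
Proof.
have [C C0 hC] := @hgauss_bound R j.
rewrite /window; set c := _ * 2 `^ _.
exists (`|c| * C) => [|s]; first exact: mulr_ge0.
by rewrite normrM -[leRHS]mulrA; apply: ler_wpM2l.
Qed.

Lemma measurable_window (j : nat) : measurable_fun setT (@window R j).
Proof. by apply: measurable_funM => //; exact: measurable_hgauss. Qed.

Lemma integrable_gauss_shift x (C : R) :
  mu.-integrable setT (EFin \o (fun t => C * expR (- (pi / 2 * (t - x) ^+ 2)))).
Proof.
by have [] := integral_preserving (measurable_translation (- x)) (translation_preserving (- x)) (integrable_gauss1 C).
Qed.

Lemma quat_measurable_comp {d1 d2 : measure_display} {T1 : measurableType d1} {T2 : measurableType d2}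
    (f : T2 -> quat R) (u : T1 -> T2) : quat_measurable f -> measurable_fun setT u ->
  quat_measurable (f \o u).
Proof.
move=> /quat_measurableP hf hu; apply/quat_measurableP => k.
exact: (measurableT_comp (hf k) hu).
Qed.

Lemma measurable_windowed n (phi : 'I_n.+1 -> R -> quat R) :
  (forall j, quat_measurable (phi j)) ->
  quat_measurable (fun z : R * R => windowed phi z.1 z.2).
Proof.
move=> hphi; apply: quat_measurable_sum => j; apply: quat_measurableZ.
  apply: measurableT_comp; first exact: measurable_window.
  exact: measurable_funB.
exact: (quat_measurable_comp (hphi j) measurable_snd).
Qed.

(** Supplies the hypotheses of [plancherel] for each coordinate. For L1, |phi_j| <= 1 + |phi_j|^2
    against the Gaussian; for L2, the Gaussian is at most 1 and the squared sum of n + 1 terms is at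
    most n + 1 times the sum of squares. *)
Lemma windowed_L2 n (phi : 'I_n.+1 -> R -> quat R) x (l : 'I_4) :
  (forall j, inL2 mu (phi j)) ->
  mu.-integrable setT (EFin \o (fun t => qcoord l (windowed phi x t))) /\
  mu.-integrable setT (EFin \o (fun t => qcoord l (windowed phi x t) ^+ 2)).
Proof.
move=> hphi.
have mw : quat_measurable (windowed phi x).
  exact: (quat_measurable_comp (measurable_windowed (fun j => (hphi j).1)) (pair1_measurable x)).
have mwl : measurable_fun setT (fun t => qcoord l (windowed phi x t)).
  exact: ((quat_measurableP _).1 mw l).
have [C C0 hC] : exists2 C : R, 0 <= C & forall (j : 'I_n.+1) s, `|window j s| <= C * expR (- (pi / 2 * s ^+ 2)).
  have /choice[C hC] : forall j : 'I_n.+1, exists C : R, 0 <= C /\ forall s, `|window j s| <= C * expR (- (pi / 2 * s ^+ 2)).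
    by move=> j; have [C C0 hC] := window_bound j; exists C.
  (* The sum of the nonnegative constants serves all windows at once. *)
  exists (\sum_(j < n.+1) C j) => [|j s]; first by apply: sumr_ge0 => j _; have [] := hC j.
  apply: (le_trans ((hC j).2 s)); rewrite ler_wpM2r ?expR_ge0// (bigD1 j)//= lerDl.
  by apply: sumr_ge0 => i _; have [] := hC i.
pose S t := \sum_(j < n.+1) `|phi j t| ^+ 2.
have S0 t : 0 <= S t by apply: sumr_ge0 => j _; exact: sqr_ge0.
have iS : mu.-integrable setT (EFin \o S).
  exact: (Rintegral_sum (fun j => inL2_integrable (hphi j))).1.
have E1 t : expR (- (pi / 2 * (t - x) ^+ 2)) <= 1.
  rewrite -[leRHS]expR0 ler_expR oppr_le0 mulr_ge0 ?sqr_ge0// divr_ge0// pi_ge0//.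
have bnd t : `|windowed phi x t| <= C * expR (- (pi / 2 * (t - x) ^+ 2)) * \sum_(j < n.+1) `|phi j t|.
  rewrite (le_trans (ler_norm_sum _ _ _))// mulr_sumr; apply: ler_sum => j _.
  by rewrite normrZ; apply: ler_wpM2r.
have sum1 t : \sum_(j < n.+1) `|phi j t| <= n.+1%:R + S t.
  have -> : n.+1%:R = \sum_(j < n.+1) 1 :> R by rewrite sumr_const card_ord.
  rewrite -big_split /=; apply: ler_sum => j _.
  have := sqr_ge0 (`|phi j t| - 1); have := sqr_ge0 (`|phi j t|); lra.
have sum0 t : 0 <= \sum_(j < n.+1) `|phi j t| by apply: sumr_ge0.
have sum2 t : (\sum_(j < n.+1) `|phi j t|) ^+ 2 <= n.+1%:R * S t.
  rewrite expr2 big_distrlr /=.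
  apply: (@le_trans _ _ (\sum_(i < n.+1) \sum_(j < n.+1) (2^-1 * `|phi i t| ^+ 2 + 2^-1 * `|phi j t| ^+ 2))).
    apply: ler_sum => i _; apply: ler_sum => j _.
    have := sqr_ge0 (`|phi i t| - `|phi j t|); lra.
  under eq_bigr do rewrite big_split /= sumr_const card_ord -mulr_sumr.
  rewrite big_split /= sumr_const card_ord sumrMnl -mulr_sumr -/(S t) -mulrnDl -mulrDl.
  by rewrite (_ : 2^-1 + 2^-1 = 1 :> R) ?mul1r ?mulr_natl//; field.
split.
  have h := integrable_add (integrable_gauss_shift x (C * n.+1%:R)) (integrable_scale C iS).
  apply: le_integrable (h) => //; first exact/measurable_EFinP.
  move=> t _ /=; rewrite lee_fin (le_trans (norm_qcoord _ _))// (le_trans (bnd t))//.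
  apply: le_trans (ler_norm _).
  apply: (@le_trans _ _ (C * expR (- (pi / 2 * (t - x) ^+ 2)) * (n.+1%:R + S t))).
    by rewrite ler_wpM2l// mulr_ge0// expR_ge0.
  rewrite mulrDr; apply: lerD; first by rewrite mulrAC.
  by apply: ler_wpM2r => //; rewrite -[leRHS]mulr1; apply: ler_wpM2l.
apply: le_integrable (integrable_scale (C ^+ 2 * n.+1%:R) iS) => //.
  by apply/measurable_EFinP; exact: measurable_funX.
move=> t _ /=; rewrite lee_fin ger0_norm ?sqr_ge0//; apply: le_trans (ler_norm _).
rewrite -(real_normK (num_real (qcoord l _))).
apply: (@le_trans _ _ ((C * \sum_(j < n.+1) `|phi j t|) ^+ 2)).
  rewrite lerXn2r ?nnegrE ?mulr_ge0// (le_trans (norm_qcoord _ _))// (le_trans (bnd t))//.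
  by apply: ler_wpM2r => //; rewrite -[leRHS]mulr1; apply: ler_wpM2l.
by rewrite exprMn -mulrA; apply: ler_wpM2l; [exact: sqr_ge0|exact: sum2].
Qed.

Definition phase (I : quat R) w t : quat R :=
  slice I (cos (2 * pi * w * t)) (- sin (2 * pi * w * t)).

(** All components carry the same phase on the left, so their transforms merge into one Fourier
    integral. *)
Lemma full_poly_qstft_window n (phi : 'I_n.+1 -> R -> quat R) (I : quat R) x w :
  (forall j, inL2 mu (phi j)) -> I ^+ 2 = -1 ->
  full_poly_qstft I phi (x, w) = quat_integral mu (fun t => phase I w t * windowed phi x t).
Proof.
move=> hphi I2; rewrite /full_poly_qstft /full_bargmann mulr_sumr mulr_suml.
have h (j : 'I_n.+1) := true_bargmann_window j x w (hphi j) I2.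
under eq_bigr => j _ do rewrite (h j).2.
rewrite -(quat_integral_sum (fun j => (h j).1)).2; congr quat_integral.
apply/funext => t; rewrite /windowed mulr_sumr; apply: eq_bigr => j _.
by rewrite scalerAr.
Qed.

Definition quat_of (F : 'I_4 -> R) : quat R :=
  Quat (F (@Ordinal 4 0 isT)) (F (@Ordinal 4 1 isT)) (F (@Ordinal 4 2 isT)) (F (@Ordinal 4 3 isT)).

Lemma qcoord_quat_of F l : qcoord l (quat_of F) = F l.
Proof.
case: l => [[|[|[|[|//]]]] lt4]; rewrite /qcoord /=; congr F; exact: val_inj.
Qed.

Definition qfcos (G : R -> quat R) w := quat_of (fun l => fcos (fun t => qcoord l (G t)) w).
Definition qfsin (G : R -> quat R) w := quat_of (fun l => fsin (fun t => qcoord l (G t)) w).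

Lemma quat_integral_phase (I : quat R) (G : R -> quat R) w : qintegrable mu G -> I ^+ 2 = -1 ->
  quat_integral mu (fun t => phase I w t * G t) = qfcos G w - I * qfsin G w.
Proof.
move=> iG I2.
have ic : qintegrable mu (fun t => cos (2 * pi * w * t) *: G t).
  by move=> k; under eq_fun do rewrite linearZ /=; exact: (integrable_fcos w (iG k)).
have is' : qintegrable mu (fun t => sin (2 * pi * w * t) *: G t).
  by move=> k; under eq_fun do rewrite linearZ /=; exact: (integrable_fsin w (iG k)).
have [h1 h2] := quat_integralMl (- I) is'.
have [h3 h4] := quat_integralD ic h1.
rewrite (_ : (fun t => phase I w t * G t) = (fun t => cos (2 * pi * w * t) *: G t + - I * (sin (2 * pi * w * t) *: G t))).
  rewrite h4 h2 mulNr; congr (_ - _ * _); apply: qcoordP => l; rewrite qcoord_integral qcoord_quat_of;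
    by apply: eq_Rintegral => t _; rewrite linearZ.
apply/funext => t; rewrite /phase /slice mulrDl -(scalerAl _ 1 (G t)) mul1r; congr (_ + _).
by rewrite -(scalerAl _ I (G t)) scaleNr mulNr -(scalerAr _ I (G t)).
Qed.

Lemma norm_sqr_parallelogram (p q : quat R) :
  `|p - q| ^+ 2 + `|p + q| ^+ 2 = 2 * (`|p| ^+ 2 + `|q| ^+ 2).
Proof. by rewrite !normq_sqrE /=; ring. Qed.

(** Stated with 0 - w to match the reflections x |-> a - x at a = 0. *)
Lemma fcosN (g : R -> R) w : fcos g (0 - w) = fcos g w.
Proof.
apply: eq_Rintegral => t _; rewrite (_ : 2 * pi * (0 - w) * t = - (2 * pi * w * t)) ?cosN//.
by rewrite sub0r mulrN mulNr.
Qed.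

Lemma fsinN (g : R -> R) w : mu.-integrable setT (EFin \o g) -> fsin g (0 - w) = - fsin g w.
Proof.
move=> ig; rewrite /fsin -[RHS]mulN1r -RintegralZl//; last exact: integrable_fsin.
apply: eq_Rintegral => t _; rewrite (_ : 2 * pi * (0 - w) * t = - (2 * pi * w * t)) ?sinN ?mulN1r ?mulNr//.
by rewrite sub0r mulrN mulNr.
Qed.

(** The transform is V = C - I S with quaternion-valued cosine and sine parts. Its reflection is C +
    I S, so the parallelogram law and |I| = 1 reduce the claim to the real identity for the four
    coordinates. *)
Lemma quat_plancherel (I : quat R) (G : R -> quat R) : I ^+ 2 = -1 ->
  (forall l, mu.-integrable setT (EFin \o (fun t => qcoord l (G t)))) ->
  (forall l, mu.-integrable setT (EFin \o (fun t => qcoord l (G t) ^+ 2))) ->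
  (\int[mu]_w (`|quat_integral mu (fun t => phase I w t * G t)| ^+ 2)%:E =
   \int[mu]_t (`|G t| ^+ 2)%:E)%E.
Proof.
move=> I2 iG iG2.
have mG l : measurable_fun setT (fun t => qcoord l (G t)).
  by apply/measurable_EFinP; exact: (measurable_int mu (iG l)).
pose V w := qfcos G w - I * qfsin G w.
transitivity (\int[mu]_w (`|V w| ^+ 2)%:E)%E.
  by apply: eq_integral => w _; rewrite quat_integral_phase.
pose P l w := fcos (fun t => qcoord l (G t)) w ^+ 2 + fsin (fun t => qcoord l (G t)) w ^+ 2.
have VE w : `|V w| ^+ 2 + `|V (0 - w)| ^+ 2 = 2 * \sum_(l < 4) P l w.
  (* The cross terms of |V w|^2 are odd in w, so they disappear after symmetrisation. *)
  have -> : V (0 - w) = qfcos G w + I * qfsin G w.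
    rewrite /V -mulrN; congr (_ + _ * _); apply: qcoordP => l.
      by rewrite !qcoord_quat_of fcosN.
    by rewrite linearN /= !qcoord_quat_of fsinN// opprK.
  rewrite norm_sqr_parallelogram normqM (norm_unit I2).
  rewrite mul1r !normq_sqr -big_split /=.
  by congr (_ * _); apply: eq_bigr => l _; rewrite !qcoord_quat_of.
have mV : quat_measurable V.
  apply/quat_measurableP => l; rewrite /V.
  under eq_fun do rewrite -mulNr linearD /= qcoordM.
  apply: measurable_funD.
    by under eq_fun do rewrite qcoord_quat_of; exact: measurable_fcos.
  apply: measurable_sum => i; apply: measurable_funM => //.
  by under eq_fun do rewrite qcoord_quat_of; exact: measurable_fsin.
have mV2 : measurable_fun setT (fun w => (`|V w| ^+ 2)%:E).
  by apply/measurable_EFinP; apply: measurable_funX; exact: measurable_normq.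
have V0 w : (0 <= (`|V w| ^+ 2)%:E)%E by rewrite lee_fin sqr_ge0.
have mP l : measurable_fun setT (fun w => (P l w)%:E).
  by apply/measurable_EFinP; apply: measurable_funD; apply: measurable_funX;
    [exact: measurable_fcos|exact: measurable_fsin].
have P0 l w : (0 <= (P l w)%:E)%E by rewrite lee_fin addr_ge0 ?sqr_ge0.
have iP : (\int[mu]_w (\sum_(l < 4) P l w)%:E = \int[mu]_t (`|G t| ^+ 2)%:E)%E.
  under eq_integral do rewrite -sumEFin.
  under [RHS]eq_integral do rewrite normq_sqr -sumEFin.
  rewrite ge0_integral_sum// ge0_integral_sum//.
  - by apply: eq_bigr => l _; exact: plancherel.
  - by move=> l; exact: (measurable_int mu (iG2 l)).
  - by move=> l t _; rewrite lee_fin sqr_ge0.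
(* Reflection invariance doubles the integral of |V|^2 into the symmetrised one. *)
have H : (2%:E * \int[mu]_w (`|V w| ^+ 2)%:E = 2%:E * \int[mu]_w (\sum_(l < 4) P l w)%:E)%E.
  transitivity (\int[mu]_w ((`|V w| ^+ 2)%:E + (`|V (0 - w)| ^+ 2)%:E))%E.
    rewrite ge0_integralD//; last first.
      by apply: (measurableT_comp mV2); exact: measurable_reflection.
    rewrite (ge0_integral_preserving (measurable_reflection 0) (reflection_preserving 0) mV2)//.
    by rewrite -mule2n mule_natl.
  rewrite -ge0_integralZl//; last 2 first.
  - by under eq_fun do rewrite -sumEFin; exact: emeasurable_sum.
  - by move=> w _; rewrite -sumEFin; apply: sume_ge0.
  by apply: eq_integral => w _; rewrite -EFinD VE EFinM.
rewrite -iP; move: H => /(congr1 (fun z => (2^-1)%:E * z)%E).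
by rewrite !muleA -EFinM mulVf ?pnatr_eq0// !mul1e.
Qed.

(** With t fixed the values phi_j t are constants, and orthogonality of the windows in x kills the
    terms with j distinct from k. *)
Lemma window_energy n (phi : 'I_n.+1 -> R -> quat R) t :
  (\int[mu]_x (`|windowed phi x t| ^+ 2)%:E = (2 * \sum_(j < n.+1) `|phi j t| ^+ 2)%:E)%E.
Proof.
pose c (j : 'I_n.+1) l := qcoord l (phi j t).
pose T (l : 'I_4) (j k : 'I_n.+1) x := c j l * c k l * (window j (t - x) * window k (t - x)).
have E x : `|windowed phi x t| ^+ 2 = \sum_(l < 4) \sum_(j < n.+1) \sum_(k < n.+1) T l j k x.
  rewrite normq_sqr; apply: eq_bigr => l _.
  rewrite /windowed linear_sum /= expr2 big_distrlr /=; apply: eq_bigr => j _.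
  by apply: eq_bigr => k _; rewrite !linearZ /= /T /c; ring.
have H1 l j k : mu.-integrable setT (EFin \o T l j k).
  exact: (integrable_scale _ (window_orthogonal j k t).1).
have H1E l j k : \int[mu]_x T l j k x = c j l * c k l * (2 * (j == k)%:R).
  have [h1 h2] := window_orthogonal j k t.
  by rewrite RintegralZl// h2.
have H2 l j := Rintegral_sum (H1 l j).
have H3 l := Rintegral_sum (fun j => (H2 l j).1).
have H4 := Rintegral_sum (fun l => (H3 l).1).
under eq_integral do rewrite E.
rewrite -[LHS]fineK; last exact: (integrable_fin_num _ H4.1).
congr EFin; rewrite -/(Rintegral _ _ _) H4.2 mulr_sumr.
under eq_bigr => l _.
  rewrite (H3 l).2.
  under eq_bigr => j _.
    rewrite (H2 l j).2 (bigD1 j)//= big1 => [|k kj]; last first.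
      by rewrite H1E eq_sym (negbTE kj) !mulr0.
    rewrite H1E eqxx addr0.
    over.
  over.
rewrite exchange_big /=; apply: eq_bigr => j _.
by rewrite normq_sqr mulr_sumr; apply: eq_bigr => l _; rewrite /c; ring.
Qed.

Lemma qstft_energy n (I : quat R) (phi : 'I_n.+1 -> R -> quat R) : I ^+ 2 = -1 ->
  (forall j, inL2 mu (phi j)) ->
  quat_measurable (full_poly_qstft I phi) /\
  (\int[mu \x mu]_z (`|full_poly_qstft I phi z| ^+ 2)%:E =
   2%:E * \sum_(j < n.+1) \int[mu]_t (`|phi j t| ^+ 2)%:E)%E.
Proof.
move=> I2 hphi.
have VE : full_poly_qstft I phi = (fun z => quat_integral mu (fun t => phase I z.2 t * windowed phi z.1 t)).
  by apply/funext => -[x w]; rewrite full_poly_qstft_window.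
have mw := measurable_windowed (fun j => (hphi j).1).
have mV : quat_measurable (full_poly_qstft I phi).
  rewrite VE; apply/quat_measurableP => l.
  under eq_fun do rewrite qcoord_integral.
  apply: (@measurable_Rintegral R _ _ _ (measurableTypeR R) mu
    (fun z : (R * R) * R => qcoord l (phase I z.1.2 z.2 * windowed phi z.1.1 z.2))).
  move: l; apply/quat_measurableP; apply: quat_measurableM.
    have mph : measurable_fun setT (fun z : (R * R) * R => 2 * pi * z.1.2 * z.2).
      apply: measurable_funM => //; apply: measurable_funM => //.
      exact: measurableT_comp.
    apply: quat_measurable_slice; first exact: (measurableT_comp (@measurable_cos R) mph).
    by apply: measurable_funN; exact: (measurableT_comp (@measurable_sin R) mph).
  apply: (quat_measurable_comp mw (u := fun z : (R * R) * R => (z.1.1, z.2))).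
  apply: measurable_fun_pair => //; exact: measurableT_comp.
split=> //.
rewrite fubini_tonelli1//; last first.
  by apply/measurable_EFinP; apply: measurable_funX; exact: measurable_normq.
transitivity (\int[mu]_x \int[mu]_t (`|windowed phi x t| ^+ 2)%:E)%E.
  apply: eq_integral => x _; rewrite /fubini_F VE /=.
  by apply: quat_plancherel => // l; have [] := windowed_L2 x l hphi.
(* Integrating in x first makes the orthogonality of the windows available. *)
rewrite (fubini_tonelli (m1 := mu) (m2 := mu) (fun z : R * R => (`|windowed phi z.1 z.2| ^+ 2)%:E))//; last first.
  by apply/measurable_EFinP; apply: measurable_funX; exact: measurable_normq.
under eq_integral do rewrite window_energy EFinM -sumEFin.
rewrite ge0_integralZl//; last 2 first.
- apply: emeasurable_sum => j; exact: (measurable_int mu (inL2_integrable (hphi j))).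
- by move=> t _; apply: sume_ge0 => j _; rewrite lee_fin sqr_ge0.
rewrite ge0_integral_sum//; last first.
  by move=> j; exact: (measurable_int mu (inL2_integrable (hphi j))).
Qed.

End Assembly.

Theorem theorem6p7 (R : realType) (n : nat) (I : quat R) (hI : I ^+ 2 = -1)
    (phi : 'I_n.+1 -> R -> quat R)
    (hphi : forall j : 'I_n.+1, inL2 lebesgue_measure (phi j)) :
  inL2 (lebesgue_measure \x lebesgue_measure)%E (full_poly_qstft I phi) /\
  L2norm (lebesgue_measure \x lebesgue_measure)%E (full_poly_qstft I phi) =
    ((Num.sqrt 2)%:E * L2norm_vec lebesgue_measure phi)%E.
Proof.
have [mV EV] := qstft_energy hI hphi.
have S0 : (0 <= \sum_(j < n.+1) \int[lebesgue_measure]_t (`|phi j t| ^+ 2)%:E)%E.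
  by apply: sume_ge0 => j _; apply: integral_ge0 => t _; rewrite lee_fin sqr_ge0.
have E : L2norm (lebesgue_measure \x lebesgue_measure)%E (full_poly_qstft I phi) =
    ((Num.sqrt 2)%:E * L2norm_vec lebesgue_measure phi)%E.
  rewrite /L2norm EV sqrteM//; congr (_ * sqrte _)%E; apply: eq_bigr => j _.
  by rewrite sqr_sqrte//; apply: integral_ge0 => t _; rewrite lee_fin sqr_ge0.
split=> //; split=> //; rewrite /L2norm EV.
have : (\sum_(j < n.+1) \int[lebesgue_measure]_t (`|phi j t| ^+ 2)%:E < +oo)%E.
  apply: lte_sum_pinfty => j _; exact: (integrable_lty _ (inL2_integrable (hphi j))).
move: S0; case: (\sum_(j < n.+1) _)%E => [r|//|//] r0 _.
by rewrite -EFinM ltry.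
Qed.
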